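(* Let $a_n=[z^n]f_0(z)$ and $b_n=[z^n]f_1(z)$, where $f_0(z)=e^{z/(1-z)}$ and $f_1(z)=e^{x}E_1(x)$ with $x=1/(1-z)$, and let $\rho_n:=a_nb_n$. Then, as $n\to\infty$, $$\rho_n \sim -\,\frac{1}{2n^{3/2}}\sum_{k\ge 0} d_k n^{-k},$$ where $$d_k = \sum_{j=0}^{2k}(-1)^j c_j c_{2k-j},$$ and the constants $c_m$ ($m\ge 0$) are given by $$c_m = (-1)^m\sum_{j=0}^m \,\bigl([h^{m-j}]\exp(\mu(h))\bigr)\,\frac{(m-2j+3/2)_{2j}}{4^j\, j!},\qquad \mu(h) = h^{-1} - (e^h-1)^{-1} - \tfrac12.$$
   Context: $E_1(x):=\int_x^\infty \frac{e^{-t}}{t}\,dt$ is the exponential integral (principal branch; for $|z|<1$ the point $x=1/(1-z)$ lies in the right half-plane). Both $f_0$ and $f_1$ are analytic in the open unit disk, and $[z^n]f(z)$ denotes the coefficient of $z^n$ in the Maclaurin series of $f$; likewise $[h^n]$ for series in $h$. The function $\mu(h)$ has a removable singularity at $h=0$ with $\mu(0)=0$, so $\exp(\mu(h))$ has a Maclaurin expansion. $(x)_\ell:=x(x+1)\cdots(x+\ell-1)$ is the ascending factorial (Pochhammer symbol), $(x)_0=1$. The symbol $\sim$ denotes an asymptotic series in the sense of Poincaré: $u_n\sim g(n)\sum_{k\ge0}s_k n^{-k}$ means that for every fixed $N>0$, $u_n/g(n)=\sum_{k=0}^{N-1}s_k n^{-k}+O(n^{-N})$ as $n\to\infty$. 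*)

(* Defs.v *)
From Stdlib Require Import Reals Factorial ClassicalEpsilon.
From Coquelicot Require Import Coquelicot.
Open Scope R_scope.

(* [maclaurin f n] is [z^n] f(z), over R or C: the coefficients of the power
   series that converges to f on a neighbourhood of 0.  Such a sequence is
   unique when f is analytic at 0; otherwise the value is unspecified. *)
Definition maclaurin {K : AbsRing} (f : K -> K) : nat -> K :=
  epsilon (inhabits (fun _ => zero))
    (fun a => exists r : posreal,
       forall z : K, abs z < r -> is_pseries a z (f z)).

Definition Cexp (z : C) : C :=
  (exp (Re z) * cos (Im z), exp (Re z) * sin (Im z)).

(* Principal branch: the integral of e^{-t}/t is taken along the horizontal
   ray t = x + s, 0 <= s < +oo, which stays off the cut (-oo, 0] as soon as
   x does. *)
Definition expint_E1 (x : C) : C :=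
  RInt_gen (V := C_R_CompleteNormedModule)
    (fun s : R => (Cexp (- (x + RtoC s)) / (x + RtoC s))%C)
    (at_point 0) (Rbar_locally p_infty).

Definition f0 (z : C) : C := Cexp (z / (1 - z))%C.

Definition f1 (z : C) : C :=
  let x := (1 / (1 - z))%C in (Cexp x * expint_E1 x)%C.

Definition mu (h : R) : R :=
  if Req_dec_T h 0 then 0 else / h - / (exp h - 1) - 1 / 2.

Fixpoint pochhammer (x : R) (l : nat) : R :=
  match l with
  | O => 1
  | S l' => pochhammer x l' * (x + INR l')
  end.

(* Coquelicot's [sum_n u m] is u 0 + ... + u m, with m + 1 terms. *)
Definition c (m : nat) : R :=
  (-1) ^ m *
  sum_n (fun j : nat =>
    maclaurin (K := R_AbsRing) (fun h : R => exp (mu h)) (m - j) *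
    (pochhammer (INR m - 2 * INR j + 3 / 2) (2 * j) /
     (4 ^ j * INR (fact j)))) m.

Definition d (k : nat) : R :=
  sum_n (fun j : nat => (-1) ^ j * c j * c (2 * k - j)) (2 * k).

(* u n ~ g n * (s 0 + s 1 / n + s 2 / n^2 + ...) in the sense of Poincare. *)
Definition asymptotic_series (u : nat -> C) (g s : nat -> R) : Prop :=
  forall N : nat, (0 < N)%nat ->
  exists M : R, eventually (fun n : nat =>
    Cmod (u n / RtoC (g n) -
          RtoC (sum_n (fun k : nat => s k / INR n ^ k)%R (N - 1)))%C
    <= M / INR n ^ N).

(* Main.v *)
Require Import Defs.
From Stdlib Require Import Reals Lra Lia Factorial ClassicalEpsilon.
From Coquelicot Require Import Coquelicot.
Open Scope R_scope.

(** Both coefficient sequences solve the recurrence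
    (n+1) u_{n+1} - (2n+1) u_n + (n-1) u_{n-1} = 0, because f_0 and f_1 solve
    (1-z)^2 f' = f up to a polynomial.  The coefficient b_n is minus a moment,
    b_n = - int_0^1 p^{n-1} phi(p) dp with phi(p) = exp(-p/(1-p)); it is the
    recessive solution, a_n is a dominant one, and their Casoratian is known
    exactly ([moment_wronskian]).

    The expansion of b_n is a Laplace-type computation.  With p = e^{-h} the
    integrand becomes exp(-nh - 1/h) exp(mu(h)), up to the factor e^{1/2}, and
    h = w(u)/sqrt n with w(u) = (u + sqrt(1+u^2))^2 turns nh + 1/h into
    sqrt n (2 + 4 u^2).  Expanding exp(mu) in powers of h leaves integrals of
    Bessel type, whose Gaussian expansion produces the Pochhammer symbols; this
    gives b_n ~ - K x^{3/2} e^{-2/x} sum_m c_m (-x)^m for x = 1/sqrt n and some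
    K > 0 ([moment_asymptotic]).

    For a_n no integral is expanded.  Insert x^{3/2} e^{-2/x} P(-x), with P a
    truncation of sum_m c_m x^m, in the recurrence.  After division by the
    envelope the residual is a function of x with Taylor expansions of every
    order at 0, on both sides.  The expansion of b_n makes it O(x^N) along
    x = 1/sqrt n, hence all its coefficients below x^N vanish, and it is
    O(|x|^N) for negative x too ([jet_reflection]).  Changing x into -x says
    precisely that A_n = x^{3/2} e^{2/x} P(x) solves the recurrence up to
    O(x^N) as well ([residual_small]).

    It remains to compare a_n with A_n.  The Casoratian of (b_n) and (A_n) is
    almost constant after multiplication by n(n+1), and its limit 2K is read
    off from the first-order terms ([casoratian_rate]).  So a_n and A_n/(2K)
    have nearly the same Casoratian with (b_n), and since b_n b_{n+1} decreases
    fast, b_n (a_n - A_n/(2K)) is as small as desired ([defect_small]).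
    The product a_n b_n is then - (x^3/2) P(x) P(-x) up to negligible terms: K
    cancels, odd powers of x cancel, and the even ones are the d_k. *)

(** * Finite sums and power series *)

Fixpoint psum (f : nat -> R) (n : nat) : R :=
  match n with O => 0 | S m => psum f m + f m end.

Lemma psum_ext f g n : (forall k, (k < n)%nat -> f k = g k) -> psum f n = psum g n.
Proof.
  induction n as [|n IH]; simpl; intros H; [reflexivity|].
  rewrite IH, H; auto with arith.
Qed.

Lemma psum_plus f g n : psum (fun k => f k + g k) n = psum f n + psum g n.
Proof. induction n as [|n IH]; simpl; [ring|rewrite IH; ring]. Qed.

Lemma psum_scal a f n : psum (fun k => a * f k) n = a * psum f n.
Proof. induction n as [|n IH]; simpl; [ring|rewrite IH; ring]. Qed.

Lemma psum_Sl f n : psum f (S n) = f 0%nat + psum (fun k => f (S k)) n.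
Proof.
  induction n as [|n IH]; [simpl; ring|].
  change (psum f (S n) + f (S n) = f 0%nat + (psum (fun k => f (S k)) n + f (S n))).
  rewrite IH; ring.
Qed.

Lemma psum_rev (g : nat -> R) n : psum g (S n) = psum (fun j => g (n - j)%nat) (S n).
Proof.
  induction n as [|n IH]; [reflexivity|].
  rewrite (psum_Sl (fun j => g (S n - j)%nat)). change (psum g (S (S n))) with (psum g (S n) + g (S n)).
  rewrite IH. replace (S n - 0)%nat with (S n) by lia. rewrite Rplus_comm. reflexivity.
Qed.

Lemma psum_sum_n f n : sum_n f n = psum f (S n).
Proof.
  induction n as [|n IH].
  - rewrite sum_O; simpl; symmetry; apply Rplus_0_l.
  - rewrite sum_Sn, IH; reflexivity.
Qed.

Lemma psum_sum_f_R0 f n : sum_f_R0 f n = psum f (S n).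
Proof.
  induction n as [|n IH]; simpl in *; [ring|rewrite IH; ring].
Qed.

Lemma psum_le f g n : (forall k, (k < n)%nat -> f k <= g k) -> psum f n <= psum g n.
Proof.
  induction n as [|n IH]; simpl; intros H; [lra|].
  apply Rplus_le_compat; [apply IH|apply H]; auto with arith.
Qed.

Lemma psum_Rabs f n : Rabs (psum f n) <= psum (fun k => Rabs (f k)) n.
Proof.
  induction n as [|n IH]; simpl; [rewrite Rabs_R0; lra|].
  eapply Rle_trans; [apply Rabs_triang|lra].
Qed.

(** Course-of-values recursion for real sequences, used for the coefficients
    of a reciprocal and of an exponential. *)
Lemma strong_recursion (F : nat -> (nat -> R) -> R) :
  (forall n f g, (forall k, (k < n)%nat -> f k = g k) -> F n f = F n g) ->
  exists f, forall n, f n = F n f.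
Proof.
  intros HF.
  set (tbl := fix tbl (n : nat) : nat -> R :=
    match n with
    | O => fun _ => 0
    | S m => fun k => if Nat.ltb k m then tbl m k else F m (tbl m)
    end).
  exists (fun n => tbl (S n) n).
  assert (Hst : forall n m k, (k < n)%nat -> (n <= m)%nat -> tbl m k = tbl (S k) k).
  { intros n m; revert n.
    induction m as [|m IH]; intros n k Hk Hn; [lia|].
    destruct (Nat.eq_dec k m) as [->|Hkm]; [reflexivity|].
    change (tbl (S m) k) with (if Nat.ltb k m then tbl m k else F m (tbl m)).
    replace (Nat.ltb k m) with true by (symmetry; apply Nat.ltb_lt; lia).
    apply (IH (S k)); lia. }
  intros n.
  change (tbl (S n) n) with (if Nat.ltb n n then tbl n n else F n (tbl n)).
  rewrite Nat.ltb_irrefl.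
  apply HF; intros k Hk. apply (Hst n); lia.
Qed.

Definition geometric (r : R) (a : nat -> R) : Prop :=
  exists M, forall n, Rabs (a n) <= M * r ^ n.

(** Coefficients of order r^n are summable against any point of modulus below
    1/r, which bounds the radius of convergence from below. *)
Lemma geometric_radius r a x :
  0 < r -> geometric r a -> Rabs x * r < 1 -> Rbar_lt (Rabs x) (CV_radius a).
Proof.
  intros Hr [M HM] Hx.
  set (y := (Rabs x + / r) / 2).
  assert (Hxr : Rabs x < / r).
  { apply Rmult_lt_reg_r with r; [exact Hr|]. rewrite Rinv_l; lra. }
  assert (Hy : Rabs x < y < / r) by (unfold y; lra).
  apply Rbar_lt_le_trans with y; [exact (proj1 Hy)|].
  unfold CV_radius.
  apply (proj1 (Lub_Rbar_correct (CV_disk a))).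
  unfold CV_disk.
  pose proof (Rabs_pos x) as Hx0.
  assert (Hyr : 0 <= r * y < 1).
  { split; [apply Rmult_le_pos; lra|].
    replace 1 with (r * / r) by (field; lra).
    apply Rmult_lt_compat_l; lra. }
  apply (ex_series_le (K := R_AbsRing) (V := R_CompleteNormedModule)
           _ (fun n => M * (r * y) ^ n)).
  - intros n. unfold norm; simpl. unfold abs; simpl.
    rewrite Rabs_Rabsolu, Rabs_mult, Rpow_mult_distr, <- Rmult_assoc.
    rewrite (Rabs_right (y ^ n)) by (apply Rle_ge, pow_le; lra).
    apply Rmult_le_compat_r; [apply pow_le; lra|apply HM].
  - apply (ex_series_scal (K := R_AbsRing) M (fun n => (r * y) ^ n)), ex_series_geom.
    rewrite Rabs_right; lra.
Qed.

Lemma geometric_pseries r a x :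
  0 < r -> geometric r a -> Rabs x * r < 1 -> is_pseries a x (PSeries a x).
Proof.
  intros Hr Ha Hx. apply PSeries_correct, CV_radius_inside.
  exact (geometric_radius r a x Hr Ha Hx).
Qed.

Lemma PSeries_bound r M a x :
  0 < r -> 0 <= M -> (forall n, Rabs (a n) <= M * r ^ n) -> Rabs x * r <= / 2 ->
  Rabs (PSeries a x) <= 2 * M.
Proof.
  intros Hr HM Ha Hx.
  assert (Hgeo : ex_series (fun n => M * (/ 2) ^ n)).
  { apply (ex_series_scal (K := R_AbsRing) M (fun n => (/ 2) ^ n)), ex_series_geom.
    rewrite Rabs_right; lra. }
  assert (Hle : forall n, 0 <= Rabs (a n * x ^ n) <= M * (/ 2) ^ n).
  { intros n; split; [apply Rabs_pos|].
    rewrite Rabs_mult, <- RPow_abs.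
    apply Rle_trans with (M * r ^ n * Rabs x ^ n).
    - apply Rmult_le_compat_r; [apply pow_le, Rabs_pos|apply Ha].
    - rewrite Rmult_assoc, <- Rpow_mult_distr.
      apply Rmult_le_compat_l; [exact HM|].
      apply pow_incr. split; [apply Rmult_le_pos; [lra|apply Rabs_pos]|lra]. }
  unfold PSeries.
  apply Rle_trans with (Series (fun n => Rabs (a n * x ^ n))).
  - apply Series_Rabs.
    apply (ex_series_le (K := R_AbsRing) (V := R_CompleteNormedModule)
             _ (fun n => M * (/ 2) ^ n)); [|exact Hgeo].
    intros n. unfold norm; simpl; unfold abs; simpl.
    rewrite Rabs_Rabsolu; apply Hle.
  - eapply Rle_trans; [apply Series_le; [exact Hle|exact Hgeo]|].
    rewrite (Series_scal_l M (fun n => (/ 2) ^ n)), Series_geom by (rewrite Rabs_right; lra).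
    lra.
Qed.

(** Peel off one coefficient at a time: the shifted series is again of
    geometric type, so its sum stays bounded on the same disc. *)
Lemma PSeries_tail r a N :
  0 < r -> geometric r a ->
  exists C, 0 <= C /\ forall x, Rabs x * r <= / 2 ->
    Rabs (PSeries a x - psum (fun k => a k * x ^ k) N) <= C * Rabs x ^ N.
Proof.
  intros Hr [M HM].
  assert (HM0 : 0 <= M).
  { specialize (HM 0%nat); simpl in HM; pose proof (Rabs_pos (a 0%nat)); lra. }
  revert a M HM0 HM.
  induction N as [|N IH]; intros a M HM0 HM.
  - exists (2 * M); split; [lra|]. intros x Hx; simpl.
    rewrite Rminus_0_r, Rmult_1_r.
    apply (PSeries_bound r); assumption.
  - destruct (IH (PS_decr_1 a) (M * r)) as [C [HC0 HC]].
    + apply Rmult_le_pos; lra.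
    + intros n. unfold PS_decr_1. eapply Rle_trans; [apply HM|simpl; right; ring].
    + exists C; split; [exact HC0|]. intros x Hx.
      rewrite PSeries_decr_1
        by (exists (PSeries a x); apply (geometric_pseries r);
            [exact Hr|exists M; exact HM|lra]).
      rewrite psum_Sl.
      rewrite (psum_ext _ (fun k => x * (PS_decr_1 a k * x ^ k)))
        by (intros k _; unfold PS_decr_1; simpl; ring).
      rewrite psum_scal.
      replace (_ - _) with
        (x * (PSeries (PS_decr_1 a) x - psum (fun k => PS_decr_1 a k * x ^ k) N))
        by (simpl; ring).
      rewrite Rabs_mult; simpl.
      replace (C * (Rabs x * Rabs x ^ N)) with (Rabs x * (C * Rabs x ^ N)) by ring.
      apply Rmult_le_compat_l; [apply Rabs_pos|apply HC; exact Hx].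
Qed.

Lemma null_derivative_const (f : R -> R) r x :
  (forall t, Rabs t < r -> is_derive f t 0) -> Rabs x < r -> f x = f 0.
Proof.
  intros Hf Hx.
  destruct (MVT_gen f 0 x (fun _ => 0)) as [c [_ Hc]].
  - intros t Ht. apply Hf. revert Hx Ht.
    unfold Rmin, Rmax, Rabs; destruct (Rle_dec 0 x); destruct (Rcase_abs x), (Rcase_abs t); lra.
  - intros t Ht. apply continuity_pt_filterlim.
    apply (ex_derive_continuous (K := R_AbsRing) (V := R_NormedModule)).
    exists 0; apply Hf. revert Hx Ht.
    unfold Rmin, Rmax, Rabs; destruct (Rle_dec 0 x); destruct (Rcase_abs x), (Rcase_abs t); lra.
  - lra.
Qed.

Lemma is_derive_Rmult (f g : R -> R) x f' g' :
  is_derive f x f' -> is_derive g x g' ->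
  is_derive (fun t => f t * g t) x (f' * g x + f x * g').
Proof.
  intros Hf Hg. exact (is_derive_mult f g x f' g' Hf Hg Rmult_comm).
Qed.

Lemma is_derive_Ropp (f : R -> R) x f' :
  is_derive f x f' -> is_derive (fun t => - f t) x (- f').
Proof. exact (is_derive_opp f x f'). Qed.

Lemma is_derive_exp_comp (f : R -> R) x f' :
  is_derive f x f' -> is_derive (fun t => exp (f t)) x (f' * exp (f x)).
Proof.
  intros Hf. exact (is_derive_comp exp f x _ f' (is_derive_exp (f x)) Hf).
Qed.

(** * The Maclaurin series of exp(mu) *)

(** The coefficients are forced by E' = m' E, that is (n+1) e_{n+1} = sum_k
    (k+1) m_{k+1} e_{n-k}. This recursion gives |e_n| <= 2^n, so the series
    converges, and E exp(-m) has zero derivative. *)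
Lemma PSeries_exp (m : nat -> R) :
  m 0%nat = 0 -> (forall n, Rabs (m n) <= 1) ->
  exists e : nat -> R, e 0%nat = 1 /\ (forall n, Rabs (e n) <= 2 ^ n) /\
    forall x, Rabs x < / 2 -> PSeries e x = exp (PSeries m x).
Proof.
  intros Hm0 Hm.
  destruct (strong_recursion (fun n e => match n with
      | O => 1
      | S n' => / INR (S n') * PS_mult (PS_derive m) e n' end)) as [e He].
  { intros [|n] f g Hfg; [reflexivity|].
    f_equal. unfold PS_mult. rewrite !psum_sum_f_R0. apply psum_ext.
    intros k Hk. rewrite Hfg by lia. reflexivity. }
  assert (Hb : forall n k, (k <= n)%nat -> Rabs (e k) <= 2 ^ k).
  { induction n as [|n IH]; intros k Hk.
    - replace k with 0%nat by lia. rewrite He, Rabs_R1; simpl; lra.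
    - destruct (Nat.eq_dec k (S n)) as [->|Hkn]; [|apply IH; lia].
      rewrite He.
      assert (Hn : 0 < INR (S n)) by (apply lt_0_INR; lia).
      rewrite Rabs_mult, (Rabs_right (/ INR (S n)))
        by (apply Rle_ge, Rlt_le, Rinv_0_lt_compat, Hn).
      apply Rmult_le_reg_l with (INR (S n)); [exact Hn|].
      rewrite <- Rmult_assoc, Rinv_r, Rmult_1_l by lra.
      unfold PS_mult. rewrite psum_sum_f_R0.
      eapply Rle_trans; [apply psum_Rabs|].
      assert (Hgeo : forall N, psum (fun k => 2 ^ (N - S k)) N <= 2 ^ N - 1).
      { induction N as [|N IHN]; [simpl; lra|].
        rewrite psum_Sl.
        simpl in *. replace (N - 0)%nat with N by lia. lra. }
      apply Rle_trans with (psum (fun k => INR (S n) * 2 ^ (S n - S k)) (S n)).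
      + apply psum_le. intros j Hj. rewrite Rabs_mult.
        apply Rmult_le_compat; try apply Rabs_pos.
        * unfold PS_derive. rewrite Rabs_mult, Rabs_right by (apply Rle_ge, pos_INR).
          rewrite <- (Rmult_1_r (INR (S n))).
          apply Rmult_le_compat; auto using pos_INR, Rabs_pos.
          apply le_INR; lia.
        * replace (S n - S j)%nat with (n - j)%nat by lia. apply IH; lia.
      + rewrite psum_scal. apply Rmult_le_compat_l; [lra|].
        eapply Rle_trans; [apply Hgeo|]. lra. }
  assert (Heb : forall n, Rabs (e n) <= 2 ^ n) by (intros n; apply (Hb n); lia).
  exists e. repeat split.
  - rewrite He; reflexivity.
  - exact Heb.
  - assert (Gm : geometric 1 m).
    { exists 1. intros n. rewrite pow1, Rmult_1_l. apply Hm. }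
    assert (Ge : geometric 2 e).
    { exists 1. intros n. rewrite Rmult_1_l. apply Heb. }
    assert (Rm : forall x, Rabs x < / 2 -> Rbar_lt (Rabs x) (CV_radius m)).
    { intros x Hx. apply (geometric_radius 1); [lra|exact Gm|lra]. }
    assert (Re : forall x, Rabs x < / 2 -> Rbar_lt (Rabs x) (CV_radius e)).
    { intros x Hx. apply (geometric_radius 2); [lra|exact Ge|lra]. }
    assert (Hode : forall x, Rabs x < / 2 ->
      PSeries (PS_derive e) x = PSeries (PS_derive m) x * PSeries e x).
    { intros x Hx. rewrite <- PSeries_mult.
      - apply PSeries_ext. intros n. unfold PS_derive at 1.
        rewrite He. field. apply not_0_INR; lia.
      - rewrite CV_radius_derive. apply Rm; exact Hx.
      - apply Re; exact Hx. }
    intros x Hx.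
    set (g := fun t => PSeries e t * exp (- PSeries m t)).
    assert (Hg : g x = g 0).
    { apply (null_derivative_const g (/ 2)); [|exact Hx].
      intros t Ht. unfold g.
      pose proof (is_derive_PSeries e t (Re t Ht)) as De.
      pose proof (is_derive_PSeries m t (Rm t Ht)) as Dm.
      rewrite Hode in De by exact Ht.
      evar_last.
      - exact (is_derive_Rmult _ _ _ _ _ De (is_derive_exp_comp _ _ _ (is_derive_Ropp _ _ _ Dm))).
      - simpl. ring. }
    unfold g in Hg. rewrite !PSeries_0, Hm0, Ropp_0, exp_0 in Hg.
    rewrite (He 0%nat), exp_Ropp in Hg.
    apply Rmult_eq_reg_r with (/ exp (PSeries m x)).
    + rewrite Hg, Rinv_r; [ring|]. apply Rgt_not_eq, exp_pos.
    + apply Rinv_neq_0_compat, Rgt_not_eq, exp_pos.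
Qed.

Lemma half_pow_fact n : / INR (fact (S (S n))) <= (/ 2) ^ S n.
Proof.
  induction n as [|n IH]; [simpl; lra|].
  change (fact (S (S (S n)))) with (S (S (S n)) * fact (S (S n)))%nat.
  rewrite mult_INR, Rinv_mult. change ((/ 2) ^ S (S n)) with (/ 2 * (/ 2) ^ S n).
  apply Rmult_le_compat; [| |apply Rinv_le_contravar; [lra|]|exact IH].
  - apply Rlt_le, Rinv_0_lt_compat, lt_0_INR; lia.
  - apply Rlt_le, Rinv_0_lt_compat, INR_fact_lt_0.
  - replace 2 with (INR 2) by reflexivity. apply le_INR; lia.
Qed.

(** The reciprocal of (e^h - 1)/h, so q_n is B_n/n!. The crude bound |q_n| <=
    1 holds because 1/2! + 1/3! + ... < 1. *)
Lemma bernoulli_series :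
  exists q : nat -> R, q 0%nat = 1 /\ q 1%nat = - / 2 /\ (forall n, Rabs (q n) <= 1) /\
    forall h, h <> 0 -> Rabs h < 1 -> PSeries q h = h / (exp h - 1).
Proof.
  destruct (strong_recursion (fun n q => match n with
      | O => 1
      | S n' => - PS_mult (fun k => / INR (fact (S (S k)))) q n' end)) as [q Hq].
  { intros [|n] f g Hfg; [reflexivity|].
    f_equal. unfold PS_mult. rewrite !psum_sum_f_R0. apply psum_ext.
    intros k Hk. rewrite Hfg by lia. reflexivity. }
  assert (Hb : forall n k, (k <= n)%nat -> Rabs (q k) <= 1).
  { induction n as [|n IH]; intros k Hk.
    - replace k with 0%nat by lia. rewrite Hq, Rabs_R1; lra.
    - destruct (Nat.eq_dec k (S n)) as [->|Hkn]; [|apply IH; lia].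
      rewrite Hq, Rabs_Ropp.
      unfold PS_mult. rewrite psum_sum_f_R0.
      eapply Rle_trans; [apply psum_Rabs|].
      assert (Hgeo : forall N, psum (fun k => (/ 2) ^ S k) N <= 1 - (/ 2) ^ N).
      { induction N as [|N IHN]; simpl in *; lra. }
      apply Rle_trans with (psum (fun k => (/ 2) ^ S k) (S n)).
      + apply psum_le. intros j Hj. rewrite Rabs_mult, Rabs_right
          by (apply Rle_ge, Rlt_le, Rinv_0_lt_compat, INR_fact_lt_0).
        rewrite <- (Rmult_1_r ((/ 2) ^ S j)).
        apply Rmult_le_compat; [|apply Rabs_pos|apply half_pow_fact|apply IH; lia].
        apply Rlt_le, Rinv_0_lt_compat, INR_fact_lt_0.
      + eapply Rle_trans; [apply Hgeo|].
        assert (0 <= (/ 2) ^ S n) by (apply pow_le; lra). lra. }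
  assert (Hq1 : forall n, Rabs (q n) <= 1) by (intros n; apply (Hb n); lia).
  exists q. repeat split.
  - rewrite Hq; reflexivity.
  - rewrite Hq; unfold PS_mult; simpl; rewrite Hq; lra.
  - exact Hq1.
  - intros h Hh0 Hh.
    set (g := PS_decr_1 (fun n => / INR (fact n))).
    assert (Gq : geometric 1 q) by (exists 1; intros n; rewrite pow1, Rmult_1_l; apply Hq1).
    assert (Gg : geometric 1 g).
    { exists 1. intros n. rewrite pow1, Rmult_1_l. unfold g, PS_decr_1.
      rewrite Rabs_right by (apply Rle_ge, Rlt_le, Rinv_0_lt_compat, INR_fact_lt_0).
      rewrite <- Rinv_1. apply Rinv_le_contravar; [lra|].
      apply (le_INR 1), lt_O_fact. }
    assert (Hexp : exp h = 1 + h * PSeries g h).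
    { rewrite exp_Reals, PSeries_decr_1.
      - simpl. unfold g. f_equal. lra.
      - exists (exp h). apply is_exp_Reals. }
    assert (Hprod : PSeries g h * PSeries q h = 1).
    { rewrite <- PSeries_mult
        by (apply (geometric_radius 1); [lra|assumption|lra]).
      rewrite (PSeries_ext _ (fun n => match n with O => 1 | S _ => 0 end)).
      - rewrite PSeries_decr_1.
        + rewrite (PSeries_ext _ (fun _ => 0)) by reflexivity.
          rewrite PSeries_const_0; ring.
        + exists (PSeries (fun n => match n with O => 1 | S _ => 0 end) h).
          apply (geometric_pseries 1); [lra| |lra].
          exists 1. intros [|n]; rewrite pow1; [rewrite Rabs_R1|rewrite Rabs_R0]; lra.
      - intros [|n].
        + unfold PS_mult, g, PS_decr_1; simpl. rewrite Hq. lra.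
        + unfold PS_mult. rewrite psum_sum_f_R0, psum_Sl.
          replace (S n - 0)%nat with (S n) by lia. rewrite Hq at 1.
          unfold PS_mult. rewrite psum_sum_f_R0.
          unfold g, PS_decr_1. simpl (S n - S _)%nat. simpl (fact 1). simpl (INR 1).
          lra. }
    rewrite Hexp. replace (1 + h * PSeries g h - 1) with (h * PSeries g h) by ring.
    assert (PSeries g h <> 0) by (intros Z; rewrite Z in Hprod; lra).
    apply Rmult_eq_reg_l with (PSeries g h); [|assumption].
    rewrite Hprod. field. split; assumption.
Qed.

Lemma exp_mu_series :
  exists e : nat -> R, e 0%nat = 1 /\ (forall n, Rabs (e n) <= 2 ^ n) /\
    forall h, Rabs h < / 2 -> PSeries e h = exp (mu h).
Proof.
  destruct bernoulli_series as [q [Hq0 [Hq1 [Hq Hser]]]].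
  set (m := fun n => match n with O => 0 | S _ => - q (S n) end).
  destruct (PSeries_exp m) as [e [He0 [Heb He]]].
  - reflexivity.
  - intros [|n]; simpl; [rewrite Rabs_R0; lra|rewrite Rabs_Ropp; apply Hq].
  - exists e. split; [exact He0|split; [exact Heb|]].
    intros h Hh. rewrite (He h Hh). f_equal.
    unfold mu. destruct (Req_dec_T h 0) as [->|Hh0].
    + rewrite PSeries_0; reflexivity.
    + assert (Gq : forall k, Rabs (q k) <= 1 * 1 ^ k)
        by (intros k; rewrite pow1, Rmult_1_l; apply Hq).
      assert (E := Hser h Hh0 ltac:(lra)).
      rewrite PSeries_decr_1 in E.
      2:{ exists (PSeries q h). apply (geometric_pseries 1); [lra|exists 1; exact Gq|lra]. }
      rewrite PSeries_decr_1 in E.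
      2:{ exists (PSeries (PS_decr_1 q) h).
          apply (geometric_pseries 1); [lra|exists 1|lra]. intros k; unfold PS_decr_1.
          rewrite pow1, Rmult_1_l; apply Hq. }
      rewrite PSeries_decr_1_aux by reflexivity.
      rewrite (PSeries_ext (PS_decr_1 m) (PS_scal (-1) (PS_decr_1 (PS_decr_1 q)))).
      2:{ intros n; unfold PS_decr_1, PS_scal, m, scal; simpl; unfold mult; simpl; ring. }
      rewrite PSeries_scal.
      unfold PS_decr_1 at 1 in E. rewrite Hq0, Hq1 in E.
      assert (Hne : exp h - 1 <> 0).
      { intros Z. apply Hh0. apply exp_inv. rewrite exp_0; lra. }
      replace (/ h - / (exp h - 1) - 1 / 2)
        with (/ h * (1 - h / (exp h - 1)) - 1 / 2) by (field; split; assumption).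
      rewrite <- E. field. exact Hh0.
Qed.

(** * The series of the inverse square root *)

Fixpoint inv_sqrt_coeff (j : nat) : R :=
  match j with
  | O => 1
  | S j' => - inv_sqrt_coeff j' * ((INR j' + 1 / 2) / (INR j' + 1))
  end.

Lemma inv_sqrt_coeff_bound j : Rabs (inv_sqrt_coeff j) <= 1.
Proof.
  induction j as [|j IH]; simpl; [rewrite Rabs_R1; lra|].
  pose proof (pos_INR j) as Hj.
  rewrite Rabs_mult, Rabs_Ropp. apply Rle_trans with (1 * 1); [|lra].
  assert (H : 0 <= (INR j + 1 / 2) / (INR j + 1) <= 1).
  { assert (0 < / (INR j + 1)) by (apply Rinv_0_lt_compat; lra).
    assert ((INR j + 1) * / (INR j + 1) = 1) by (apply Rinv_r; lra).
    unfold Rdiv; nra. }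
  rewrite (Rabs_right ((INR j + 1 / 2) / (INR j + 1))) by lra.
  apply Rmult_le_compat; [apply Rabs_pos|lra|exact IH|lra].
Qed.

Lemma inv_sqrt_coeff_geometric : geometric 1 inv_sqrt_coeff.
Proof. exists 1; intros n; rewrite pow1, Rmult_1_l; apply inv_sqrt_coeff_bound. Qed.

(** The series satisfies 2 (1+y) S' = - S, so S sqrt(1+y) is constant. *)
Lemma inv_sqrt_series y : Rabs y < 1 -> PSeries inv_sqrt_coeff y = / sqrt (1 + y).
Proof.
  intros Hy.
  assert (Rb : forall t, Rabs t < 1 -> Rbar_lt (Rabs t) (CV_radius inv_sqrt_coeff)).
  { intros t Ht. apply (geometric_radius 1); [lra|apply inv_sqrt_coeff_geometric|lra]. }
  assert (Hpos : forall t, Rabs t < 1 -> 0 < 1 + t).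
  { intros t Ht. apply Rabs_def2 in Ht. lra. }
  assert (Hode : forall t, Rabs t < 1 ->
    (1 + t) * PSeries (PS_derive inv_sqrt_coeff) t = - / 2 * PSeries inv_sqrt_coeff t).
  { intros t Ht.
    rewrite Rmult_plus_distr_r, Rmult_1_l, <- PSeries_incr_1, <- PSeries_plus, <- PSeries_scal.
    - apply PSeries_ext. intros [|n];
        unfold PS_plus, PS_incr_1, PS_derive, PS_scal, plus, scal; simpl.
      + unfold zero, mult; simpl. field.
      + unfold mult; simpl.
        pose proof (pos_INR n).
        replace (match n with 0%nat => 1 | S _ => INR n + 1 end) with (INR n + 1)
          by (destruct n; simpl; lra).
        field. lra.
    - apply ex_pseries_derive, Rb, Ht.
    - apply ex_pseries_incr_1, ex_pseries_derive, Rb, Ht. }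
  set (g := fun t => PSeries inv_sqrt_coeff t * sqrt (1 + t)).
  assert (Hg : g y = g 0).
  { apply (null_derivative_const g 1); [|exact Hy].
    intros t Ht. unfold g.
    pose proof (is_derive_PSeries inv_sqrt_coeff t (Rb t Ht)) as De.
    pose proof (Hpos t Ht) as Hp.
    assert (Ds : is_derive (fun t => sqrt (1 + t)) t (/ (2 * sqrt (1 + t)))).
    { auto_derive; [lra|]. field. apply Rgt_not_eq, sqrt_lt_R0; lra. }
    evar_last; [exact (is_derive_Rmult _ _ _ _ _ De Ds)|].
    simpl. pose proof (sqrt_lt_R0 _ Hp) as Hs.
    apply Rmult_eq_reg_r with (sqrt (1 + t)); [|lra].
    rewrite Rmult_0_l, Rmult_plus_distr_r, Rmult_assoc, sqrt_sqrt by lra.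
    rewrite (Rmult_comm _ (1 + t)), Hode by exact Ht. field. lra. }
  unfold g in Hg. rewrite PSeries_0, Rplus_0_r, sqrt_1 in Hg.
  pose proof (sqrt_lt_R0 _ (Hpos y Hy)) as Hs.
  apply Rmult_eq_reg_r with (sqrt (1 + y)); [|lra].
  rewrite Hg, Rinv_l by lra. simpl; ring.
Qed.

(** * Uniqueness of Maclaurin coefficients *)

Lemma CV_radius_pos_of_series (a : nat -> R) x l :
  0 < x -> is_pseries a x l -> Rbar_lt 0 (CV_radius a).
Proof.
  intros Hx Ha.
  apply Rbar_lt_le_trans with (Rabs x).
  - simpl. rewrite Rabs_right; lra.
  - apply Rbar_not_lt_le. intros Hlt.
    apply (CV_disk_outside a x Hlt).
    apply (is_lim_seq_ext (fun n => scal (pow_n x n) (a n))).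
    + intros n. rewrite pow_n_pow. unfold scal; simpl; unfold mult; simpl. ring.
    + apply ex_series_lim_0. exists l; exact Ha.
Qed.

Lemma pseries_coeff_unique (a b : nat -> R) (f : R -> R) r :
  0 < r -> (forall x, Rabs x < r -> is_pseries a x (f x)) ->
  (forall x, Rabs x < r -> is_pseries b x (f x)) -> forall n, a n = b n.
Proof.
  intros Hr Ha Hb n.
  assert (Hr2 : Rabs (r / 2) < r) by (rewrite Rabs_right; lra).
  apply PSeries_ext_recip.
  - apply (CV_radius_pos_of_series a (r / 2) (f (r / 2))); [lra|apply Ha, Hr2].
  - apply (CV_radius_pos_of_series b (r / 2) (f (r / 2))); [lra|apply Hb, Hr2].
  - exists (mkposreal r Hr). intros y Hy.
    assert (Hyr : Rabs y < r).
    { unfold ball in Hy; simpl in Hy. unfold AbsRing_ball, abs, minus, plus, opp in Hy; simpl in Hy.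
      rewrite Ropp_0, Rplus_0_r in Hy. exact Hy. }
    rewrite (is_pseries_unique _ _ _ (Ha y Hyr)).
    rewrite (is_pseries_unique _ _ _ (Hb y Hyr)). reflexivity.
Qed.

Lemma maclaurin_R_eq (f : R -> R) (a : nat -> R) r :
  0 < r -> (forall x, Rabs x < r -> is_pseries a x (f x)) ->
  forall n, maclaurin (K := R_AbsRing) f n = a n.
Proof.
  intros Hr Ha n. unfold maclaurin.
  match goal with |- epsilon ?i ?P n = _ =>
    destruct (epsilon_spec i P) as [r' Hr'] end.
  { exists a, (mkposreal r Hr). exact Ha. }
  apply (pseries_coeff_unique _ _ f (Rmin r r')).
  - apply Rmin_glb_lt; [exact Hr|apply cond_pos].
  - intros x Hx. apply Hr'. exact (Rlt_le_trans _ _ _ Hx (Rmin_r _ _)).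
  - intros x Hx. apply Ha. exact (Rlt_le_trans _ _ _ Hx (Rmin_l _ _)).
Qed.

Fixpoint Csum (u : nat -> C) (n : nat) : C :=
  match n with O => 0%C | S m => (Csum u m + u m)%C end.

Lemma is_series_C_iff (u : nat -> C) (l : C) :
  @is_series C_AbsRing (AbsRing_NormedModule C_AbsRing) u l <->
  forall eps : posreal, eventually (fun n => Cmod (Csum u n - l)%C < eps).
Proof.
  assert (Hs : forall n, @sum_n (AbsRing_NormedModule C_AbsRing) u n = Csum u (S n)).
  { induction n as [|n IH].
    - rewrite sum_O. simpl. symmetry; apply Cplus_0_l.
    - rewrite sum_Sn, IH. reflexivity. }
  pose proof (filterlim_locally (F := eventually)
    (U := NormedModule.UniformSpace _ (AbsRing_NormedModule C_AbsRing))
    (@sum_n (AbsRing_NormedModule C_AbsRing) u) l) as E.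
  unfold is_series. refine (iff_trans E _). clear E.
  split; intros H eps; destruct (H eps) as [N HN].
  - exists (S N). intros [|n] Hn; [lia|]. rewrite <- Hs. apply HN; lia.
  - exists N. intros n Hn. rewrite Hs. apply HN; lia.
Qed.

Lemma is_series_R_iff (u : nat -> R) (l : R) :
  @is_series R_AbsRing (AbsRing_NormedModule R_AbsRing) u l <->
  forall eps : posreal, eventually (fun n => Rabs (psum u n - l) < eps).
Proof.
  pose proof (filterlim_locally (F := eventually)
    (U := NormedModule.UniformSpace _ (AbsRing_NormedModule R_AbsRing))
    (@sum_n (AbsRing_NormedModule R_AbsRing) u) l) as E.
  unfold is_series. refine (iff_trans E _). clear E.
  split; intros H eps; destruct (H eps) as [N HN].
  - exists (S N). intros [|n] Hn; [lia|]. rewrite <- psum_sum_n. apply HN; lia.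
  - exists N. intros n Hn.
    change (Rabs (@sum_n R_AbelianMonoid u n - l) < eps).
    rewrite psum_sum_n. apply HN; lia.
Qed.

Lemma Rabs_Re_le (z : C) : Rabs (Re z) <= Cmod z.
Proof.
  eapply Rle_trans; [|apply Rmax_Cmod]. apply Rmax_l.
Qed.

Lemma Rabs_Im_le (z : C) : Rabs (Im z) <= Cmod z.
Proof.
  eapply Rle_trans; [|apply Rmax_Cmod]. apply Rmax_r.
Qed.

Lemma Re_Csum u n : Re (Csum u n) = psum (fun k => Re (u k)) n.
Proof. induction n as [|n IH]; [reflexivity|]. simpl. rewrite <- IH. reflexivity. Qed.

Lemma Im_Csum u n : Im (Csum u n) = psum (fun k => Im (u k)) n.
Proof. induction n as [|n IH]; [reflexivity|]. simpl. rewrite <- IH. reflexivity. Qed.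

Lemma pow_n_C_RtoC (t : R) n : pow_n (K := C_AbsRing) (RtoC t) n = RtoC (t ^ n).
Proof.
  induction n as [|n IH]; [reflexivity|]. simpl. rewrite IH, RtoC_mult. reflexivity.
Qed.

(** On the real axis the powers of the variable are real, so a complex power
    series splits into two real ones; this reduces uniqueness over C to
    uniqueness over R. *)
Lemma is_pseries_C_real_axis (a : nat -> C) (t : R) (l : C) :
  @is_pseries C_AbsRing (AbsRing_NormedModule C_AbsRing) a (RtoC t) l ->
  is_pseries (fun n => Re (a n)) t (Re l) /\ is_pseries (fun n => Im (a n)) t (Im l).
Proof.
  unfold is_pseries. intros H.
  assert (H' := proj1 (is_series_C_iff _ _) H). clear H.
  split; apply is_series_R_iff; intros eps; destruct (H' eps) as [N HN];
    exists N; intros n Hn; specialize (HN n Hn);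
    refine (Rle_lt_trans _ _ _ _ HN).
  - eapply Rle_trans; [|apply Rabs_Re_le]. right. f_equal.
    unfold Cminus, Cplus, Copp; simpl. fold (Re l).
    change (fst (Csum ?u n)) with (Re (Csum u n)). rewrite Re_Csum.
    unfold Rminus. f_equal. apply psum_ext; intros k _.
    rewrite pow_n_C_RtoC, pow_n_pow.
    unfold scal; simpl; unfold mult; simpl. unfold Cmult, RtoC, Re; simpl. ring.
  - eapply Rle_trans; [|apply Rabs_Im_le]. right. f_equal.
    unfold Cminus, Cplus, Copp; simpl. fold (Im l).
    change (snd (Csum ?u n)) with (Im (Csum u n)). rewrite Im_Csum.
    unfold Rminus. f_equal. apply psum_ext; intros k _.
    rewrite pow_n_C_RtoC, pow_n_pow.
    unfold scal; simpl; unfold mult; simpl. unfold Cmult, RtoC, Im; simpl. ring.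
Qed.

Lemma maclaurin_C_eq (f : C -> C) (a : nat -> C) r :
  0 < r ->
  (forall z, Cmod z < r -> @is_pseries C_AbsRing (AbsRing_NormedModule C_AbsRing) a z (f z)) ->
  forall n, maclaurin (K := C_AbsRing) f n = a n.
Proof.
  intros Hr Ha n. unfold maclaurin.
  match goal with |- epsilon ?i ?P n = _ =>
    destruct (epsilon_spec i P) as [r' Hr']; [|set (b := epsilon i P) in *] end.
  { exists a, (mkposreal r Hr). exact Ha. }
  change (forall z, Cmod z < r' -> is_pseries b z (f z)) in Hr'.
  assert (H : forall t, Rabs t < Rmin r r' -> Cmod (RtoC t) < r /\ Cmod (RtoC t) < r').
  { intros t Ht. rewrite Cmod_R. split.
    - exact (Rlt_le_trans _ _ _ Ht (Rmin_l _ _)).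
    - exact (Rlt_le_trans _ _ _ Ht (Rmin_r _ _)). }
  assert (Hm : 0 < Rmin r r') by (apply Rmin_glb_lt; [exact Hr|apply cond_pos]).
  apply injective_projections.
  - apply (pseries_coeff_unique (fun n => Re (b n)) (fun n => Re (a n))
             (fun t => Re (f (RtoC t))) _ Hm); intros t Ht.
    + apply (is_pseries_C_real_axis b), Hr', H, Ht.
    + apply (is_pseries_C_real_axis a), Ha, H, Ht.
  - apply (pseries_coeff_unique (fun n => Im (b n)) (fun n => Im (a n))
             (fun t => Im (f (RtoC t))) _ Hm); intros t Ht.
    + apply (is_pseries_C_real_axis b), Hr', H, Ht.
    + apply (is_pseries_C_real_axis a), Ha, H, Ht.
Qed.

(** * The Maclaurin series of f_0 *)

(** Rewrites the derivatives left by [auto_derive], which are stated for an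
    eta-expanded function. *)
Ltac derive_by H :=
  match type of H with
  | ?D = _ => repeat match goal with
      |- context [Derive ?f ?x] => progress change (Derive f x) with D end;
      rewrite ?H
  end.

(** The recurrence has order two, hence the pair of consecutive values. *)
Fixpoint acoef_pair (n : nat) : R * R :=
  match n with
  | O => (1, 1)
  | S m => (snd (acoef_pair m),
            ((2 * INR m + 3) * snd (acoef_pair m) - INR m * fst (acoef_pair m)) / (INR m + 2))
  end.

Definition acoef (n : nat) : R := fst (acoef_pair n).

Lemma acoef_recurrence n :
  (INR n + 2) * acoef (S (S n)) = (2 * INR n + 3) * acoef (S n) - INR n * acoef n.
Proof.
  unfold acoef. simpl. field. pose proof (pos_INR n); lra.
Qed.

Lemma acoef_bound n : Rabs (acoef n) <= 3 ^ n.
Proof.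
  cut (Rabs (acoef n) <= 3 ^ n /\ Rabs (acoef (S n)) <= 3 ^ S n); [tauto|].
  induction n as [|n [IH1 IH2]].
  - unfold acoef; simpl. rewrite Rabs_R1; lra.
  - split; [exact IH2|].
    pose proof (pos_INR n) as Hn.
    apply Rmult_le_reg_l with (INR n + 2); [lra|].
    rewrite <- (Rabs_right (INR n + 2)) at 1 by lra.
    rewrite <- Rabs_mult, acoef_recurrence.
    eapply Rle_trans; [apply Rabs_triang|].
    rewrite Rabs_Ropp, !Rabs_mult, (Rabs_right (INR n)), (Rabs_right (2 * INR n + 3)) by lra.
    pose proof (pow_lt 3 n ltac:(lra)). simpl in *. nra.
Qed.

Definition Cderive (F : R -> C) (t : R) (l : C) : Prop :=
  is_derive (fun s => Re (F s)) t (Re l) /\ is_derive (fun s => Im (F s)) t (Im l).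

Lemma Cderive_mult (F G : R -> C) t f g :
  Cderive F t f -> Cderive G t g ->
  Cderive (fun s => F s * G s)%C t (f * G t + F t * g)%C.
Proof.
  intros [Fr Fi] [Gr Gi].
  split.
  - evar_last.
    + exact (is_derive_minus _ _ _ _ _ (is_derive_Rmult _ _ _ _ _ Fr Gr)
               (is_derive_Rmult _ _ _ _ _ Fi Gi)).
    + unfold minus, plus, opp; simpl. unfold Re, Im; simpl. ring.
  - evar_last.
    + exact (is_derive_plus _ _ _ _ _ (is_derive_Rmult _ _ _ _ _ Fr Gi)
               (is_derive_Rmult _ _ _ _ _ Fi Gr)).
    + unfold plus; simpl. unfold Re, Im; simpl. ring.
Qed.

Lemma Cderive_Cexp (F : R -> C) t f : Cderive F t f -> Cderive (fun s => Cexp (F s)) t (f * Cexp (F t))%C.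
Proof.
  assert (Hr : forall (a b : R -> R) a' b', is_derive a t a' -> is_derive b t b' ->
    is_derive (fun s => exp (a s) * cos (b s)) t
      (a' * (exp (a t) * cos (b t)) - b' * (exp (a t) * sin (b t)))).
  { intros a b a' b' Ha Hb. auto_derive.
    - repeat split; eexists; eassumption.
    - derive_by (is_derive_unique a t a' Ha). derive_by (is_derive_unique b t b' Hb). ring. }
  assert (Hi : forall (a b : R -> R) a' b', is_derive a t a' -> is_derive b t b' ->
    is_derive (fun s => exp (a s) * sin (b s)) t
      (a' * (exp (a t) * sin (b t)) + b' * (exp (a t) * cos (b t)))).
  { intros a b a' b' Ha Hb. auto_derive.
    - repeat split; eexists; eassumption.
    - derive_by (is_derive_unique a t a' Ha). derive_by (is_derive_unique b t b' Hb). ring. }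
  intros [Fr Fi]. split; [exact (Hr _ _ _ _ Fr Fi)|exact (Hi _ _ _ _ Fr Fi)].
Qed.

Lemma C_sumsq_neq0 (z : C) : z <> 0%C -> Re z ^ 2 + Im z ^ 2 <> 0.
Proof.
  intros Hz H. apply Hz. destruct z as [a b]; unfold Re, Im in H; simpl in H.
  assert (a = 0) by nra. assert (b = 0) by nra. subst; reflexivity.
Qed.

Lemma Cderive_inv (F : R -> C) t f :
  F t <> 0%C -> Cderive F t f -> Cderive (fun s => / F s)%C t (- f * (/ F t * / F t))%C.
Proof.
  assert (Hr : forall (a b : R -> R) a' b', a t ^ 2 + b t ^ 2 <> 0 ->
    is_derive a t a' -> is_derive b t b' ->
    is_derive (fun s => a s / (a s ^ 2 + b s ^ 2)) t
      (- (a' * (a t ^ 2 - b t ^ 2) + b' * (2 * a t * b t)) / (a t ^ 2 + b t ^ 2) ^ 2)).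
  { intros a b a' b' H1 Ha Hb. auto_derive.
    - simpl in *. repeat split; try (eexists; eassumption). exact H1.
    - derive_by (is_derive_unique a t a' Ha). derive_by (is_derive_unique b t b' Hb).
      field. simpl in H1. exact H1. }
  assert (Hi : forall (a b : R -> R) a' b', a t ^ 2 + b t ^ 2 <> 0 ->
    is_derive a t a' -> is_derive b t b' ->
    is_derive (fun s => - b s / (a s ^ 2 + b s ^ 2)) t
      ((a' * (2 * a t * b t) - b' * (a t ^ 2 - b t ^ 2)) / (a t ^ 2 + b t ^ 2) ^ 2)).
  { intros a b a' b' H1 Ha Hb. auto_derive.
    - simpl in *. repeat split; try (eexists; eassumption). exact H1.
    - derive_by (is_derive_unique a t a' Ha). derive_by (is_derive_unique b t b' Hb).
      field. simpl in H1. exact H1. }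
  intros H0 [Fr Fi].
  pose proof (C_sumsq_neq0 _ H0) as H1.
  split.
  - evar_last; [exact (Hr _ _ _ _ H1 Fr Fi)|].
    unfold Re, Im in *; simpl in *. field. intros E; apply H1; rewrite <- E; ring.
  - evar_last; [exact (Hi _ _ _ _ H1 Fr Fi)|].
    unfold Re, Im in *; simpl in *. field. intros E; apply H1; rewrite <- E; ring.
Qed.

Lemma Cexp_plus z w : Cexp (z + w) = (Cexp z * Cexp w)%C.
Proof.
  unfold Cexp, Cmult, Cplus, Re, Im; simpl.
  rewrite exp_plus, cos_plus, sin_plus. f_equal; ring.
Qed.

Lemma Cexp_0 : Cexp 0 = 1%C.
Proof. unfold Cexp; simpl. rewrite exp_0, cos_0, sin_0. unfold RtoC; f_equal; ring. Qed.

Lemma pow_n_Cpow (z : C) n : pow_n (K := C_AbsRing) z n = (z ^ n)%C.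
Proof. induction n as [|n IH]; [reflexivity|]. simpl. rewrite IH. reflexivity. Qed.

(** A power series with complex coefficients in a real variable: the
    restriction of a complex power series to a ray. *)
Definition Cpseries (u : nat -> C) (t : R) : C :=
  (PSeries (fun n => Re (u n)) t, PSeries (fun n => Im (u n)) t).

Definition Cconv (u : nat -> C) (t : R) : Prop :=
  ex_pseries (fun n => Re (u n)) t /\ ex_pseries (fun n => Im (u n)) t.

Definition Cincr (u : nat -> C) (n : nat) : C :=
  match n with O => 0%C | S m => u m end.

Definition Cder (u : nat -> C) (n : nat) : C := (RtoC (INR (S n)) * u (S n))%C.

Lemma Cpseries_ext u v t : (forall n, u n = v n) -> Cpseries u t = Cpseries v t.
Proof. intros H. unfold Cpseries. f_equal; apply PSeries_ext; intros n; rewrite H; reflexivity. Qed.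

Lemma Cpseries_plus u v t :
  Cconv u t -> Cconv v t ->
  Cconv (fun n => u n + v n)%C t /\ Cpseries (fun n => u n + v n)%C t = (Cpseries u t + Cpseries v t)%C.
Proof.
  intros [Ur Ui] [Vr Vi]. split.
  - split; [exact (ex_pseries_plus _ _ _ Ur Vr)|exact (ex_pseries_plus _ _ _ Ui Vi)].
  - unfold Cpseries, Cplus; simpl. f_equal.
    + exact (PSeries_plus _ _ _ Ur Vr).
    + exact (PSeries_plus _ _ _ Ui Vi).
Qed.

Lemma ex_pseries_Rscal (c : R) (a : nat -> R) (x : R) :
  ex_pseries a x -> ex_pseries (fun n => c * a n) x.
Proof. intros H. apply (ex_pseries_scal c a x); [apply Rmult_comm|exact H]. Qed.

Lemma Cpseries_scal k u t :
  Cconv u t -> Cconv (fun n => k * u n)%C t /\ Cpseries (fun n => k * u n)%C t = (k * Cpseries u t)%C.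
Proof.
  intros [Ur Ui]. split.
  - split.
    + exact (ex_pseries_minus _ _ _ (ex_pseries_Rscal (fst k) _ _ Ur) (ex_pseries_Rscal (snd k) _ _ Ui)).
    + exact (ex_pseries_plus _ _ _ (ex_pseries_Rscal (fst k) _ _ Ui) (ex_pseries_Rscal (snd k) _ _ Ur)).
  - unfold Cpseries, Cmult; simpl. f_equal.
    + rewrite <- !PSeries_scal.
      exact (PSeries_minus _ _ _ (ex_pseries_Rscal (fst k) _ _ Ur) (ex_pseries_Rscal (snd k) _ _ Ui)).
    + rewrite <- !PSeries_scal.
      exact (PSeries_plus _ _ _ (ex_pseries_Rscal (fst k) _ _ Ui) (ex_pseries_Rscal (snd k) _ _ Ur)).
Qed.

Lemma Cpseries_incr u t :
  Cconv u t -> Cconv (Cincr u) t /\ Cpseries (Cincr u) t = (RtoC t * Cpseries u t)%C.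
Proof.
  intros [Ur Ui].
  assert (Er : forall n, PS_incr_1 (fun n => Re (u n)) n = Re (Cincr u n)) by (intros [|n]; reflexivity).
  assert (Ei : forall n, PS_incr_1 (fun n => Im (u n)) n = Im (Cincr u n)) by (intros [|n]; reflexivity).
  split.
  - split.
    + apply (ex_pseries_ext _ _ _ Er), ex_pseries_incr_1, Ur.
    + apply (ex_pseries_ext _ _ _ Ei), ex_pseries_incr_1, Ui.
  - unfold Cpseries, Cmult; simpl.
    rewrite <- (PSeries_ext _ _ t Er), <- (PSeries_ext _ _ t Ei), !PSeries_incr_1.
    f_equal; ring.
Qed.

Lemma Cderive_Cpseries r u t :
  0 < r -> geometric r (fun n => Re (u n)) -> geometric r (fun n => Im (u n)) ->
  Rabs t * r < 1 ->
  Cconv u t /\ Cconv (Cder u) t /\ Cderive (Cpseries u) t (Cpseries (Cder u) t).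
Proof.
  intros Hr Gr Gi Ht.
  pose proof (geometric_radius _ _ _ Hr Gr Ht) as Rr.
  pose proof (geometric_radius _ _ _ Hr Gi Ht) as Ri.
  assert (Er : forall n, PS_derive (fun n => Re (u n)) n = Re (Cder u n)).
  { intros n. unfold PS_derive, Cder, Cmult, RtoC, Re; cbn -[INR]. ring. }
  assert (Ei : forall n, PS_derive (fun n => Im (u n)) n = Im (Cder u n)).
  { intros n. unfold PS_derive, Cder, Cmult, RtoC, Im; cbn -[INR]. ring. }
  split; [split; apply CV_radius_inside; assumption|].
  split.
  - split.
    + apply (ex_pseries_ext _ _ _ Er), ex_pseries_derive, Rr.
    + apply (ex_pseries_ext _ _ _ Ei), ex_pseries_derive, Ri.
  - split.
    + evar_last; [apply is_derive_PSeries, Rr|exact (PSeries_ext _ _ t Er)].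
    + evar_last; [apply is_derive_PSeries, Ri|exact (PSeries_ext _ _ t Ei)].
Qed.

Lemma is_series_C_of_parts (u : nat -> C) (l : C) :
  @is_series R_AbsRing (AbsRing_NormedModule R_AbsRing) (fun n => Re (u n)) (Re l) ->
  @is_series R_AbsRing (AbsRing_NormedModule R_AbsRing) (fun n => Im (u n)) (Im l) ->
  @is_series C_AbsRing (AbsRing_NormedModule C_AbsRing) u l.
Proof.
  intros Hr Hi.
  assert (Hr' := proj1 (is_series_R_iff _ _) Hr). assert (Hi' := proj1 (is_series_R_iff _ _) Hi).
  apply is_series_C_iff. intros eps.
  destruct (Hr' (pos_div_2 eps)) as [N1 H1], (Hi' (pos_div_2 eps)) as [N2 H2].
  exists (N1 + N2)%nat. intros n Hn.
  specialize (H1 n ltac:(lia)). specialize (H2 n ltac:(lia)). simpl in H1, H2.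
  replace (Csum u n - l)%C with
    (RtoC (psum (fun k => Re (u k)) n - Re l) + Ci * RtoC (psum (fun k => Im (u k)) n - Im l))%C.
  - eapply Rle_lt_trans; [apply Cmod_triangle|].
    rewrite Cmod_mult, Cmod_Ci, Rmult_1_l, !Cmod_R. lra.
  - rewrite <- Re_Csum, <- Im_Csum.
    apply injective_projections; unfold Re, Im, Ci; simpl; ring.
Qed.

Lemma Cmod_lt_1_neq (z : C) : Cmod z < 1 -> (1 - z)%C <> 0%C.
Proof.
  intros Hz H. assert (E : z = 1%C).
  { replace z with (1 - (1 - z))%C by ring. rewrite H. ring. }
  rewrite E, Cmod_1 in Hz. lra.
Qed.

(** On the ray t -> t z the recurrence for the coefficients is the
    differential equation (1 - tz)^2 F' = z F. Hence F(t) exp(1 - 1/(1 - tz))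
    is constant, equal to its value 1 at t = 0, and t = 1 gives the claim. *)
Lemma f0_series (z : C) :
  Cmod z < / 6 ->
  @is_pseries C_AbsRing (AbsRing_NormedModule C_AbsRing) (fun n => RtoC (acoef n)) z (f0 z).
Proof.
  intros Hz.
  set (u := fun n => (z ^ n * RtoC (acoef n))%C).
  assert (Hu : forall n, Cmod (u n) <= 1 * (/ 2) ^ n).
  { intros n. unfold u. rewrite Cmod_mult, Cmod_pow, Cmod_R, Rmult_1_l.
    apply Rle_trans with ((/ 6) ^ n * 3 ^ n).
    - apply Rmult_le_compat; [apply pow_le, Cmod_ge_0|apply Rabs_pos| |apply acoef_bound].
      apply pow_incr. split; [apply Cmod_ge_0|lra].
    - rewrite <- Rpow_mult_distr. right. f_equal. lra. }
  assert (Gr : geometric (/ 2) (fun n => Re (u n))).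
  { exists 1. intros n. eapply Rle_trans; [apply Rabs_Re_le|apply Hu]. }
  assert (Gi : geometric (/ 2) (fun n => Im (u n))).
  { exists 1. intros n. eapply Rle_trans; [apply Rabs_Im_le|apply Hu]. }
  (* The radius 3/2 leaves room around the end point t = 1 of the ray. *)
  assert (HF : forall t, Rabs t < 3 / 2 ->
     Cconv u t /\ Cconv (Cder u) t /\ Cderive (Cpseries u) t (Cpseries (Cder u) t)).
  { intros t Ht. apply (Cderive_Cpseries (/ 2)); [lra|exact Gr|exact Gi|lra]. }
  assert (Hne : forall t, Rabs t < 3 / 2 -> (1 - RtoC t * z)%C <> 0%C).
  { intros t Ht. apply Cmod_lt_1_neq. rewrite Cmod_mult, Cmod_R.
    pose proof (Rabs_pos t). pose proof (Cmod_ge_0 z). nra. }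
  assert (Hode : forall t, Rabs t < 3 / 2 ->
    ((1 - RtoC t * z) * (1 - RtoC t * z) * Cpseries (Cder u) t = z * Cpseries u t)%C).
  { intros t Ht. destruct (HF t Ht) as [Cu [Cd _]].
    destruct (Cpseries_incr _ _ Cd) as [C1 E1].
    destruct (Cpseries_incr _ _ C1) as [C2 E2].
    destruct (Cpseries_scal (- (2 * z))%C _ _ C1) as [C3 E3].
    destruct (Cpseries_scal (z * z)%C _ _ C2) as [C4 E4].
    destruct (Cpseries_plus _ _ _ C3 C4) as [C5 E5].
    destruct (Cpseries_plus _ _ _ Cd C5) as [C6 E6].
    destruct (Cpseries_scal z _ _ Cu) as [C7 E7].
    rewrite <- E7.
    transitivity (Cpseries (fun n => Cder u n + (- (2 * z) * Cincr (Cder u) n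
       + z * z * Cincr (Cincr (Cder u)) n))%C t).
    - rewrite E6, E5, E4, E3, E2, E1. ring.
    - apply Cpseries_ext. intros [|[|n]]; unfold Cder, Cincr, u; cbn [INR Cpow].
      + change (acoef 0) with 1. change (acoef 1) with 1. ring.
      + change (acoef 0) with 1. change (acoef 1) with 1.
        replace (acoef 2) with (3 / 2) by (unfold acoef; simpl; field).
        replace (RtoC (1 + 1)) with (RtoC 2) by (f_equal; ring).
        transitivity (z * z * (RtoC 2 * RtoC (3 / 2)) - 2 * z * z)%C; [ring|].
        rewrite <- RtoC_mult. replace (2 * (3 / 2)) with 3 by field. ring.
      + pose proof (acoef_recurrence (S n)) as Ha.
        assert (Ha' : (RtoC (INR (S n) + 2) * RtoC (acoef (S (S (S n)))) =
          RtoC (2 * INR (S n) + 3) * RtoC (acoef (S (S n))) - RtoC (INR (S n)) * RtoC (acoef (S n)))%C).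
        { rewrite <- !RtoC_mult, <- RtoC_minus, Ha. reflexivity. }
        replace (match n with 0%nat => 1 | S _ => INR n + 1 end) with (INR (S n)) by reflexivity.
        rewrite ?RtoC_plus, ?RtoC_mult, ?S_INR, ?RtoC_plus in *.
        transitivity (z * z * z * z ^ n * ((RtoC (INR n) + 1 + 2) * RtoC (acoef (S (S (S n)))))
           - (z * z * z * z ^ n * (2 * (RtoC (INR n) + 1 + 1) * RtoC (acoef (S (S n)))
           - (RtoC (INR n) + 1) * RtoC (acoef (S n)))))%C.
        * ring.
        * rewrite Ha'. ring. }
  set (v := fun t : R => (1 - RtoC t * z)%C).
  assert (Dv : forall t, Cderive v t (- z)%C).
  { intros t. unfold v. split; unfold Re, Im; simpl; auto_derive; trivial; ring. }
  set (H := fun t => (Cpseries u t * Cexp (1 + (- (1)) * / v t))%C).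
  assert (DH : forall t, Rabs t < 3 / 2 -> Cderive H t 0%C).
  { intros t Ht. unfold H. pose proof (Hne t Ht) as Hv.
    assert (D1 : Cderive (fun s => 1 + (- (1)) * / v s)%C t (- z * (/ v t * / v t))%C).
    { pose proof (Cderive_inv v t _ Hv (Dv t)) as [Dr Di].
      split.
      - apply (is_derive_ext (fun s => 1 - Re (/ v s)%C)).
        { intros s. unfold Cmult, Cplus, Copp, RtoC, Re; simpl. ring. }
        evar_last.
        + exact (is_derive_minus _ _ _ _ _ (is_derive_const 1 t) Dr).
        + unfold minus, plus, opp, zero; simpl. unfold Re; simpl. ring.
      - apply (is_derive_ext (fun s => 0 - Im (/ v s)%C)).
        { intros s. unfold Cmult, Cplus, Copp, RtoC, Im; simpl. ring. }
        evar_last.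
        + exact (is_derive_minus _ _ _ _ _ (is_derive_const 0 t) Di).
        + unfold minus, plus, opp, zero; simpl. unfold Im; simpl. ring. }
    pose proof (Cderive_mult _ _ _ _ _ (proj2 (proj2 (HF t Ht))) (Cderive_Cexp _ _ _ D1)) as D2.
    replace (RtoC 0) with (Cpseries (Cder u) t * Cexp (1 + - (1) * / v t) +
      Cpseries u t * (- z * (/ v t * / v t) * Cexp (1 + - (1) * / v t)))%C; [exact D2|].
    transitivity (/ v t * / v t * Cexp (1 + - (1) * / v t) *
       ((1 - RtoC t * z) * (1 - RtoC t * z) * Cpseries (Cder u) t - z * Cpseries u t))%C.
    - unfold v. field. exact Hv.
    - rewrite (Hode t Ht). ring. }
  assert (H1 : H 1 = H 0).
  { apply injective_projections.
    - apply (null_derivative_const (fun t => Re (H t)) (3 / 2)).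
      + intros t Ht. exact (proj1 (DH t Ht)).
      + rewrite Rabs_R1; lra.
    - apply (null_derivative_const (fun t => Im (H t)) (3 / 2)).
      + intros t Ht. exact (proj2 (DH t Ht)).
      + rewrite Rabs_R1; lra. }
  assert (H0 : H 0 = 1%C).
  { unfold H, v, Cpseries. rewrite !PSeries_0. unfold u at 1 2. cbn [Cpow].
    change (acoef 0) with 1.
    replace (1 + - (1) * / (1 - 0 * z))%C with (RtoC 0).
    - rewrite Cexp_0. apply injective_projections; simpl; ring.
    - field. }
  assert (HF1 : Cpseries u 1 = f0 z).
  { unfold f0.
    transitivity (Cpseries u 1 * Cexp (1 + - (1) * / v 1) * Cexp (z / (1 - z)))%C.
    - rewrite <- Cmult_assoc, <- Cexp_plus.
      replace (1 + - (1) * / v 1 + z / (1 - z))%C with (RtoC 0); [rewrite Cexp_0; ring|].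
      unfold v. rewrite Cmult_1_l. field. rewrite <- (Cmult_1_l z). apply (Hne 1). rewrite Rabs_R1; lra.
    - change (Cpseries u 1 * Cexp (1 + - (1) * / v 1))%C with (H 1). rewrite H1, H0. ring. }
  destruct (HF 1 ltac:(rewrite Rabs_R1; lra)) as [[Cr Ci] _].
  unfold is_pseries. rewrite <- HF1.
  apply is_series_C_of_parts.
  - apply (is_series_ext (fun n => scal (pow_n 1 n) (Re (u n)))).
    + intros n. rewrite pow_n_pow, pow1, pow_n_Cpow. unfold scal; simpl. unfold mult; simpl. ring.
    + exact (PSeries_correct _ _ Cr).
  - apply (is_series_ext (fun n => scal (pow_n 1 n) (Im (u n)))).
    + intros n. rewrite pow_n_pow, pow1, pow_n_Cpow. unfold scal; simpl. unfold mult; simpl. ring.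
    + exact (PSeries_correct _ _ Ci).
Qed.

(** * The moments and their recurrence *)

(** The density e^{-s} ds / (1 + s) in the variable p = s/(1+s), extended by 0
    beyond p = 1. Written with 1 - 1/(1-p) = -p/(1-p). *)
Definition psi (p : R) : R :=
  if Rlt_dec p 1 then exp (1 - / (1 - p)) / (1 - p) else 0.

Definition phi (p : R) : R := (1 - p) * psi p.

Lemma psi_lt p : p < 1 -> psi p = exp (1 - / (1 - p)) / (1 - p).
Proof. intros H. unfold psi. destruct (Rlt_dec p 1); [reflexivity|lra]. Qed.

Lemma psi_ge p : 1 <= p -> psi p = 0.
Proof. intros H. unfold psi. destruct (Rlt_dec p 1); [lra|reflexivity]. Qed.

Lemma phi_lt p : p < 1 -> phi p = exp (1 - / (1 - p)).
Proof. intros H. unfold phi. rewrite psi_lt by exact H. field. lra. Qed.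

(** With y = 1/(1-p) this says that e^{1-y} is at most 12/y^2, which follows
    from e^{y/2} >= y/2. It gives continuity at p = 1. *)
Lemma psi_bound p : 0 <= psi p <= 12 * Rabs (1 - p).
Proof.
  destruct (Rlt_le_dec p 1) as [H|H].
  - rewrite psi_lt by exact H.
    assert (Hq : 0 < 1 - p) by lra.
    rewrite (Rabs_right (1 - p)) by lra.
    split.
    + apply Rmult_le_pos; [apply Rlt_le, exp_pos|apply Rlt_le, Rinv_0_lt_compat, Hq].
    + apply Rmult_le_reg_r with (1 - p); [exact Hq|].
      unfold Rdiv. rewrite Rmult_assoc, Rinv_l, Rmult_1_r by lra.
      set (y := / (1 - p)).
      assert (Hy : 0 < y) by (apply Rinv_0_lt_compat, Hq).
      assert (Hyq : y * (1 - p) = 1) by (unfold y; field; lra).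
      assert (E : exp (1 - y) * (exp (y / 2) * exp (y / 2)) = exp 1).
      { rewrite <- !exp_plus. f_equal. field. }
      pose proof (exp_ineq1 (y / 2) ltac:(lra)) as E2.
      pose proof exp_le_3 as E3.
      pose proof (exp_pos (1 - y)) as E4.
      assert (E5 : exp (1 - y) * ((y / 2) * (y / 2)) <= 3).
      { apply Rle_trans with (exp (1 - y) * (exp (y / 2) * exp (y / 2))); [|lra].
        apply Rmult_le_compat_l; [lra|]. nra. }
      assert (E6 : exp (1 - y) * ((y / 2) * (y / 2)) * (4 * ((1 - p) * (1 - p))) = exp (1 - y)).
      { transitivity (exp (1 - y) * ((y * (1 - p)) * (y * (1 - p)))); [field|].
        rewrite Hyq; ring. }
      rewrite <- E6.
      apply Rle_trans with (3 * (4 * ((1 - p) * (1 - p)))); [|lra].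
      apply Rmult_le_compat_r; [nra|exact E5].
  - rewrite psi_ge by exact H. pose proof (Rabs_pos (1 - p)). lra.
Qed.

Lemma psi_continuous p : continuous psi p.
Proof.
  destruct (Rtotal_order p 1) as [H|[H|H]].
  - apply (continuous_ext_loc _ (fun p => exp (1 - / (1 - p)) / (1 - p))).
    + exists (mkposreal (1 - p) ltac:(lra)). intros y Hy.
      symmetry; apply psi_lt.
      apply Rabs_def2 in Hy. simpl in Hy. unfold minus, plus, opp in Hy; simpl in Hy. lra.
    + apply (ex_derive_continuous (K := R_AbsRing) (V := R_NormedModule)).
      auto_derive. lra.
  - subst p. apply filterlim_locally. intros eps.
    assert (He : 0 < eps / 12) by (pose proof (cond_pos eps); lra).
    exists (mkposreal _ He). intros y Hy. rewrite (psi_ge 1) by lra.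
    change (Rabs (y - 1) < eps / 12) in Hy. change (Rabs (psi y - 0) < eps).
    destruct (psi_bound y) as [H1 H2].
    rewrite Rminus_0_r, Rabs_right by lra.
    rewrite Rabs_minus_sym in H2. lra.
  - apply (continuous_ext_loc _ (fun _ => 0)).
    + exists (mkposreal (p - 1) ltac:(lra)). intros y Hy.
      symmetry; apply psi_ge.
      apply Rabs_def2 in Hy. simpl in Hy. unfold minus, plus, opp in Hy; simpl in Hy. lra.
    + apply continuous_const.
Qed.

Lemma phi_continuous p : continuous phi p.
Proof.
  apply (continuous_mult (K := R_AbsRing) (fun p => 1 - p) psi).
  - apply (ex_derive_continuous (K := R_AbsRing) (V := R_NormedModule)). auto_derive; trivial.
  - apply psi_continuous.
Qed.

Lemma phi_bound p : 0 <= p <= 1 -> 0 <= phi p <= 12 * ((1 - p) * (1 - p)).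
Proof.
  intros Hp. unfold phi. destruct (psi_bound p) as [H1 H2].
  rewrite Rabs_right in H2 by lra. nra.
Qed.

Lemma pow_phi_continuous k p : continuous (fun p => p ^ k * phi p) p.
Proof.
  apply (continuous_mult (K := R_AbsRing) (fun p => p ^ k) phi).
  - apply (ex_derive_continuous (K := R_AbsRing) (V := R_NormedModule)). auto_derive; trivial.
  - apply phi_continuous.
Qed.

Definition moment (k : nat) : R := RInt (fun p => p ^ k * phi p) 0 1.

Lemma moment_is_RInt k : is_RInt (fun p => p ^ k * phi p) 0 1 (moment k).
Proof.
  apply (RInt_correct (V := R_CompleteNormedModule)).
  apply (ex_RInt_continuous (V := R_CompleteNormedModule)).
  intros; apply pow_phi_continuous.
Qed.

(** At p = 1 the factor (1-p)^2 and the bound on [psi] make the derivative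
    vanish. *)
Lemma is_derive_sq_phi p :
  p <= 1 -> is_derive (fun p => (1 - p) ^ 2 * phi p) p ((2 * p - 3) * phi p).
Proof.
  intros [Hp| ->].
  - rewrite phi_lt by exact Hp.
    apply (is_derive_ext_loc (fun p => (1 - p) ^ 2 * exp (1 - / (1 - p)))).
    + exists (mkposreal (1 - p) ltac:(lra)). intros y Hy.
      rewrite phi_lt; [reflexivity|].
      apply Rabs_def2 in Hy. simpl in Hy. unfold minus, plus, opp in Hy; simpl in Hy. lra.
    + auto_derive; [lra|]. unfold Rminus. field. lra.
  - apply is_derive_Reals. intros eps Heps.
    assert (Hd : 0 < Rmin 1 (eps / 12)) by (apply Rmin_glb_lt; lra).
    exists (mkposreal _ Hd). intros h Hh0 Hh. simpl in Hh.
    pose proof (Rmin_l 1 (eps / 12)). pose proof (Rmin_r 1 (eps / 12)).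
    match goal with |- Rabs ?a < _ => replace a with (h * phi (1 + h)) by
      (unfold phi; rewrite (psi_ge 1) by lra; field; exact Hh0) end.
    unfold phi.
    replace (1 - (1 + h)) with (- h) by ring.
    rewrite !Rabs_mult, Rabs_Ropp.
    destruct (psi_bound (1 + h)) as [H1 H2].
    replace (1 - (1 + h)) with (- h) in H2 by ring. rewrite Rabs_Ropp in H2.
    rewrite (Rabs_right (psi _)) by lra.
    assert (Ha : 0 < Rabs h) by (apply Rabs_pos_lt; exact Hh0).
    apply Rle_lt_trans with (Rabs h * (Rabs h * (12 * Rabs h))).
    + repeat apply Rmult_le_compat_l; lra.
    + apply Rle_lt_trans with (1 * (1 * (12 * Rabs h))); [|lra].
      repeat apply Rmult_le_compat; nra.
Qed.

(** Integrate the derivative of p^{k+1} (1-p)^2 phi(p), which vanishes at both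
    ends. *)
Lemma moment_recurrence k :
  (INR k + 1) * moment k - (2 * INR k + 5) * moment (S k) + (INR k + 3) * moment (S (S k)) = 0.
Proof.
  set (g := fun p => (INR k + 1) * (p ^ k * phi p) - (2 * INR k + 5) * (p ^ S k * phi p)
             + (INR k + 3) * (p ^ S (S k) * phi p)).
  assert (Hint : is_RInt g 0 1 ((INR k + 1) * moment k - (2 * INR k + 5) * moment (S k)
                   + (INR k + 3) * moment (S (S k)))).
  { apply (is_RInt_plus (V := R_NormedModule)).
    - apply (is_RInt_minus (V := R_NormedModule));
        apply (is_RInt_scal (V := R_NormedModule)), moment_is_RInt.
    - apply (is_RInt_scal (V := R_NormedModule)), moment_is_RInt. }
  apply (is_RInt_unique (V := R_CompleteNormedModule)) in Hint. rewrite <- Hint.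
  replace 0 with (minus (1 ^ S k * ((1 - 1) ^ 2 * phi 1)) (0 ^ S k * ((1 - 0) ^ 2 * phi 0))) at 2
    by (unfold minus, plus, opp; simpl; ring).
  apply (is_RInt_unique (V := R_CompleteNormedModule)).
  apply (is_RInt_derive (V := R_CompleteNormedModule) (fun p => p ^ S k * ((1 - p) ^ 2 * phi p))).
  - intros p Hp. rewrite Rmin_left, Rmax_right in Hp by lra.
    evar_last.
    + apply is_derive_Rmult; [|exact (is_derive_sq_phi p (proj2 Hp))].
      auto_derive; [trivial|reflexivity].
    + unfold g. change (match k with 0%nat => 1 | S _ => INR k + 1 end) with (INR (S k)).
      rewrite S_INR. cbn [pow]. ring.
  - intros p _. unfold g.
    apply (continuous_plus (V := R_NormedModule)); [apply (continuous_minus (V := R_NormedModule))|];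
      apply (continuous_scal_r (V := R_NormedModule)), pow_phi_continuous.
Qed.

Lemma moment_01 : 2 * moment 1 = 3 * moment 0 - 1.
Proof.
  assert (Hint : is_RInt (fun p => 2 * (p ^ 1 * phi p) - 3 * (p ^ 0 * phi p)) 0 1
                   (2 * moment 1 - 3 * moment 0)).
  { apply (is_RInt_minus (V := R_NormedModule));
      apply (is_RInt_scal (V := R_NormedModule)), moment_is_RInt. }
  assert (Hder : is_RInt (fun p => 2 * (p ^ 1 * phi p) - 3 * (p ^ 0 * phi p)) 0 1
     (minus ((1 - 1) ^ 2 * phi 1) ((1 - 0) ^ 2 * phi 0))).
  { apply (is_RInt_derive (V := R_CompleteNormedModule) (fun p => (1 - p) ^ 2 * phi p)).
    - intros p Hp. rewrite Rmin_left, Rmax_right in Hp by lra.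
      evar_last; [exact (is_derive_sq_phi p (proj2 Hp))|]. simpl; ring.
    - intros p _. apply (continuous_minus (V := R_NormedModule));
        apply (continuous_scal_r (V := R_NormedModule)), pow_phi_continuous. }
  apply (is_RInt_unique (V := R_CompleteNormedModule)) in Hint.
  apply (is_RInt_unique (V := R_CompleteNormedModule)) in Hder.
  rewrite Hint in Hder. unfold minus, plus, opp in Hder; simpl in Hder.
  rewrite (phi_lt 0) in Hder by lra.
  replace (1 - / (1 - 0)) with 0 in Hder by field. rewrite exp_0 in Hder. lra.
Qed.

Lemma moment_pos k : 0 < moment k.
Proof.
  apply RInt_gt_0; [lra| |].
  - intros x Hx. apply Rmult_lt_0_compat; [apply pow_lt; lra|].
    rewrite phi_lt by lra. apply exp_pos.
  - intros x _. apply pow_phi_continuous.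
Qed.

(** The recurrence is the same for both sequences, so (n+1)(n+2) times the
    Casoratian does not depend on n; its value comes from [moment_01]. *)
Lemma moment_wronskian n :
  (INR n + 1) * (INR n + 2) *
    (moment n * acoef (S (S n)) - acoef (S n) * moment (S n)) = 1.
Proof.
  induction n as [|n IH].
  - replace (acoef 2) with (3 / 2) by (unfold acoef; simpl; field).
    replace (acoef 1) with 1 by reflexivity.
    pose proof moment_01. simpl. lra.
  - rewrite S_INR. etransitivity; [|exact IH].
    pose proof (acoef_recurrence (S n)) as Ha. pose proof (moment_recurrence n) as Hm.
    rewrite S_INR in Ha.
    transitivity ((INR n + 2) * (moment (S n) * ((INR n + 1 + 2) * acoef (S (S (S n))))
       - acoef (S (S n)) * ((INR n + 3) * moment (S (S n))))); [ring|].
    rewrite Ha.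
    replace ((INR n + 3) * moment (S (S n))) with
      ((2 * INR n + 5) * moment (S n) - (INR n + 1) * moment n) by lra.
    ring.
Qed.

(** * The Maclaurin series of f_1 *)

Lemma continuous_C_pair (f g : R -> R) x :
  continuous f x -> continuous g x ->
  continuous (U := C_UniformSpace) (fun p => (f p, g p) : C) x.
Proof.
  intros Hf Hg. apply filterlim_locally. intros eps.
  apply filterlim_locally with (eps := eps) in Hf.
  apply filterlim_locally with (eps := eps) in Hg.
  generalize (filter_and _ _ Hf Hg). apply filter_imp.
  intros y [H1 H2]. split; assumption.
Qed.

Definition is_CInt (f : R -> C) (a b : R) (l : C) : Prop :=
  is_RInt (V := C_R_NormedModule) f a b l.

Lemma is_CInt_pair (f g : R -> R) a b lf lg :
  is_RInt f a b lf -> is_RInt g a b lg -> is_CInt (fun p => (f p, g p)) a b (lf, lg).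
Proof.
  intros Hf Hg.
  exact (is_RInt_fct_extend_pair (fun p => (f p, g p)) a b lf lg Hf Hg).
Qed.

Lemma is_CInt_fst f a b l : is_CInt f a b l -> is_RInt (fun p => Re (f p)) a b (Re l).
Proof. intros H. destruct l. exact (is_RInt_fct_extend_fst f a b _ H). Qed.

Lemma is_CInt_snd f a b l : is_CInt f a b l -> is_RInt (fun p => Im (f p)) a b (Im l).
Proof. intros H. destruct l. exact (is_RInt_fct_extend_snd f a b _ H). Qed.

Lemma is_CInt_mult k f a b l : is_CInt f a b l -> is_CInt (fun p => k * f p)%C a b (k * l)%C.
Proof.
  intros H. pose proof (is_CInt_fst _ _ _ _ H) as Hr. pose proof (is_CInt_snd _ _ _ _ H) as Hi.
  apply is_CInt_pair.
  - apply (is_RInt_minus (V := R_NormedModule)); apply (is_RInt_scal (V := R_NormedModule)); assumption.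
  - apply (is_RInt_plus (V := R_NormedModule)); apply (is_RInt_scal (V := R_NormedModule)); assumption.
Qed.

Lemma is_CInt_plus f g a b lf lg :
  is_CInt f a b lf -> is_CInt g a b lg -> is_CInt (fun p => f p + g p)%C a b (lf + lg)%C.
Proof. exact (is_RInt_plus (V := C_R_NormedModule) f g a b lf lg). Qed.

Lemma is_CInt_RtoC f a b l : is_RInt f a b l -> is_CInt (fun p => RtoC (f p)) a b (RtoC l).
Proof.
  intros H. apply is_CInt_pair; [exact H|].
  evar_last; [apply (is_RInt_const (V := R_NormedModule))|]. unfold scal; simpl; unfold mult; simpl; ring.
Qed.

Lemma is_CInt_bound f l M :
  is_CInt f 0 1 l -> (forall p, 0 <= p <= 1 -> Cmod (f p) <= M) -> Cmod l <= M.
Proof.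
  assert (E : forall z : C, norm (V := C_R_NormedModule) z = Cmod z).
  { intros z. unfold norm; simpl. unfold prod_norm, Cmod, norm; simpl. unfold abs; simpl.
    f_equal. rewrite !Rmult_1_r, <- !Rabs_mult.
    rewrite !Rabs_right; [reflexivity| |]; apply Rle_ge; nra. }
  intros Hl HM. rewrite <- E. rewrite <- (Rmult_1_l M). replace 1 with (1 - 0) by ring.
  apply (norm_RInt_le_const (V := C_R_NormedModule) f 0 1); [lra| |exact Hl].
  intros p Hp. rewrite E. apply HM, Hp.
Qed.

Lemma cauchy_kernel_continuous (r : R -> R) (z : C) p :
  continuous r p -> (1 - RtoC p * z)%C <> 0%C ->
  continuous (U := C_UniformSpace) (fun q => (RtoC (r q) * / (1 - RtoC q * z))%C) p.
Proof.
  intros Hr Hp. destruct z as [a b].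
  pose proof (C_sumsq_neq0 _ Hp) as Hd. unfold Re, Im in Hd; simpl in Hd.
  set (d := fun q => (1 - q * a) ^ 2 + (q * b) ^ 2).
  assert (Hd' : d p <> 0).
  { unfold d. intros E. apply Hd. etransitivity; [|exact E]. ring. }
  apply (continuous_ext (T := R_UniformSpace) (U := C_UniformSpace)
    (fun q => (r q * ((1 - q * a) / d q), r q * (q * b / d q)) : C)).
  { intros q. unfold d. apply injective_projections; unfold Cinv, Cmult, RtoC; simpl.
    - replace ((1 + - (q * a - 0 * b)) * ((1 + - (q * a - 0 * b)) * 1) +
         (0 + - (q * b + 0 * a)) * ((0 + - (q * b + 0 * a)) * 1))
        with ((1 - q * a) * ((1 - q * a) * 1) + q * b * (q * b * 1)) by ring.
      unfold Rdiv. ring.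
    - replace ((1 + - (q * a - 0 * b)) * ((1 + - (q * a - 0 * b)) * 1) +
         (0 + - (q * b + 0 * a)) * ((0 + - (q * b + 0 * a)) * 1))
        with ((1 - q * a) * ((1 - q * a) * 1) + q * b * (q * b * 1)) by ring.
      unfold Rdiv. ring. }
  apply continuous_C_pair; apply (continuous_mult (K := R_AbsRing)); try exact Hr;
    apply (ex_derive_continuous (K := R_AbsRing) (V := R_NormedModule)); unfold d in *;
    auto_derive; simpl in Hd'; repeat split; exact Hd'.
Qed.

Lemma cauchy_kernel_bound (z : C) p :
  Cmod z < / 2 -> 0 <= p <= 1 ->
  (1 - RtoC p * z)%C <> 0%C /\ Cmod (/ (1 - RtoC p * z))%C <= 2.
Proof.
  intros Hz Hp.
  assert (Hpz : Cmod (RtoC p * z) < / 2).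
  { rewrite Cmod_mult, Cmod_R, Rabs_right by lra. pose proof (Cmod_ge_0 z). nra. }
  assert (Hne : (1 - RtoC p * z)%C <> 0%C) by (apply Cmod_lt_1_neq; lra).
  split; [exact Hne|].
  rewrite Cmod_inv by exact Hne.
  rewrite <- (Rinv_inv 2). apply Rinv_le_contravar; [lra|].
  pose proof (Cmod_triangle (1 - RtoC p * z) (RtoC p * z)) as Ht.
  replace (1 - RtoC p * z + RtoC p * z)%C with (RtoC 1) in Ht by ring.
  rewrite Cmod_1 in Ht. lra.
Qed.

Lemma cauchy_kernel_ex_CInt (r : R -> R) (z : C) :
  Cmod z < / 2 -> (forall p, continuous r p) ->
  exists l, is_CInt (fun q => (RtoC (r q) * / (1 - RtoC q * z))%C) 0 1 l.
Proof.
  intros Hz Hr.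
  apply (ex_RInt_continuous (V := C_R_CompleteNormedModule)).
  intros p Hp. rewrite Rmin_left, Rmax_right in Hp by lra.
  apply cauchy_kernel_continuous; [apply Hr|]. apply cauchy_kernel_bound; assumption.
Qed.

(** For n >= 1 the coefficient of z^n in (1-z)/(1-pz) is -(1-p) p^{n-1}, and
    phi = (1-p) psi. *)
Definition f1_coeff (n : nat) : R :=
  match n with O => RInt psi 0 1 | S k => - moment k end.

Lemma is_CInt_ext (f g : R -> C) a b l :
  (forall p, Rmin a b < p < Rmax a b -> f p = g p) -> is_CInt f a b l -> is_CInt g a b l.
Proof. exact (is_RInt_ext (V := C_R_NormedModule) f g a b l). Qed.

Lemma is_CInt_unique f a b l l' : is_CInt f a b l -> is_CInt f a b l' -> l = l'.
Proof.
  intros H H'.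
  rewrite <- (is_RInt_unique (V := C_R_CompleteNormedModule) _ _ _ _ H).
  exact (is_RInt_unique (V := C_R_CompleteNormedModule) _ _ _ _ H').
Qed.

(** Since 1/(1-pz) = 1 + pz/(1-pz), the remainder after n terms is z^n times
    an integral bounded uniformly in n. *)
Lemma stieltjes_series (z Y : C) :
  Cmod z < / 2 ->
  is_CInt (fun p => (1 - z) * (RtoC (psi p) * / (1 - RtoC p * z)))%C 0 1 Y ->
  @is_pseries C_AbsRing (AbsRing_NormedModule C_AbsRing) (fun n => RtoC (f1_coeff n)) z Y.
Proof.
  intros Hz HY.
  (* The bound is 12 for phi times 2 for the Cauchy kernel, independently of k. *)
  assert (HR : forall k, exists l,
     is_CInt (fun q => (RtoC (q ^ k * phi q) * / (1 - RtoC q * z))%C) 0 1 l /\ Cmod l <= 24).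
  { intros k. destruct (cauchy_kernel_ex_CInt (fun q => q ^ k * phi q) z Hz) as [l Hl].
    - apply pow_phi_continuous.
    - exists l. split; [exact Hl|].
      apply (is_CInt_bound _ _ _ Hl). intros p Hp.
      destruct (cauchy_kernel_bound z p Hz Hp) as [_ H2].
      rewrite Cmod_mult, Cmod_R. replace 24 with (12 * 2) by ring.
      apply Rmult_le_compat; [apply Rabs_pos|apply Cmod_ge_0| |exact H2].
      destruct (phi_bound p Hp) as [H3 H4].
      assert (H5 : 0 <= p ^ k <= 1).
      { split; [apply pow_le; lra|]. rewrite <- (pow1 k). apply pow_incr; lra. }
      rewrite Rabs_right by (apply Rle_ge; nra). nra. }
  assert (Hpart : forall n, exists l,
     is_CInt (fun q => (RtoC (q ^ n * phi q) * / (1 - RtoC q * z))%C) 0 1 l /\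
     Y = (Csum (fun k => z ^ k * RtoC (f1_coeff k)) (S n) - z ^ (S n) * l)%C).
  { induction n as [|n [l [Hl1 Hl2]]].
    - destruct (HR 0%nat) as [l [Hl1 _]]. exists l. split; [exact Hl1|].
      simpl. apply (is_CInt_unique _ _ _ _ _ HY).
      assert (Hpsi : is_RInt psi 0 1 (RInt psi 0 1)).
      { apply (RInt_correct (V := R_CompleteNormedModule)).
        apply (ex_RInt_continuous (V := R_CompleteNormedModule)). intros; apply psi_continuous. }
      pose proof (is_CInt_plus _ _ _ _ _ _ (is_CInt_RtoC _ _ _ _ Hpsi) (is_CInt_mult (- z) _ _ _ _ Hl1)) as H.
      replace (0 + 1 * RtoC (RInt psi 0 1) - z * 1 * l)%C with (RtoC (RInt psi 0 1) + - z * l)%C by ring.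
      apply (is_CInt_ext _ _ _ _ _) with (2 := H). intros p Hp.
      rewrite Rmin_left, Rmax_right in Hp by lra.
      destruct (cauchy_kernel_bound z p Hz ltac:(lra)) as [Hne _].
      unfold phi. simpl. rewrite !RtoC_mult, RtoC_minus. field. exact Hne.
    - destruct (HR (S n)) as [l' [Hl' _]]. exists l'. split; [exact Hl'|].
      assert (E : l = (RtoC (moment n) + z * l')%C).
      { apply (is_CInt_unique _ _ _ _ _ Hl1).
        pose proof (is_CInt_plus _ _ _ _ _ _ (is_CInt_RtoC _ _ _ _ (moment_is_RInt n))
                      (is_CInt_mult z _ _ _ _ Hl')) as H.
        apply (is_CInt_ext _ _ _ _ _) with (2 := H). intros p Hp.
        rewrite Rmin_left, Rmax_right in Hp by lra.
        destruct (cauchy_kernel_bound z p Hz ltac:(lra)) as [Hne _].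
        simpl. rewrite !RtoC_mult. field. exact Hne. }
      rewrite Hl2, E. cbn [Csum f1_coeff]. rewrite RtoC_opp. simpl. ring. }
  unfold is_pseries. apply is_series_C_iff. intros eps.
  assert (Hgeo : is_lim_seq (fun n => 24 * (/ 2) ^ n) 0).
  { replace (Finite 0) with (Rbar_mult 24 0) by (simpl; f_equal; ring).
    apply is_lim_seq_scal_l, is_lim_seq_geom. rewrite Rabs_right; lra. }
  apply is_lim_seq_spec in Hgeo. destruct (Hgeo eps) as [N HN].
  exists (S N). intros [|n] Hn; [lia|].
  destruct (Hpart n) as [l [Hl E]].
  assert (Hlb : Cmod l <= 24).
  { destruct (HR n) as [l' [Hl' Hb]]. rewrite (is_CInt_unique _ _ _ _ _ Hl Hl'). exact Hb. }
  assert (E' : (Csum (fun k => scal (pow_n (K := C_AbsRing) z k) (RtoC (f1_coeff k))) (S n) - Y)%C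
     = (z ^ S n * l)%C).
  { rewrite E.
    assert (Es : forall m, Csum (fun k => scal (pow_n (K := C_AbsRing) z k) (RtoC (f1_coeff k))) m
       = Csum (fun k => z ^ k * RtoC (f1_coeff k))%C m).
    { induction m as [|m IH]; [reflexivity|]. simpl Csum. rewrite IH, pow_n_Cpow. reflexivity. }
    rewrite Es. ring. }
  refine (Rle_lt_trans _ (Cmod (z ^ S n * l)%C) _ (Req_le _ _ (f_equal Cmod E')) _).
  rewrite Cmod_mult, Cmod_pow.
  specialize (HN (S n) ltac:(lia)). rewrite Rminus_0_r, Rabs_right in HN.
  2:{ apply Rle_ge, Rmult_le_pos; [lra|apply pow_le; lra]. }
  eapply Rle_lt_trans; [|exact HN]. rewrite Rmult_comm.
  apply Rmult_le_compat; [apply Cmod_ge_0|apply pow_le, Cmod_ge_0|exact Hlb|].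
  apply pow_incr. split; [apply Cmod_ge_0|lra].
Qed.

Lemma continuous_C_mult (k : C) (f : R -> C) p :
  continuous (U := C_UniformSpace) f p -> continuous (U := C_UniformSpace) (fun q => k * f q)%C p.
Proof.
  intros Hf.
  assert (Hr : continuous (fun q => fst (f q)) p).
  { apply (continuous_comp (V := C_UniformSpace) f fst _ Hf). destruct (f p). apply continuous_fst. }
  assert (Hi : continuous (fun q => snd (f q)) p).
  { apply (continuous_comp (V := C_UniformSpace) f snd _ Hf). destruct (f p). apply continuous_snd. }
  apply continuous_C_pair.
  - apply (continuous_minus (V := R_NormedModule));
      apply (continuous_scal_r (V := R_NormedModule)); assumption.
  - apply (continuous_plus (V := R_NormedModule));
      apply (continuous_scal_r (V := R_NormedModule)); assumption.
Qed.

Lemma Cexp_RtoC s : Cexp (RtoC s) = RtoC (exp s).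
Proof. unfold Cexp, RtoC; simpl. rewrite cos_0, sin_0. f_equal; ring. Qed.

(** The factor e^x cancels e^{-x} in the integrand, leaving the integral of
    e^{-s}/(x+s) over s >= 0. For p = s/(1+s) and x = 1/(1-z) one has 1/(x+s)
    = (1-z)(1-p)/(1-pz). The improper integral becomes a proper one because
    the new integrand is continuous up to p = 1. *)
Lemma f1_stieltjes (z : C) :
  Cmod z < / 2 ->
  is_CInt (fun p => (1 - z) * (RtoC (psi p) * / (1 - RtoC p * z)))%C 0 1 (f1 z).
Proof.
  intros Hz.
  assert (Hz1 : (1 - z)%C <> 0%C) by (apply Cmod_lt_1_neq; lra).
  set (x := (1 / (1 - z))%C).
  set (chi := fun p => (Cexp (- x) * ((1 - z) * (RtoC (psi p) * / (1 - RtoC p * z))))%C).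
  destruct (cauchy_kernel_ex_CInt psi z Hz psi_continuous) as [Y0 HY0].
  apply (is_CInt_mult (1 - z)%C) in HY0. set (Y := ((1 - z) * Y0)%C) in *.
  pose proof (is_CInt_mult (Cexp (- x)) _ _ _ _ HY0) as Hchi.
  fold chi in Hchi. cbv beta in Hchi.
  assert (Hne : forall p, 0 <= p <= 3 / 2 -> (1 - RtoC p * z)%C <> 0%C).
  { intros p Hp. apply Cmod_lt_1_neq. rewrite Cmod_mult, Cmod_R, Rabs_right by lra.
    pose proof (Cmod_ge_0 z). nra. }
  assert (Cchi : forall p, 0 <= p <= 3 / 2 -> continuous (U := C_UniformSpace) chi p).
  { intros p Hp. apply continuous_C_mult, continuous_C_mult.
    apply cauchy_kernel_continuous; [apply psi_continuous|exact (Hne p Hp)]. }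
  assert (Ichi : forall q, 0 <= q <= 3 / 2 ->
    is_CInt chi 0 q (RInt (V := C_R_CompleteNormedModule) chi 0 q)).
  { intros q Hq. apply (RInt_correct (V := C_R_CompleteNormedModule)).
    apply (ex_RInt_continuous (V := C_R_CompleteNormedModule)).
    intros p Hp. rewrite Rmin_left, Rmax_right in Hp by lra. apply Cchi. lra. }
  assert (Hgen : is_RInt_gen (V := C_R_NormedModule)
    (fun s : R => (Cexp (- (x + RtoC s)) / (x + RtoC s))%C)
    (at_point 0) (Rbar_locally p_infty) (Cexp (- x) * Y)%C).
  { assert (Hlim : continuous (U := C_UniformSpace)
        (fun q => RInt (V := C_R_CompleteNormedModule) chi 0 q) 1).
    { apply (continuous_RInt_1 (V := C_R_NormedModule) chi 0 1).
      exists (mkposreal (/ 2) ltac:(lra)). intros q Hq.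
      apply Rabs_def2 in Hq. simpl in Hq. unfold minus, plus, opp in Hq; simpl in Hq.
      apply Ichi. lra. }
    assert (HY1 : RInt (V := C_R_CompleteNormedModule) chi 0 1 = (Cexp (- x) * Y)%C)
      by exact (is_RInt_unique (V := C_R_CompleteNormedModule) _ _ _ _ Hchi).
    intros P HP. rewrite <- HY1 in HP.
    destruct (Hlim P HP) as [eps Heps].
    apply (Filter_prod _ _ _ (fun a => a = 0) (fun A => / eps < A)).
    - reflexivity.
    - exists (/ eps). intros A HA; exact HA.
    - intros a A -> HA. simpl.
      pose proof (cond_pos eps) as Hep.
      assert (HA0 : 0 < A).
      { apply Rlt_trans with (/ eps); [apply Rinv_0_lt_compat, Hep|exact HA]. }
      exists (RInt (V := C_R_CompleteNormedModule) chi 0 (A / (1 + A))).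
      split.
      + pose proof (is_RInt_comp (V := C_R_CompleteNormedModule) chi
          (fun s => s / (1 + s)) (fun s => / (1 + s) ^ 2) 0 A) as H.
        cbv beta in H. replace (0 / (1 + 0)) with 0 in H by field.
        assert (Hb : forall s, 0 <= s -> 0 <= s / (1 + s) < 1).
        { intros s Hs. split.
          - apply Rmult_le_pos; [exact Hs|]. apply Rlt_le, Rinv_0_lt_compat; lra.
          - apply Rmult_lt_reg_r with (1 + s); [lra|].
            unfold Rdiv. rewrite Rmult_assoc, Rinv_l; lra. }
        refine (is_CInt_ext _ _ _ _ _ _ (H _ _)); clear H; intros s Hs;
          rewrite Rmin_left, Rmax_right in Hs by lra; specialize (Hb s ltac:(lra)).
        * assert (E : forall (t : R) (w : C), scal (V := C_R_NormedModule) t w = (RtoC t * w)%C).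
          { intros t w. apply injective_projections; unfold scal; simpl;
              unfold prod_scal, scal; simpl; unfold mult; simpl; ring. }
          rewrite E. unfold chi. rewrite psi_lt by lra.
          replace (1 - / (1 - s / (1 + s))) with (- s) by (field; lra).
          replace (- (x + RtoC s))%C with (- x + RtoC (- s))%C by (rewrite RtoC_opp; ring).
          rewrite Cexp_plus, Cexp_RtoC.
          assert (Hs1 : RtoC (1 + s) <> 0%C) by (intros Z; apply RtoC_inj in Z; lra).
          specialize (Hne (s / (1 + s)) ltac:(lra)).
          replace (exp (- s) / (1 - s / (1 + s))) with (exp (- s) * (1 + s)) by (field; lra).
          replace (/ (1 + s) ^ 2) with (/ (1 + s) * / (1 + s)) by (field; lra).
          unfold Rdiv in Hne |- *.
          rewrite RtoC_mult, RtoC_inv, RtoC_plus in Hne by lra.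
          rewrite !RtoC_mult, !RtoC_inv, !RtoC_plus by lra. rewrite RtoC_plus in Hs1.
          assert (Hne' : (1 + RtoC s - RtoC s * z)%C <> 0%C).
          { intros Z. apply Hne. transitivity (/ (1 + RtoC s) * (1 + RtoC s - RtoC s * z))%C.
            - field. exact Hs1.
            - rewrite Z. ring. }
          unfold x. field. repeat split; try assumption.
          -- intros Z. apply Hne'. rewrite <- Z. ring.
        * apply Cchi. lra.
        * split.
          -- auto_derive; [lra|]. field. lra.
          -- apply (ex_derive_continuous (K := R_AbsRing) (V := R_NormedModule)).
             auto_derive. simpl. apply Rgt_not_eq. nra.
      + apply Heps. change (Rabs (A / (1 + A) - 1) < eps).
        replace (A / (1 + A) - 1) with (- / (1 + A)) by (field; lra).
        rewrite Rabs_Ropp, Rabs_right by (apply Rle_ge, Rlt_le, Rinv_0_lt_compat; lra).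
        rewrite <- (Rinv_inv eps). apply Rinv_lt_contravar; [|lra].
        apply Rmult_lt_0_compat; [apply Rinv_0_lt_compat, Hep|lra]. }
  replace (f1 z) with Y; [exact HY0|].
  unfold f1. fold x. cbv zeta. unfold expint_E1.
  rewrite (is_RInt_gen_unique (V := C_R_CompleteNormedModule) _ _ Hgen).
  rewrite Cmult_assoc, <- Cexp_plus.
  replace (x + - x)%C with (RtoC 0) by ring. rewrite Cexp_0. ring.
Qed.

Lemma f1_series (z : C) :
  Cmod z < / 2 ->
  @is_pseries C_AbsRing (AbsRing_NormedModule C_AbsRing) (fun n => RtoC (f1_coeff n)) z (f1 z).
Proof. intros Hz. apply stieltjes_series; [exact Hz|]. apply f1_stieltjes, Hz. Qed.

Lemma rho_coefficients n :
  (maclaurin (K := C_AbsRing) f0 (S n) * maclaurin (K := C_AbsRing) f1 (S n))%C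
  = RtoC (- (acoef (S n) * moment n)).
Proof.
  rewrite (maclaurin_C_eq f0 _ (/ 6) ltac:(lra) f0_series).
  rewrite (maclaurin_C_eq f1 _ (/ 2) ltac:(lra) f1_series).
  rewrite <- RtoC_mult. f_equal. simpl. ring.
Qed.

(** * Asymptotic orders at infinity *)

(** [bigO N f] means f(l) = O(l^{-N}) as l tends to infinity; the variable l
    plays the role of sqrt n. *)
Definition bigO (N : nat) (f : R -> R) : Prop :=
  exists C L, 1 <= L /\ 0 <= C /\ forall l, L <= l -> Rabs (f l) <= C * (/ l) ^ N.

Lemma bigO_intro N f C L :
  (forall l, 1 <= l -> L <= l -> Rabs (f l) <= C * (/ l) ^ N) -> bigO N f.
Proof.
  intros H. exists (Rabs C), (Rmax 1 L).
  split; [apply Rmax_l|split; [apply Rabs_pos|]].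
  intros l Hl. assert (1 <= l) by (eapply Rle_trans; [apply Rmax_l|exact Hl]).
  eapply Rle_trans; [apply H; [assumption|eapply Rle_trans; [apply Rmax_r|exact Hl]]|].
  apply Rmult_le_compat_r; [|apply Rle_abs].
  apply pow_le, Rlt_le, Rinv_0_lt_compat; lra.
Qed.

Lemma bigO_ext N f g L : (forall l, 1 <= l -> L <= l -> f l = g l) -> bigO N f -> bigO N g.
Proof.
  intros H (C & L' & H1 & HC & HL).
  apply (bigO_intro N g C (Rmax L L')). intros l Hl1 Hl.
  rewrite <- H; [apply HL| |]; try assumption.
  - eapply Rle_trans; [apply Rmax_r|exact Hl].
  - eapply Rle_trans; [apply Rmax_l|exact Hl].
Qed.

Lemma bigO_plus N f g : bigO N f -> bigO N g -> bigO N (fun l => f l + g l).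
Proof.
  intros (C & L & H1 & HC & HL) (C' & L' & H1' & HC' & HL').
  apply (bigO_intro _ _ (C + C') (Rmax L L')). intros l _ Hl.
  eapply Rle_trans; [apply Rabs_triang|]. rewrite Rmult_plus_distr_r.
  apply Rplus_le_compat; [apply HL|apply HL'].
  - eapply Rle_trans; [apply Rmax_l|exact Hl].
  - eapply Rle_trans; [apply Rmax_r|exact Hl].
Qed.

Lemma bigO_mult N M f g : bigO N f -> bigO M g -> bigO (N + M) (fun l => f l * g l).
Proof.
  intros (C & L & H1 & HC & HL) (C' & L' & H1' & HC' & HL').
  apply (bigO_intro _ _ (C * C') (Rmax L L')). intros l _ Hl.
  rewrite Rabs_mult, pow_add.
  replace (C * C' * ((/ l) ^ N * (/ l) ^ M)) with (C * (/ l) ^ N * (C' * (/ l) ^ M)) by ring.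
  apply Rmult_le_compat; try apply Rabs_pos; [apply HL|apply HL'].
  - eapply Rle_trans; [apply Rmax_l|exact Hl].
  - eapply Rle_trans; [apply Rmax_r|exact Hl].
Qed.

Lemma bigO_const a : bigO 0 (fun _ => a).
Proof. apply (bigO_intro _ _ (Rabs a) 0). intros l _ _. simpl. lra. Qed.

Lemma bigO_scal N a f : bigO N f -> bigO N (fun l => a * f l).
Proof. intros H. exact (bigO_mult 0 N _ _ (bigO_const a) H). Qed.

Lemma bigO_minus N f g : bigO N f -> bigO N g -> bigO N (fun l => f l - g l).
Proof.
  intros Hf Hg. apply (bigO_ext _ (fun l => f l + (-1) * g l) _ 0).
  - intros; ring.
  - apply bigO_plus; [exact Hf|apply bigO_scal, Hg].
Qed.

Lemma bigO_pow N : bigO N (fun l => (/ l) ^ N).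
Proof.
  apply (bigO_intro _ _ 1 0). intros l Hl _.
  rewrite Rabs_right, Rmult_1_l; [lra|].
  apply Rle_ge, pow_le, Rlt_le, Rinv_0_lt_compat; lra.
Qed.

Lemma bigO_weaken N M f : (M <= N)%nat -> bigO N f -> bigO M f.
Proof.
  intros HNM (C & L & H1 & HC & HL).
  apply (bigO_intro _ _ C L). intros l Hl Hl'.
  eapply Rle_trans; [apply HL, Hl'|].
  apply Rmult_le_compat_l; [exact HC|].
  replace N with (M + (N - M))%nat by lia. rewrite pow_add.
  assert (Hi : 0 < / l <= 1).
  { split; [apply Rinv_0_lt_compat; lra|]. rewrite <- Rinv_1. apply Rinv_le_contravar; lra. }
  rewrite <- (Rmult_1_r ((/ l) ^ M)) at 2.
  apply Rmult_le_compat_l; [apply pow_le; lra|].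
  rewrite <- (pow1 (N - M)). apply pow_incr. lra.
Qed.

Lemma bigO_psum N (F : nat -> R -> R) n :
  (forall k, (k < n)%nat -> bigO N (F k)) -> bigO N (fun l => psum (fun k => F k l) n).
Proof.
  induction n as [|n IH]; intros H; simpl.
  - apply (bigO_intro _ _ 0 0). intros. rewrite Rabs_R0. lra.
  - apply bigO_plus; [apply IH; intros; apply H; lia|apply H; lia].
Qed.

Lemma bigO_le N f g L : (forall l, 1 <= l -> L <= l -> Rabs (f l) <= g l) -> bigO N g -> bigO N f.
Proof.
  intros H (C & L' & H1 & HC & HL).
  apply (bigO_intro _ _ C (Rmax L L')). intros l Hl Hl'.
  eapply Rle_trans; [apply H; [exact Hl|eapply Rle_trans; [apply Rmax_l|exact Hl']]|].
  eapply Rle_trans; [apply Rle_abs|]. apply HL.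
  eapply Rle_trans; [apply Rmax_r|exact Hl'].
Qed.

Lemma bigO_exp N : bigO N (fun l => exp (- l)).
Proof.
  apply (bigO_weaken (S N)); [lia|].
  set (k := INR (S N)).
  assert (Hk : 0 < k) by (apply lt_0_INR; lia).
  apply (bigO_intro _ _ (k ^ S N) 0). intros l Hl _.
  rewrite Rabs_right by (apply Rle_ge, Rlt_le, exp_pos).
  rewrite <- Rpow_mult_distr.
  replace (exp (- l)) with ((/ exp (l / k)) ^ S N).
  - apply pow_incr. split; [apply Rlt_le, Rinv_0_lt_compat, exp_pos|].
    replace (k * / l) with (/ (l / k)) by (field; lra).
    assert (0 < l / k) by (apply Rdiv_lt_0_compat; lra).
    apply Rinv_le_contravar; [assumption|].
    pose proof (exp_ineq1 (l / k) ltac:(lra)). lra.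
  - rewrite <- exp_Ropp, <- Rpower_pow by apply exp_pos.
    unfold Rpower. rewrite ln_exp. f_equal. fold k. field. lra.
Qed.

(** * Truncated Gaussian moments *)

(** The range |u| <= 1/2 keeps w(u) in a compact subset of the positive
    half-line; beyond it the integrand is exponentially small. *)
Definition gauss_moment (j : nat) (l : R) : R :=
  RInt (fun u => u ^ (2 * j) * exp (- (4 * l * u ^ 2))) (- / 2) (/ 2).

Lemma continuous_of_derive (f : R -> R) x : ex_derive f x -> continuous f x.
Proof. apply (ex_derive_continuous (K := R_AbsRing) (V := R_NormedModule)). Qed.

Lemma ex_RInt_cont (f : R -> R) a b : (forall x, continuous f x) -> ex_RInt f a b.
Proof.
  intros H. apply (ex_RInt_continuous (V := R_CompleteNormedModule)). intros; apply H.
Qed.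

Lemma gauss_moment_is_RInt j l :
  is_RInt (fun u => u ^ (2 * j) * exp (- (4 * l * u ^ 2))) (- / 2) (/ 2) (gauss_moment j l).
Proof.
  apply (RInt_correct (V := R_CompleteNormedModule)), ex_RInt_cont.
  intros x. apply continuous_of_derive. auto_derive; trivial.
Qed.

(** Integration by parts; the boundary term is exponentially small. *)
Lemma gauss_step j l :
  0 < l ->
  gauss_moment (S j) l = (INR j + 1 / 2) * (/ (4 * l)) * gauss_moment j l
                  - (/ 2) ^ (2 * j + 1) * exp (- l) / (4 * l).
Proof.
  intros Hl.
  set (F := fun u => u ^ (2 * j + 1) * exp (- (4 * l * u ^ 2))).
  assert (H1 : is_RInt (fun u => (2 * INR j + 1) * (u ^ (2 * j) * exp (- (4 * l * u ^ 2)))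
       - (8 * l) * (u ^ (2 * S j) * exp (- (4 * l * u ^ 2)))) (- / 2) (/ 2)
       (minus (F (/ 2)) (F (- / 2)))).
  { apply (is_RInt_derive (V := R_CompleteNormedModule) F).
    - intros u _. unfold F.
      assert (D1 : is_derive (fun u => - (4 * l * u ^ 2)) u (- (8 * l * u))).
      { auto_derive; [trivial|]. ring. }
      evar_last.
      + exact (is_derive_Rmult _ _ _ _ _
          (is_derive_pow (fun u => u) (2 * j + 1) u 1 (is_derive_id u)) (is_derive_exp_comp _ _ _ D1)).
      + replace (Nat.pred (2 * j + 1)) with (2 * j)%nat by lia.
        replace (2 * S j)%nat with (2 * j + 1 + 1)%nat by lia.
        rewrite plus_INR, mult_INR, !pow_add. simpl. ring.
    - intros u _. apply continuous_of_derive. auto_derive; trivial. }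
  assert (H2 : is_RInt (fun u => (2 * INR j + 1) * (u ^ (2 * j) * exp (- (4 * l * u ^ 2)))
       - (8 * l) * (u ^ (2 * S j) * exp (- (4 * l * u ^ 2)))) (- / 2) (/ 2)
       ((2 * INR j + 1) * gauss_moment j l - 8 * l * gauss_moment (S j) l)).
  { apply (is_RInt_minus (V := R_NormedModule));
      apply (is_RInt_scal (V := R_NormedModule)), gauss_moment_is_RInt. }
  apply (is_RInt_unique (V := R_CompleteNormedModule)) in H1.
  apply (is_RInt_unique (V := R_CompleteNormedModule)) in H2.
  rewrite H2 in H1. unfold minus, plus, opp in H1; simpl in H1. unfold F in H1.
  replace ((- / 2) ^ (2 * j + 1)) with (- (/ 2) ^ (2 * j + 1)) in H1.
  2:{ rewrite !pow_add, !pow_mult. replace ((- / 2) ^ 2) with ((/ 2) ^ 2) by ring. ring. }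
  replace (- (4 * l * (- / 2) ^ 2)) with (- l) in H1 by field.
  replace (- (4 * l * (/ 2) ^ 2)) with (- l) in H1 by field.
  apply Rmult_eq_reg_l with (8 * l); [|lra].
  replace (8 * l * gauss_moment (S j) l) with
    ((2 * INR j + 1) * gauss_moment j l - ((2 * INR j + 1) * gauss_moment j l - 8 * l * gauss_moment (S j) l)) by ring.
  rewrite H1. field. lra.
Qed.

(** sqrt l * gauss_moment 0 l is the integral of exp(-4 v^2) over [-sqrt l/2,
    sqrt l/2], that is, twice [gauss_half] at sqrt l/2. *)
Definition gauss_half (A : R) : R := RInt (fun v => exp (- (4 * v ^ 2))) 0 A.

Lemma gauss_half_cont v : continuous (fun v => exp (- (4 * v ^ 2))) v.
Proof. apply continuous_of_derive. auto_derive; trivial. Qed.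

Lemma gauss_half_diff A B :
  gauss_half B - gauss_half A = RInt (fun v => exp (- (4 * v ^ 2))) A B.
Proof.
  unfold gauss_half.
  rewrite <- (RInt_Chasles (V := R_CompleteNormedModule) (fun v => exp (- (4 * v ^ 2))) 0 A B).
  - unfold plus; simpl. ring.
  - apply ex_RInt_cont, gauss_half_cont.
  - apply ex_RInt_cont, gauss_half_cont.
Qed.

Lemma gauss_half_mono A B : A <= B -> gauss_half A <= gauss_half B.
Proof.
  intros H. cut (0 <= gauss_half B - gauss_half A); [lra|].
  rewrite gauss_half_diff. apply RInt_ge_0; [exact H|apply ex_RInt_cont, gauss_half_cont|].
  intros; apply Rlt_le, exp_pos.
Qed.

(** On v >= 1/2 the integrand is at most 2 v exp(-4 v^2), which has an
    elementary primitive. *)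
Lemma gauss_half_tail A B : / 2 <= A <= B -> gauss_half B - gauss_half A <= exp (- (4 * A ^ 2)).
Proof.
  intros H. rewrite gauss_half_diff.
  assert (H1 : is_RInt (fun v => 2 * v * exp (- (4 * v ^ 2))) A B
     (minus (- exp (- (4 * B ^ 2)) / 4) (- exp (- (4 * A ^ 2)) / 4))).
  { apply (is_RInt_derive (V := R_CompleteNormedModule) (fun v => - exp (- (4 * v ^ 2)) / 4)).
    - intros v _. auto_derive; [trivial|]. simpl. field.
    - intros v _. apply continuous_of_derive. auto_derive; trivial. }
  apply Rle_trans with (RInt (fun v => 2 * v * exp (- (4 * v ^ 2))) A B).
  - apply RInt_le; [lra|apply ex_RInt_cont, gauss_half_cont|eexists; exact H1|].
    intros v Hv. pose proof (exp_pos (- (4 * v ^ 2))). nra.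
  - rewrite (is_RInt_unique (V := R_CompleteNormedModule) _ _ _ _ H1).
    unfold minus, plus, opp; simpl.
    pose proof (exp_pos (- (4 * (A * (A * 1))))). pose proof (exp_pos (- (4 * (B * (B * 1))))). lra.
Qed.

Lemma gauss_0_scaled l : 0 < l -> sqrt l * gauss_moment 0 l = 2 * gauss_half (sqrt l / 2).
Proof.
  intros Hl. pose proof (sqrt_lt_R0 l Hl) as Hs.
  assert (E1 : RInt (fun v => exp (- (4 * v ^ 2))) (- (sqrt l / 2)) (sqrt l / 2) = sqrt l * gauss_moment 0 l).
  { replace (- (sqrt l / 2)) with (sqrt l * (- / 2) + 0) by field.
    replace (sqrt l / 2) with (sqrt l * / 2 + 0) by field.
    rewrite <- (RInt_comp_lin (V := R_CompleteNormedModule) (fun v => exp (- (4 * v ^ 2))) (sqrt l) 0 (- / 2) (/ 2)).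
    - unfold gauss_moment.
      change (sqrt l * ?x) with (scal (sqrt l) x).
      rewrite <- (RInt_scal (V := R_CompleteNormedModule)) by (eexists; apply gauss_moment_is_RInt).
      apply RInt_ext. intros v _. unfold scal; simpl; unfold mult; simpl. rewrite Rmult_1_l.
      f_equal. f_equal. f_equal.
      transitivity (4 * (sqrt l * sqrt l) * (v * (v * 1))); [ring|]. rewrite sqrt_sqrt by lra. ring.
    - apply ex_RInt_cont, gauss_half_cont. }
  rewrite <- E1, <- gauss_half_diff.
  assert (E2 : - gauss_half (sqrt l / 2) = gauss_half (- (sqrt l / 2))).
  { symmetry. unfold gauss_half at 1. apply (is_RInt_unique (V := R_CompleteNormedModule)).
    assert (H : is_RInt (fun v => exp (- (4 * v ^ 2))) (- 0) (- - (sqrt l / 2)) (gauss_half (sqrt l / 2))).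
    { rewrite Ropp_0, Ropp_involutive.
      apply (RInt_correct (V := R_CompleteNormedModule)), ex_RInt_cont, gauss_half_cont. }
    apply (is_RInt_comp_opp (V := R_NormedModule)), (is_RInt_opp (V := R_NormedModule)) in H.
    refine (is_RInt_ext (V := R_NormedModule) _ _ _ _ _ _ H).
    intros v _. unfold opp; simpl. rewrite Ropp_involutive. f_equal. ring. }
  rewrite <- E2. ring.
Qed.

(** The limit is the full Gaussian integral, reached at an exponential rate;
    it enters only the constant K, which cancels in the product a_n b_n. *)
Lemma gauss_0_limit :
  exists K c, 0 < K /\ 0 < c /\ (forall l, 1 <= l -> c <= sqrt l * gauss_moment 0 l) /\
    forall N, bigO N (fun l => sqrt l * gauss_moment 0 l - K).
Proof.
  set (c := gauss_half (/ 2)).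
  assert (Hc : 0 < c).
  { apply RInt_gt_0; [lra|intros; apply exp_pos|intros; apply gauss_half_cont]. }
  set (E := fun y => exists A, / 2 <= A /\ y = gauss_half A).
  destruct (completeness E) as [S [HS1 HS2]].
  { exists (c + exp (- (4 * (/ 2) ^ 2))). intros y [A [HA ->]].
    pose proof (gauss_half_tail (/ 2) A). unfold c. lra. }
  { exists c, (/ 2). split; [lra|reflexivity]. }
  assert (Hs : forall l, 1 <= l -> / 2 <= sqrt l / 2).
  { intros l Hl. pose proof (sqrt_le_1 1 l ltac:(lra) ltac:(lra) Hl) as H.
    rewrite sqrt_1 in H. lra. }
  assert (HcS : c <= S) by (apply HS1; exists (/ 2); split; [lra|reflexivity]).
  exists (2 * S), (2 * c). split; [lra|split; [lra|split]].
  - intros l Hl. rewrite gauss_0_scaled by lra.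
    pose proof (gauss_half_mono _ _ (Hs l Hl)). unfold c; lra.
  - intros N. apply (bigO_le N _ (fun l => 2 * exp (- l)) 0); [|apply bigO_scal, bigO_exp].
    intros l Hl _. rewrite gauss_0_scaled by lra.
    pose proof (Hs l Hl) as HA.
    assert (H1 : gauss_half (sqrt l / 2) <= S) by (apply HS1; exists (sqrt l / 2); split; [exact HA|reflexivity]).
    assert (H2 : S <= gauss_half (sqrt l / 2) + exp (- l)).
    { apply HS2. intros y [B [HB ->]].
      destruct (Rle_dec B (sqrt l / 2)) as [H|H].
      - pose proof (gauss_half_mono _ _ H). pose proof (exp_pos (- l)). lra.
      - pose proof (gauss_half_tail (sqrt l / 2) B ltac:(lra)) as H'.
        replace (- (4 * (sqrt l / 2) ^ 2)) with (- l) in H'; [lra|].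
        simpl. rewrite <- (sqrt_sqrt l) at 1 by lra. field. }
    rewrite Rabs_left1; lra.
Qed.

Lemma bigO_gauss_mult N f : bigO (S N) f -> bigO N (fun l => f l / gauss_moment 0 l).
Proof.
  destruct gauss_0_limit as (K & c & HK & Hc & Hlow & _).
  intros (C & L & H1 & HC & HL).
  apply (bigO_intro _ _ (C / c) L). intros l Hl Hl'.
  pose proof (sqrt_lt_R0 l ltac:(lra)) as Hs.
  assert (Hg : c / l <= gauss_moment 0 l).
  { apply Rmult_le_reg_l with (sqrt l); [exact Hs|].
    eapply Rle_trans; [|apply Hlow, Hl].
    apply Rmult_le_reg_r with (sqrt l); [exact Hs|].
    replace (sqrt l * (c / l) * sqrt l) with (sqrt l * sqrt l * c / l) by (field; lra).
    rewrite sqrt_sqrt by lra. replace (l * c / l) with c by (field; lra).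
    rewrite <- (Rmult_1_r c) at 1. apply Rmult_le_compat_l; [lra|].
    rewrite <- sqrt_1. apply sqrt_le_1; lra. }
  assert (Hcl : 0 < c / l) by (apply Rdiv_lt_0_compat; lra).
  unfold Rdiv. rewrite Rabs_mult, (Rabs_right (/ gauss_moment 0 l))
    by (apply Rle_ge, Rlt_le, Rinv_0_lt_compat; lra).
  apply Rle_trans with (C * (/ l) ^ S N * (/ (c / l))).
  - apply Rmult_le_compat; [apply Rabs_pos|apply Rlt_le, Rinv_0_lt_compat; lra|apply HL, Hl'|].
    apply Rinv_le_contravar; lra.
  - right. simpl. field. repeat split; lra.
Qed.

(** Iterating [gauss_step] gives the full Gaussian moments (1/2)_j (4l)^{-j},
    up to exponentially small terms. *)
Lemma gauss_ratio j :
  forall N, bigO N (fun l => gauss_moment j l / gauss_moment 0 l - pochhammer (1 / 2) j * (/ (4 * l)) ^ j).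
Proof.
  destruct gauss_0_limit as (K & c & HK & Hc & Hlow & _).
  assert (Hg0 : forall l, 1 <= l -> gauss_moment 0 l <> 0).
  { intros l Hl H. specialize (Hlow l Hl). rewrite H in Hlow. lra. }
  induction j as [|j IH]; intros N.
  - apply (bigO_ext _ (fun _ => 0) _ 0).
    + intros l Hl _. simpl. field. apply Hg0, Hl.
    + apply (bigO_intro _ _ 0 0). intros. rewrite Rabs_R0; lra.
  - apply (bigO_ext _ (fun l => (INR j + 1 / 2) * / 4 * ((/ l) ^ 1 *
       (gauss_moment j l / gauss_moment 0 l - pochhammer (1 / 2) j * (/ (4 * l)) ^ j))
       - (/ 2) ^ (2 * j + 1) * / 4 * ((/ l) ^ 1 * (exp (- l) / gauss_moment 0 l))) _ 0).
    + intros l Hl _. rewrite gauss_step by lra. cbn [pochhammer pow]. field.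
      split; [lra|apply Hg0, Hl].
    + apply bigO_minus; apply bigO_scal, (bigO_weaken (1 + N)); try lia;
        apply bigO_mult; try apply bigO_pow; [apply IH|].
      apply bigO_gauss_mult, bigO_exp.
Qed.

(** * The substitution w and its even part *)

Definition root (u : R) : R := sqrt (1 + u ^ 2).
(** For u = sinh t this is e^{2t}, and w + 1/w = 2 cosh(2t) = 2 + 4 u^2. *)
Definition w (u : R) : R := (u + root u) ^ 2.

Lemma root_sqr u : root u * root u = 1 + u ^ 2.
Proof. unfold root. apply sqrt_sqrt. pose proof (pow2_ge_0 u). lra. Qed.

Lemma root_ge1 u : 1 <= root u.
Proof.
  unfold root. pose proof (pow2_ge_0 u).
  apply Rle_trans with (sqrt 1); [rewrite sqrt_1; lra|apply sqrt_le_1; lra].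
Qed.

Lemma root_opp u : root (- u) = root u.
Proof. unfold root. f_equal. ring. Qed.

Lemma w_pos u : 0 < w u.
Proof.
  unfold w. pose proof (root_sqr u). pose proof (root_ge1 u).
  apply pow_lt, Rnot_le_lt. intros Hle.
  assert (0 <= (- u - root u) * (- u + root u)) by (apply Rmult_le_pos; lra).
  simpl in *. lra.
Qed.

Lemma w_opp u : w (- u) = / w u.
Proof.
  apply Rmult_eq_reg_r with (w u); [|apply Rgt_not_eq, w_pos].
  rewrite Rinv_l by apply Rgt_not_eq, w_pos.
  unfold w. rewrite root_opp.
  transitivity ((root u * root u - u ^ 2) ^ 2); [ring|]. rewrite root_sqr. ring.
Qed.

Lemma w_sum u : w u + / w u = 2 + 4 * u ^ 2.
Proof.
  rewrite <- w_opp. unfold w. rewrite root_opp.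
  transitivity (2 * (root u * root u) + 2 * u ^ 2); [ring|]. rewrite root_sqr. ring.
Qed.

Lemma sqr_le_quarter u : - / 2 <= u <= / 2 -> 0 <= u ^ 2 <= / 4.
Proof. intros H. simpl. nra. Qed.

Lemma w_le3 u : - / 2 <= u <= / 2 -> w u <= 3.
Proof.
  intros H. pose proof (w_sum u). pose proof (sqr_le_quarter u H). pose proof (w_pos u) as Hw.
  apply Rinv_0_lt_compat in Hw. lra.
Qed.

Lemma root_derive u : is_derive root u (u / root u).
Proof.
  unfold root. pose proof (pow2_ge_0 u). simpl in *.
  auto_derive; [lra|]. field.
  apply Rgt_not_eq, sqrt_lt_R0. lra.
Qed.

Lemma w_derive u : is_derive w u (2 * w u / root u).
Proof.
  unfold w.
  assert (H : is_derive (fun u => u + root u) u (1 + u / root u)).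
  { apply (is_derive_plus (K := R_AbsRing) (V := R_NormedModule));
      [apply (is_derive_id (K := R_AbsRing))|apply root_derive]. }
  evar_last; [exact (is_derive_pow _ 2 _ _ H)|].
  pose proof (root_ge1 u). simpl. field. lra.
Qed.

Lemma w_cont u : continuous w u.
Proof. apply continuous_of_derive. eexists; apply w_derive. Qed.

Lemma continuous_Rmult (f g : R -> R) x :
  continuous f x -> continuous g x -> continuous (fun u => f u * g u) x.
Proof. apply (continuous_mult (K := R_AbsRing)). Qed.

Lemma inv_root_cont u : continuous (fun u => / root u) u.
Proof.
  apply continuous_of_derive. pose proof (root_ge1 u).
  eexists. apply (is_derive_inv root u _ (root_derive u)). lra.
Qed.

Lemma pow_cont (f : R -> R) n x : continuous f x -> continuous (fun u => f u ^ n) x.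
Proof.
  intros Hf. induction n as [|n IH]; simpl; [apply continuous_const|].
  apply continuous_Rmult; assumption.
Qed.

(** The coefficient of u^{2j} in cosh(2at)/cosh t, where u = sinh t. *)
Definition cosh_coeff (a : R) (j : nat) : R :=
  pochhammer (a - INR j + 1 / 2) (2 * j) / (INR (fact j) * pochhammer (1 / 2) j).

Lemma pochhammer_Sl x n : pochhammer x (S n) = x * pochhammer (x + 1) n.
Proof.
  induction n as [|n IH]; [simpl; ring|].
  change (pochhammer x (S (S n))) with (pochhammer x (S n) * (x + INR (S n))).
  rewrite IH. simpl pochhammer. rewrite S_INR. ring.
Qed.

Lemma pochhammer_half_pos j : 0 < pochhammer (1 / 2) j.
Proof.
  induction j as [|j IH]; simpl; [lra|]. pose proof (pos_INR j).
  apply Rmult_lt_0_compat; lra.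
Qed.

Lemma cosh_coeff_S a j :
  cosh_coeff a (S j) = cosh_coeff a j * ((a - INR j - 1 / 2) * (a + INR j + 1 / 2))
                / ((INR j + 1) * (INR j + 1 / 2)).
Proof.
  unfold cosh_coeff. replace (2 * S j)%nat with (S (S (2 * j))) by lia.
  rewrite pochhammer_Sl. rewrite S_INR.
  replace (a - (INR j + 1) + 1 / 2 + 1) with (a - INR j + 1 / 2) by ring.
  cbn [pochhammer]. change (fact (S j)) with (S j * fact j)%nat.
  rewrite ?mult_INR, ?S_INR, ?mult_INR, ?S_INR. change (INR 0) with 0.
  pose proof (pochhammer_half_pos j). pose proof (INR_fact_lt_0 j). pose proof (pos_INR j).
  field. repeat split; lra.
Qed.

Lemma cosh_coeff_opp a j : cosh_coeff (- a) j = cosh_coeff a j.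
Proof.
  induction j as [|j IH]; [unfold cosh_coeff; simpl; reflexivity|].
  rewrite !cosh_coeff_S, IH. f_equal. ring.
Qed.

Lemma cosh_coeff_0 a : cosh_coeff a 0 = 1.
Proof. unfold cosh_coeff; simpl. field. Qed.

(** The three Pochhammer symbols share the factor (a - j + 1/2)_{2j}. *)
Lemma cosh_coeff_second_difference a j :
  cosh_coeff (a + 1) (S j) + cosh_coeff (a - 1) (S j) - 2 * cosh_coeff a (S j) = 4 * cosh_coeff a j.
Proof.
  unfold cosh_coeff. replace (2 * S j)%nat with (S (S (2 * j))) by lia.
  rewrite (pochhammer_Sl (a - INR (S j) + 1 / 2)).
  rewrite (pochhammer_Sl (a - 1 - INR (S j) + 1 / 2)), (pochhammer_Sl (a - 1 - INR (S j) + 1 / 2 + 1)).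
  rewrite !S_INR.
  replace (a + 1 - (INR j + 1) + 1 / 2) with (a - INR j + 1 / 2) by ring.
  replace (a - (INR j + 1) + 1 / 2 + 1) with (a - INR j + 1 / 2) by ring.
  replace (a - 1 - (INR j + 1) + 1 / 2 + 1 + 1) with (a - INR j + 1 / 2) by ring.
  cbn [pochhammer]. change (fact (S j)) with (S j * fact j)%nat.
  rewrite ?mult_INR, ?S_INR, ?mult_INR, ?S_INR. change (INR 0) with 0.
  pose proof (pochhammer_half_pos j). pose proof (INR_fact_lt_0 j). pose proof (pos_INR j).
  field. repeat split; lra.
Qed.

Lemma cosh_coeff_zero j : cosh_coeff 0 j = inv_sqrt_coeff j.
Proof.
  induction j as [|j IH]; [apply cosh_coeff_0|].
  rewrite cosh_coeff_S, IH. simpl. pose proof (pos_INR j). field. lra.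
Qed.

Lemma psum_cosh_coeff_rec a y J :
  psum (fun j => cosh_coeff (a + 1) j * y ^ j) (S J) + psum (fun j => cosh_coeff (a - 1) j * y ^ j) (S J)
  = 2 * psum (fun j => cosh_coeff a j * y ^ j) (S J) + 4 * y * psum (fun j => cosh_coeff a j * y ^ j) J.
Proof.
  induction J as [|J IH].
  - simpl. rewrite !cosh_coeff_0. ring.
  - change (psum (fun j => cosh_coeff (a + 1) j * y ^ j) (S (S J)))
      with (psum (fun j => cosh_coeff (a + 1) j * y ^ j) (S J) + cosh_coeff (a + 1) (S J) * y ^ S J).
    change (psum (fun j => cosh_coeff (a - 1) j * y ^ j) (S (S J)))
      with (psum (fun j => cosh_coeff (a - 1) j * y ^ j) (S J) + cosh_coeff (a - 1) (S J) * y ^ S J).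
    change (psum (fun j => cosh_coeff a j * y ^ j) (S (S J)))
      with (psum (fun j => cosh_coeff a j * y ^ j) (S J) + cosh_coeff a (S J) * y ^ S J).
    change (psum (fun j => cosh_coeff a j * y ^ j) (S J)) with (psum (fun j => cosh_coeff a j * y ^ j) J + cosh_coeff a J * y ^ J) at 2.
    pose proof (cosh_coeff_second_difference a J) as H.
    replace (cosh_coeff (a + 1) (S J)) with (4 * cosh_coeff a J + 2 * cosh_coeff a (S J) - cosh_coeff (a - 1) (S J)) by lra.
    transitivity ((psum (fun j => cosh_coeff (a + 1) j * y ^ j) (S J) + psum (fun j => cosh_coeff (a - 1) j * y ^ j) (S J))
       + (4 * cosh_coeff a J + 2 * cosh_coeff a (S J)) * y ^ S J); [ring|].
    rewrite IH. simpl (y ^ S J). ring.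
Qed.

(** The even part of w(u)^nu / sqrt(1+u^2), equal to cosh(2 nu t)/cosh t for u
    = sinh t. *)
Definition cosh_ratio (nu : nat) (u : R) : R := (w u ^ nu + (/ w u) ^ nu) / 2 * / root u.

Lemma cosh_ratio_rec nu u : cosh_ratio (S (S nu)) u + cosh_ratio nu u = (2 + 4 * u ^ 2) * cosh_ratio (S nu) u.
Proof.
  unfold cosh_ratio. rewrite <- w_sum. simpl. pose proof (w_pos u). pose proof (root_ge1 u).
  rewrite !pow_inv. field. repeat split; try lra. apply pow_nonzero; lra.
Qed.

(** The identity cosh(2(a+1)t) + cosh(2(a-1)t) = (2 + 4 u^2) cosh(2at) matches
    [cosh_coeff_second_difference], so the expansion propagates from one order
    to the next; order 0 is the binomial series of (1+u^2)^{-1/2}. *)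
Lemma cosh_ratio_expansion nu J :
  exists C, 0 <= C /\ forall u, - / 2 <= u <= / 2 ->
    Rabs (cosh_ratio nu u - psum (fun j => cosh_coeff (INR nu) j * (u ^ 2) ^ j) J) <= C * (u ^ 2) ^ J.
Proof.
  revert J.
  assert (Base : forall J, exists C, 0 <= C /\ forall u, - / 2 <= u <= / 2 ->
    Rabs (cosh_ratio 0 u - psum (fun j => cosh_coeff 0 j * (u ^ 2) ^ j) J) <= C * (u ^ 2) ^ J).
  { intros J. destruct (PSeries_tail 1 inv_sqrt_coeff J ltac:(lra) inv_sqrt_coeff_geometric) as [C [HC H]].
    exists C. split; [exact HC|]. intros u Hu. pose proof (sqr_le_quarter u Hu) as Hy.
    assert (Ha : Rabs (u ^ 2) = u ^ 2) by (apply Rabs_right; lra).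
    specialize (H (u ^ 2)). rewrite Ha in H. specialize (H ltac:(lra)).
    rewrite inv_sqrt_series in H by (rewrite Ha; lra).
    replace (cosh_ratio 0 u) with (/ sqrt (1 + u ^ 2)) by (unfold cosh_ratio, root; simpl; lra).
    rewrite (psum_ext _ (fun k => inv_sqrt_coeff k * (u ^ 2) ^ k)); [exact H|].
    intros k _. rewrite cosh_coeff_zero; reflexivity. }
  (* The factor 4 u^2 raises the degree, so the middle function is needed to one
     term less as well. *)
  assert (Step : forall a (f0 f1 f2 : R -> R),
    (forall u, f2 u + f0 u = (2 + 4 * u ^ 2) * f1 u) ->
    (forall J, exists C, 0 <= C /\ forall u, - / 2 <= u <= / 2 ->
      Rabs (f0 u - psum (fun j => cosh_coeff (a - 1) j * (u ^ 2) ^ j) J) <= C * (u ^ 2) ^ J) ->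
    (forall J, exists C, 0 <= C /\ forall u, - / 2 <= u <= / 2 ->
      Rabs (f1 u - psum (fun j => cosh_coeff a j * (u ^ 2) ^ j) J) <= C * (u ^ 2) ^ J) ->
    (forall J, exists C, 0 <= C /\ forall u, - / 2 <= u <= / 2 ->
      Rabs (f2 u - psum (fun j => cosh_coeff (a + 1) j * (u ^ 2) ^ j) J) <= C * (u ^ 2) ^ J)).
  { intros a f0 f1 f2 Hrec H0 H1 [|J].
    - destruct (H0 0%nat) as [C0 [P0 B0]], (H1 0%nat) as [C1 [P1 B1]].
      exists (3 * C1 + C0). split; [lra|]. intros u Hu. specialize (B0 u Hu). specialize (B1 u Hu).
      simpl psum in *. rewrite Rminus_0_r in *. simpl ((u ^ 2) ^ 0) in *. rewrite Rmult_1_r in *.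
      replace (f2 u) with ((2 + 4 * u ^ 2) * f1 u + - f0 u) by (rewrite <- Hrec; ring).
      eapply Rle_trans; [apply Rabs_triang|]. rewrite Rabs_Ropp, Rabs_mult.
      pose proof (sqr_le_quarter u Hu) as Hy. rewrite (Rabs_right (2 + 4 * u ^ 2)) by lra.
      pose proof (Rabs_pos (f1 u)).
      apply Rplus_le_compat; [|exact B0]. apply Rmult_le_compat; lra.
    - destruct (H0 (S J)) as [C0 [P0 B0]], (H1 (S J)) as [C1 [P1 B1]], (H1 J) as [C2 [P2 B2]].
      exists (2 * C1 + C0 + 4 * C2). split; [lra|]. intros u Hu.
      specialize (B0 u Hu). specialize (B1 u Hu). specialize (B2 u Hu).
      pose proof (sqr_le_quarter u Hu) as Hy.
      set (y := u ^ 2) in *.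
      pose proof (psum_cosh_coeff_rec a y J) as E. specialize (Hrec u). fold y in Hrec.
      set (A0 := psum (fun j => cosh_coeff (a - 1) j * y ^ j) (S J)) in *.
      set (A1 := psum (fun j => cosh_coeff a j * y ^ j) (S J)) in *.
      set (A2 := psum (fun j => cosh_coeff (a + 1) j * y ^ j) (S J)) in *.
      set (A3 := psum (fun j => cosh_coeff a j * y ^ j) J) in *.
      replace (f2 u - A2) with (2 * (f1 u - A1) + - (f0 u - A0) + 4 * y * (f1 u - A3)).
      2:{ replace (f2 u) with ((2 + 4 * y) * f1 u - f0 u) by lra.
          replace A2 with (2 * A1 + 4 * y * A3 - A0) by lra. ring. }
      eapply Rle_trans; [apply Rabs_triang|].
      replace ((2 * C1 + C0 + 4 * C2) * y ^ S J) with (2 * (C1 * y ^ S J) + C0 * y ^ S J + 4 * y * (C2 * y ^ J))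
        by (simpl; ring).
      apply Rplus_le_compat.
      + eapply Rle_trans; [apply Rabs_triang|]. rewrite Rabs_Ropp, Rabs_mult, (Rabs_right 2) by lra.
        apply Rplus_le_compat; [|exact B0]. apply Rmult_le_compat_l; [lra|exact B1].
      + rewrite Rabs_mult, (Rabs_right (4 * y)) by lra.
        apply Rmult_le_compat_l; [lra|exact B2]. }
  (* Order 1 follows from order 0 alone, since the orders 1 and -1 coincide. *)
  assert (Base1 : forall J, exists C, 0 <= C /\ forall u, - / 2 <= u <= / 2 ->
    Rabs (cosh_ratio 1 u - psum (fun j => cosh_coeff 1 j * (u ^ 2) ^ j) J) <= C * (u ^ 2) ^ J).
  { assert (E1 : forall u, cosh_ratio 1 u = cosh_ratio 0 u + 2 * u ^ 2 * cosh_ratio 0 u).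
    { intros u. unfold cosh_ratio. rewrite !pow_O, !pow_1, w_sum. pose proof (root_ge1 u). field. lra. }
    intros [|J].
    - destruct (Base 0%nat) as [C [HC B]]. exists (3 * C). split; [lra|]. intros u Hu.
      specialize (B u Hu). pose proof (sqr_le_quarter u Hu) as Hy.
      simpl psum in *. rewrite Rminus_0_r in *. simpl ((u ^ 2) ^ 0) in *. rewrite Rmult_1_r in *.
      rewrite E1. replace (cosh_ratio 0 u + 2 * u ^ 2 * cosh_ratio 0 u) with ((1 + 2 * u ^ 2) * cosh_ratio 0 u) by ring.
      rewrite Rabs_mult, (Rabs_right (1 + 2 * u ^ 2)) by lra. pose proof (Rabs_pos (cosh_ratio 0 u)).
      apply Rmult_le_compat; lra.
    - destruct (Base (S J)) as [C1 [P1 B1]], (Base J) as [C2 [P2 B2]].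
      exists (C1 + 2 * C2). split; [lra|]. intros u Hu.
      specialize (B1 u Hu). specialize (B2 u Hu). pose proof (sqr_le_quarter u Hu) as Hy.
      rewrite E1. set (y := u ^ 2) in *.
      pose proof (psum_cosh_coeff_rec 0 y J) as E.
      rewrite (psum_ext (fun j => cosh_coeff (0 - 1) j * y ^ j) (fun j => cosh_coeff (0 + 1) j * y ^ j)) in E.
      2:{ intros k _. rewrite <- (cosh_coeff_opp (0 - 1)). do 2 f_equal. ring. }
      replace (0 + 1) with 1 in E by ring.
      set (A0 := psum (fun j => cosh_coeff 0 j * y ^ j) (S J)) in *.
      set (A1 := psum (fun j => cosh_coeff 1 j * y ^ j) (S J)) in *.
      set (A3 := psum (fun j => cosh_coeff 0 j * y ^ j) J) in *.
      replace A1 with (A0 + 2 * y * A3) by lra.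
      replace (_ - _) with ((cosh_ratio 0 u - A0) + 2 * y * (cosh_ratio 0 u - A3)) by ring.
      replace ((C1 + 2 * C2) * y ^ S J) with (C1 * y ^ S J + 2 * y * (C2 * y ^ J)) by (simpl; ring).
      eapply Rle_trans; [apply Rabs_triang|]. apply Rplus_le_compat; [exact B1|].
      rewrite Rabs_mult, (Rabs_right (2 * y)) by lra.
      apply Rmult_le_compat_l; [lra|exact B2]. }
  cut ((forall J, exists C, 0 <= C /\ forall u, - / 2 <= u <= / 2 ->
    Rabs (cosh_ratio nu u - psum (fun j => cosh_coeff (INR nu) j * (u ^ 2) ^ j) J) <= C * (u ^ 2) ^ J) /\
   (forall J, exists C, 0 <= C /\ forall u, - / 2 <= u <= / 2 ->
    Rabs (cosh_ratio (S nu) u - psum (fun j => cosh_coeff (INR (S nu)) j * (u ^ 2) ^ j) J) <= C * (u ^ 2) ^ J)); [tauto|].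
  induction nu as [|nu [IH0 IH1]]; [split; [exact Base|exact Base1]|].
  split; [exact IH1|].
  rewrite (S_INR (S nu)). apply (Step (INR (S nu)) (cosh_ratio nu) (cosh_ratio (S nu)) (cosh_ratio (S (S nu)))).
  - intros u. apply cosh_ratio_rec.
  - rewrite S_INR. replace (INR nu + 1 - 1) with (INR nu) by ring. exact IH0.
  - exact IH1.
Qed.

(** * Integrals of Bessel type *)

Definition gaussian (l u : R) : R := exp (- (4 * l * u ^ 2)).

Lemma gaussian_cont l u : continuous (gaussian l) u.
Proof. apply continuous_of_derive. unfold gaussian. auto_derive; trivial. Qed.

Lemma gaussian_ex_RInt l (f : R -> R) :
  (forall u, - / 2 <= u <= / 2 -> continuous f u) ->
  ex_RInt (fun u => gaussian l u * f u) (- / 2) (/ 2).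
Proof.
  intros Hf. apply (ex_RInt_continuous (V := R_CompleteNormedModule)).
  intros u Hu. rewrite Rmin_left, Rmax_right in Hu by lra.
  apply continuous_Rmult; [apply gaussian_cont|apply Hf, Hu].
Qed.

Lemma gauss_moment_is_RInt_sqr j l :
  is_RInt (fun u => gaussian l u * (u ^ 2) ^ j) (- / 2) (/ 2) (gauss_moment j l).
Proof.
  refine (is_RInt_ext (V := R_NormedModule) _ _ _ _ _ _ (gauss_moment_is_RInt j l)).
  intros u _. rewrite <- pow_mult. unfold gaussian. simpl. ring.
Qed.

Lemma gaussian_dominated l (f : R -> R) C j :
  (forall u, - / 2 <= u <= / 2 -> continuous f u) ->
  (forall u, - / 2 <= u <= / 2 -> Rabs (f u) <= C * (u ^ 2) ^ j) ->
  Rabs (RInt (fun u => gaussian l u * f u) (- / 2) (/ 2)) <= C * gauss_moment j l.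
Proof.
  intros Hc Hb.
  assert (HC : is_RInt (fun u => C * (gaussian l u * (u ^ 2) ^ j)) (- / 2) (/ 2) (C * gauss_moment j l)).
  { apply (is_RInt_scal (V := R_NormedModule)), gauss_moment_is_RInt_sqr. }
  eapply Rle_trans; [apply abs_RInt_le; [lra|apply gaussian_ex_RInt, Hc]|].
  rewrite <- (is_RInt_unique (V := R_CompleteNormedModule) _ _ _ _ HC).
  apply RInt_le; [lra| |eexists; exact HC|].
  - apply (ex_RInt_continuous (V := R_CompleteNormedModule)).
    intros u Hu. rewrite Rmin_left, Rmax_right in Hu by lra.
    apply (continuous_comp (fun u => gaussian l u * f u) Rabs).
    + apply continuous_Rmult; [apply gaussian_cont|apply Hc, Hu].
    + apply continuous_Rabs.
  - intros u Hu. rewrite Rabs_mult, Rabs_right by (apply Rle_ge, Rlt_le, exp_pos).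
    rewrite <- Rmult_assoc, (Rmult_comm C), Rmult_assoc.
    apply Rmult_le_compat_l; [apply Rlt_le, exp_pos|apply Hb; lra].
Qed.

Lemma is_RInt_psum (f : nat -> R -> R) (L : nat -> R) a b n :
  (forall k, (k < n)%nat -> is_RInt (f k) a b (L k)) ->
  is_RInt (fun u => psum (fun k => f k u) n) a b (psum L n).
Proof.
  induction n as [|n IH]; intros H; simpl.
  - evar_last; [apply (is_RInt_const (V := R_NormedModule))|]. unfold scal; simpl; unfold mult; simpl; ring.
  - apply (is_RInt_plus (V := R_NormedModule)); [apply IH; intros; apply H; lia|apply H; lia].
Qed.

(** Up to an exponential factor and the truncation to |u| <= 1/2, this is the
    modified Bessel function K_nu(2l). *)
Definition bessel (nu : nat) (l : R) : R :=
  RInt (fun u => gaussian l u * (w u ^ nu * / root u)) (- / 2) (/ 2).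

Lemma bessel_integrand_cont nu u : continuous (fun u => w u ^ nu * / root u) u.
Proof. apply continuous_Rmult; [apply pow_cont, w_cont|apply inv_root_cont]. Qed.

Lemma bessel_is_RInt nu l :
  is_RInt (fun u => gaussian l u * (w u ^ nu * / root u)) (- / 2) (/ 2) (bessel nu l).
Proof.
  apply (RInt_correct (V := R_CompleteNormedModule)), gaussian_ex_RInt.
  intros; apply bessel_integrand_cont.
Qed.

(** The range is symmetric and w(-u) = 1/w(u), so only the even part of w^nu /
    sqrt(1+u^2) contributes. *)
Lemma bessel_even nu l : is_RInt (fun u => gaussian l u * cosh_ratio nu u) (- / 2) (/ 2) (bessel nu l).
Proof.
  pose proof (bessel_is_RInt nu l) as H.
  assert (H' : is_RInt (fun u => gaussian l u * (w u ^ nu * / root u)) (- - / 2) (- (/ 2)) (- bessel nu l)).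
  { rewrite Ropp_involutive. apply (is_RInt_swap (V := R_NormedModule)), H. }
  apply (is_RInt_comp_opp (V := R_NormedModule)), (is_RInt_opp (V := R_NormedModule)) in H'.
  pose proof (is_RInt_scal (V := R_NormedModule) _ _ _ (/ 2) _ (is_RInt_plus (V := R_NormedModule) _ _ _ _ _ _ H H')) as H2.
  evar_last.
  - refine (is_RInt_ext (V := R_NormedModule) _ _ _ _ _ _ H2).
    intros u _. unfold scal, plus, opp; simpl. unfold mult; simpl. unfold cosh_ratio.
    rewrite w_opp, root_opp. unfold gaussian. replace ((- u) ^ 2) with (u ^ 2) by ring.
    pose proof (w_pos u). pose proof (root_ge1 u). simpl. field. repeat split; lra.
  - unfold scal, plus, opp; simpl. unfold mult; simpl. field.
Qed.

Lemma cosh_ratio_cont nu u : continuous (cosh_ratio nu) u.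
Proof.
  unfold cosh_ratio. apply continuous_Rmult; [|apply inv_root_cont].
  apply (continuous_mult (K := R_AbsRing)); [|apply continuous_const].
  apply (continuous_plus (V := R_NormedModule)); apply pow_cont; [apply w_cont|].
  apply continuous_of_derive. pose proof (w_pos u). eexists. apply (is_derive_inv w u _ (w_derive u)). lra.
Qed.

Lemma gauss_0_nonzero l : 1 <= l -> 0 < gauss_moment 0 l.
Proof.
  intros Hl. destruct gauss_0_limit as (K & c & HK & Hc & Hlow & _).
  specialize (Hlow l Hl). pose proof (sqrt_lt_R0 l ltac:(lra)).
  apply Rnot_le_lt. intros H'. nra.
Qed.

Lemma gauss_ratio_bigO j : bigO j (fun l => gauss_moment j l / gauss_moment 0 l).
Proof.
  apply (bigO_ext _ (fun l => (gauss_moment j l / gauss_moment 0 l - pochhammer (1 / 2) j * (/ (4 * l)) ^ j)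
     + pochhammer (1 / 2) j * (/ 4) ^ j * (/ l) ^ j) _ 0).
  - intros l Hl _. rewrite Rinv_mult, Rpow_mult_distr. ring.
  - apply bigO_plus; [apply gauss_ratio|apply bigO_scal, bigO_pow].
Qed.

Lemma bessel_asymptotic nu J :
  bigO J (fun l => bessel nu l / gauss_moment 0 l -
    psum (fun j => cosh_coeff (INR nu) j * pochhammer (1 / 2) j * (/ 4) ^ j * (/ l) ^ j) J).
Proof.
  destruct (cosh_ratio_expansion nu J) as [C [HC H]].
  apply (bigO_ext _ (fun l =>
    (bessel nu l - psum (fun j => cosh_coeff (INR nu) j * gauss_moment j l) J) / gauss_moment 0 l
    + psum (fun j => cosh_coeff (INR nu) j * (gauss_moment j l / gauss_moment 0 l - pochhammer (1 / 2) j * (/ (4 * l)) ^ j)) J) _ 0).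
  - intros l Hl _. pose proof (gauss_0_nonzero l Hl).
    rewrite (psum_ext (fun j => cosh_coeff (INR nu) j * (gauss_moment j l / gauss_moment 0 l - pochhammer (1 / 2) j * (/ (4 * l)) ^ j))
      (fun j => / gauss_moment 0 l * (cosh_coeff (INR nu) j * gauss_moment j l)
         + (-1) * (cosh_coeff (INR nu) j * pochhammer (1 / 2) j * (/ 4) ^ j * (/ l) ^ j))).
    + rewrite psum_plus, !psum_scal. field. lra.
    + intros k _. rewrite Rinv_mult, Rpow_mult_distr. field. lra.
  - apply bigO_plus.
    + apply (bigO_le _ _ (fun l => C * (gauss_moment J l / gauss_moment 0 l)) 0); [|apply bigO_scal, gauss_ratio_bigO].
      intros l Hl _. pose proof (gauss_0_nonzero l Hl) as Hg.
      unfold Rdiv. rewrite Rabs_mult, (Rabs_right (/ gauss_moment 0 l))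
        by (apply Rle_ge, Rlt_le, Rinv_0_lt_compat, Hg).
      rewrite <- Rmult_assoc. apply Rmult_le_compat_r; [apply Rlt_le, Rinv_0_lt_compat, Hg|].
      assert (HI : is_RInt (fun u => gaussian l u * (cosh_ratio nu u - psum (fun j => cosh_coeff (INR nu) j * (u ^ 2) ^ j) J))
         (- / 2) (/ 2) (bessel nu l - psum (fun j => cosh_coeff (INR nu) j * gauss_moment j l) J)).
      { refine (is_RInt_ext (V := R_NormedModule) _ _ _ _ _ _
          (is_RInt_minus (V := R_NormedModule) _ _ _ _ _ _ (bessel_even nu l)
            (is_RInt_psum (fun j u => cosh_coeff (INR nu) j * (gaussian l u * (u ^ 2) ^ j)) _ _ _ J
              (fun k _ => is_RInt_scal (V := R_NormedModule) _ _ _ _ _ (gauss_moment_is_RInt_sqr k l))))).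
        intros u _. unfold minus, plus, opp; simpl.
        rewrite (psum_ext _ (fun j => gaussian l u * (cosh_coeff (INR nu) j * (u ^ 2) ^ j)))
          by (intros; simpl; ring).
        rewrite psum_scal. simpl. ring. }
      rewrite <- (is_RInt_unique (V := R_CompleteNormedModule) _ _ _ _ HI).
      apply gaussian_dominated; [|exact H].
      intros u _. apply (continuous_minus (V := R_NormedModule)); [apply cosh_ratio_cont|].
      clear. induction J as [|J IH]; simpl; [apply continuous_const|].
      apply (continuous_plus (V := R_NormedModule)); [exact IH|].
      apply continuous_of_derive. auto_derive; trivial.
    + apply bigO_psum. intros k _. apply bigO_scal, gauss_ratio.
Qed.

(** * The Laplace integral with amplitude exp(mu) *)

Definition laplace (e : nat -> R) (l : R) : R :=
  RInt (fun u => gaussian l u * (PSeries e (w u / l) * (w u * / root u))) (- / 2) (/ 2).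

(** The power l^{-i} collects the term of degree i-j of the amplitude and the
    j-th Gaussian correction of the Bessel integral of order i-j+1. *)
Definition laplace_coeff (e : nat -> R) (i : nat) : R :=
  psum (fun j => e (i - j)%nat * (cosh_coeff (INR (S (i - j))) j * pochhammer (1 / 2) j * (/ 4) ^ j)) (S i).

Lemma psum_triangle (f : nat -> nat -> R) N :
  psum (fun m => psum (fun j => f m j) (N - m)) N
  = psum (fun i => psum (fun j => f (i - j)%nat j) (S i)) N.
Proof.
  induction N as [|N IH]; [reflexivity|].
  change (psum (fun i => psum (fun j => f (i - j)%nat j) (S i)) (S N)) with
    (psum (fun i => psum (fun j => f (i - j)%nat j) (S i)) N + psum (fun j => f (N - j)%nat j) (S N)).
  rewrite <- IH.
  rewrite (psum_ext (fun m => psum (fun j => f m j) (S N - m))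
    (fun m => psum (fun j => f m j) (N - m) + f m (N - m)%nat)).
  2:{ intros m Hm. replace (S N - m)%nat with (S (N - m)) by lia. reflexivity. }
  rewrite psum_plus. f_equal.
  - simpl. rewrite Nat.sub_diag. simpl. ring.
  - rewrite (psum_rev (fun m => f m (N - m)%nat) N). apply psum_ext. intros k Hk. f_equal. lia.
Qed.

Lemma pseries_cont r e x : 0 < r -> geometric r e -> Rabs x * r < 1 -> continuous (PSeries e) x.
Proof.
  intros Hr He Hx. apply continuity_pt_filterlim, PSeries_continuity.
  exact (geometric_radius r e x Hr He Hx).
Qed.

(** The term of degree m of the amplitude contributes l^{-m} times a Bessel
    integral, whose own expansion is therefore needed to order N - m only. *)
Lemma laplace_asymptotic e N :
  geometric 2 e ->
  bigO N (fun l => laplace e l / gauss_moment 0 l - psum (fun i => laplace_coeff e i * (/ l) ^ i) N).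
Proof.
  intros He.
  destruct (PSeries_tail 2 e N ltac:(lra) He) as [C [HC H]].
  set (approx_solution := fun l => psum (fun m => e m * (/ l) ^ m * bessel (S m) l) N).
  apply (bigO_ext _ (fun l => (laplace e l - approx_solution l) / gauss_moment 0 l +
     psum (fun m => e m * ((/ l) ^ m * (bessel (S m) l / gauss_moment 0 l -
        psum (fun j => cosh_coeff (INR (S m)) j * pochhammer (1 / 2) j * (/ 4) ^ j * (/ l) ^ j) (N - m)))) N) _ 0).
  - intros l Hl _. pose proof (gauss_0_nonzero l Hl).
    assert (Etri : psum (fun i => laplace_coeff e i * (/ l) ^ i) N =
      psum (fun m => psum (fun j => e m * (/ l) ^ m * (cosh_coeff (INR (S m)) j * pochhammer (1 / 2) j * (/ 4) ^ j * (/ l) ^ j)) (N - m)) N).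
    { rewrite psum_triangle. apply psum_ext. intros i _. unfold laplace_coeff.
      rewrite Rmult_comm, <- psum_scal. apply psum_ext. intros j Hj.
      replace ((/ l) ^ i) with ((/ l) ^ (i - j) * (/ l) ^ j) by (rewrite <- pow_add; f_equal; lia).
      ring. }
    rewrite Etri. unfold approx_solution.
    rewrite (psum_ext (fun m => e m * ((/ l) ^ m * (bessel (S m) l / gauss_moment 0 l - _)))
      (fun m => / gauss_moment 0 l * (e m * (/ l) ^ m * bessel (S m) l) + (-1) *
         psum (fun j => e m * (/ l) ^ m * (cosh_coeff (INR (S m)) j * pochhammer (1 / 2) j * (/ 4) ^ j * (/ l) ^ j)) (N - m))).
    + rewrite psum_plus, !psum_scal. field. lra.
    + intros m _. rewrite psum_scal. field. lra.
  - apply bigO_plus.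
    + apply (bigO_le _ _ (fun l => C * 3 ^ N * 3 * (/ l) ^ N) 12); [|apply bigO_scal, bigO_pow].
      intros l Hl Hl12. pose proof (gauss_0_nonzero l Hl) as Hg.
      assert (Hw : forall u, - / 2 <= u <= / 2 -> 0 < w u / l <= 3 / l /\ Rabs (w u / l) * 2 <= / 2).
      { intros u Hu. pose proof (w_pos u). pose proof (w_le3 u Hu).
        assert (Hil : 0 < / l <= / 12) by (split; [apply Rinv_0_lt_compat|apply Rinv_le_contravar]; lra).
        rewrite Rabs_right by (unfold Rdiv; nra).
        unfold Rdiv; repeat split; nra. }
      assert (Hcont : forall u, - / 2 <= u <= / 2 ->
         continuous (fun u => PSeries e (w u / l) * (w u * / root u)) u).
      { intros u Hu. destruct (Hw u Hu) as [_ Hr].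
        apply continuous_Rmult; [|apply continuous_Rmult; [apply w_cont|apply inv_root_cont]].
        apply (continuous_comp (fun u => w u / l) (PSeries e)).
        - apply continuous_Rmult; [apply w_cont|apply continuous_const].
        - apply (pseries_cont 2); [lra|exact He|lra]. }
      assert (HI : is_RInt (fun u => gaussian l u *
          ((PSeries e (w u / l) - psum (fun m => e m * (w u / l) ^ m) N) * (w u * / root u)))
         (- / 2) (/ 2) (laplace e l - approx_solution l)).
      { refine (is_RInt_ext (V := R_NormedModule) _ _ _ _ _ _
          (is_RInt_minus (V := R_NormedModule) _ _ _ _ _ _
            (RInt_correct (V := R_CompleteNormedModule) _ _ _ (gaussian_ex_RInt l _ Hcont))
            (is_RInt_psum (fun m u => e m * (/ l) ^ m * (gaussian l u * (w u ^ S m * / root u))) _ _ _ N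
              (fun k _ => is_RInt_scal (V := R_NormedModule) _ _ _ _ _ (bessel_is_RInt (S k) l))))).
        intros u _. unfold minus, plus, opp; simpl.
        rewrite (psum_ext _ (fun m => (gaussian l u * (w u * / root u)) * (e m * (w u / l) ^ m))).
        - rewrite psum_scal. ring.
        - intros k _. unfold Rdiv. rewrite Rpow_mult_distr. simpl. ring. }
      unfold Rdiv. rewrite Rabs_mult, (Rabs_right (/ gauss_moment 0 l))
        by (apply Rle_ge, Rlt_le, Rinv_0_lt_compat, Hg).
      apply Rmult_le_reg_r with (gauss_moment 0 l); [exact Hg|].
      rewrite Rmult_assoc, Rinv_l, Rmult_1_r by lra.
      rewrite <- (is_RInt_unique (V := R_CompleteNormedModule) _ _ _ _ HI).
      apply gaussian_dominated.
      * intros u Hu. destruct (Hw u Hu) as [_ Hr].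
        apply continuous_Rmult; [|apply continuous_Rmult; [apply w_cont|apply inv_root_cont]].
        apply (continuous_minus (V := R_NormedModule)).
        -- apply (continuous_comp (fun u => w u / l) (PSeries e)).
           ++ apply continuous_Rmult; [apply w_cont|apply continuous_const].
           ++ apply (pseries_cont 2); [lra|exact He|lra].
        -- clear - Hl. induction N as [|N IH]; simpl; [apply continuous_const|].
           apply (continuous_plus (V := R_NormedModule)); [exact IH|].
           apply continuous_Rmult; [apply continuous_const|].
           apply pow_cont, continuous_Rmult; [apply w_cont|apply continuous_const].
      * intros u Hu. destruct (Hw u Hu) as [[Hw0 Hw3] Hr].
        pose proof (w_pos u) as Hwp. pose proof (w_le3 u Hu) as Hw3'. pose proof (root_ge1 u) as Hroot.
        simpl ((u ^ 2) ^ 0). rewrite Rmult_1_r.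
        assert (Hir : 0 < / root u <= 1).
        { split; [apply Rinv_0_lt_compat; lra|]. rewrite <- Rinv_1. apply Rinv_le_contravar; lra. }
        rewrite Rabs_mult.
        replace (C * 3 ^ N * 3 * (/ l) ^ N) with (C * (3 / l) ^ N * 3)
          by (unfold Rdiv; rewrite Rpow_mult_distr; ring).
        apply Rmult_le_compat; try apply Rabs_pos.
        -- eapply Rle_trans; [apply H, Hr|]. apply Rmult_le_compat_l; [exact HC|].
           apply pow_incr. rewrite Rabs_right by lra. lra.
        -- rewrite Rabs_right by (apply Rle_ge; nra). nra.
    + apply bigO_psum. intros m Hm. apply bigO_scal.
      replace N with (m + (N - m))%nat at 1 by lia.
      apply bigO_mult; [apply bigO_pow|apply bessel_asymptotic].
Qed.

(** * The expansion of the moments *)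

(** For nu = m - j + 1 the factor (1/2)_j in [laplace_coeff] cancels the one
    in [cosh_coeff], leaving (m - 2j + 3/2)_{2j} / (4^j j!). *)
Lemma c_eq_laplace_coeff (e : nat -> R) :
  (forall n, maclaurin (K := R_AbsRing) (fun h : R => exp (mu h)) n = e n) ->
  forall m, c m = (-1) ^ m * laplace_coeff e m.
Proof.
  intros He m. unfold c, laplace_coeff. f_equal.
  rewrite psum_sum_n. apply psum_ext. intros j Hj. rewrite He. f_equal.
  unfold cosh_coeff. rewrite S_INR, minus_INR by lia.
  replace (INR m - INR j + 1 - INR j + 1 / 2) with (INR m - 2 * INR j + 3 / 2) by field.
  rewrite pow_inv. pose proof (pochhammer_half_pos j). pose proof (INR_fact_lt_0 j).
  field. repeat split; try lra. apply pow_nonzero; lra.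
Qed.

(** This is the definition of mu: -1/(e^h - 1) = mu(h) - 1/h + 1/2. *)
Lemma phi_exp_mu h : 0 < h -> phi (exp (- h)) = exp (1 / 2) * exp (mu h) * exp (- / h).
Proof.
  intros Hh.
  assert (H1 : exp (- h) < 1) by (rewrite <- exp_0; apply exp_increasing; lra).
  rewrite phi_lt by exact H1. rewrite <- !exp_plus. f_equal.
  unfold mu. destruct (Req_dec_T h 0); [lra|].
  rewrite exp_Ropp. pose proof (exp_ineq1 h ltac:(lra)). pose proof (exp_pos h).
  field. repeat split; lra.
Qed.

Lemma ln_neg p : 0 < p < 1 -> ln p < 0.
Proof. intros Hp. rewrite <- ln_1. apply ln_increasing; lra. Qed.

(** Since 1 - p <= - ln p, the density is at most exp(1 - 1/h) at p = e^{-h}. *)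
Lemma moment_integrand_bound k p :
  0 < p < 1 -> 0 <= p ^ k * phi p <= exp (1 - (INR k * - ln p + / (- ln p))).
Proof.
  intros Hp. rewrite phi_lt by lra.
  pose proof (ln_neg p Hp) as Hln.
  split; [apply Rmult_le_pos; [apply pow_le; lra|apply Rlt_le, exp_pos]|].
  rewrite <- Rpower_pow by lra. unfold Rpower. rewrite <- exp_plus.
  assert (H : / (- ln p) <= / (1 - p)).
  { apply Rinv_le_contravar; [lra|].
    pose proof (exp_ineq1_le (ln p)) as H. rewrite exp_ln in H by lra. lra. }
  assert (Hle : INR k * ln p + (1 - / (1 - p)) <= 1 - (INR k * - ln p + / (- ln p))) by lra.
  destruct Hle as [Hlt|Heq]; [left; apply exp_increasing, Hlt|right; rewrite Heq; reflexivity].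
Qed.

Lemma exp_le a b : a <= b -> exp a <= exp b.
Proof. intros [H|H]; [left; apply exp_increasing, H|right; rewrite H; reflexivity]. Qed.

Lemma exp_w_derive l u :
  is_derive (fun u => exp (- (w u / l))) u (- (2 * w u / root u / l) * exp (- (w u / l))).
Proof.
  pose proof (is_derive_Rmult w (fun _ => / l) u _ _ (w_derive u) (is_derive_const (/ l) u)) as H.
  evar_last; [exact (is_derive_exp_comp _ _ _ (is_derive_Ropp _ _ _ H))|].
  simpl. unfold zero; simpl. unfold Rdiv; ring.
Qed.

Lemma exp_w_cont l u : continuous (fun u => exp (- (w u / l))) u.
Proof. apply continuous_of_derive. eexists; apply exp_w_derive. Qed.

(** The substitution p = exp(-w(u)/l) with l^2 = n, under which nh + 1/h = l
    (w + 1/w) = 2l + 4 l u^2. *)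
Lemma moment_main_part (e : nat -> R) (k : nat) (l : R) :
  geometric 2 e -> (forall h, Rabs h < / 2 -> PSeries e h = exp (mu h)) ->
  l * l = INR (S k) -> 12 <= l ->
  RInt (fun p => p ^ k * phi p) (exp (- (w (/ 2) / l))) (exp (- (w (- / 2) / l)))
  = 2 * exp (1 / 2) * exp (- (2 * l)) * / l * laplace e l.
Proof.
  intros Hge He Hll Hl.
  pose proof (RInt_comp (V := R_CompleteNormedModule) (fun p => p ^ k * phi p)
    (fun u => exp (- (w u / l))) (fun u => - (2 * w u / root u / l) * exp (- (w u / l))) (- / 2) (/ 2)) as H.
  cbv beta in H.
  rewrite <- (opp_RInt_swap (V := R_CompleteNormedModule)).
  2:{ apply ex_RInt_cont. intros; apply pow_phi_continuous. }
  rewrite <- H; clear H.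
  - unfold laplace.
    change (2 * exp (1 / 2) * exp (- (2 * l)) * / l * ?x)
      with (scal (2 * exp (1 / 2) * exp (- (2 * l)) * / l) x).
    rewrite <- (RInt_scal (V := R_CompleteNormedModule)).
    2:{ apply gaussian_ex_RInt. intros u Hu.
        pose proof (w_pos u). pose proof (w_le3 u Hu).
        apply continuous_Rmult; [|apply continuous_Rmult; [apply w_cont|apply inv_root_cont]].
        apply (continuous_comp (fun u => w u / l) (PSeries e)).
        - apply continuous_Rmult; [apply w_cont|apply continuous_const].
        - apply (pseries_cont 2); [lra|exact Hge|].
          assert (Hil : 0 < / l <= / 12) by (split; [apply Rinv_0_lt_compat|apply Rinv_le_contravar]; lra).
          rewrite Rabs_right by (unfold Rdiv; nra). unfold Rdiv; nra. }
    rewrite <- (RInt_opp (V := R_CompleteNormedModule)).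
    2:{ apply ex_RInt_cont. intros u.
        apply (continuous_mult (K := R_AbsRing)).
        - apply continuous_Rmult.
          + apply (continuous_opp (V := R_NormedModule)).
            apply continuous_Rmult; [|apply continuous_const].
            apply continuous_Rmult; [|apply inv_root_cont].
            apply continuous_Rmult; [apply continuous_const|apply w_cont].
          + apply exp_w_cont.
        - apply (continuous_comp (fun u => exp (- (w u / l))) (fun p => p ^ k * phi p)); [|apply pow_phi_continuous].
          apply exp_w_cont. }
    apply RInt_ext. intros u Hu. rewrite Rmin_left, Rmax_right in Hu by lra.
    assert (Hu' : - / 2 <= u <= / 2) by lra.
    pose proof (w_pos u) as Hw. pose proof (w_le3 u Hu'). pose proof (root_ge1 u).
    unfold scal, opp; simpl; unfold mult; simpl.
    assert (Hh : 0 < w u / l) by (apply Rdiv_lt_0_compat; lra).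
    rewrite phi_exp_mu by exact Hh.
    rewrite He.
    2:{ assert (Hil : 0 < / l <= / 12) by (split; [apply Rinv_0_lt_compat|apply Rinv_le_contravar]; lra).
        rewrite Rabs_right by lra. unfold Rdiv; nra. }
    unfold gaussian.
    assert (E : exp (- (w u / l)) * exp (- (w u / l)) ^ k * exp (- / (w u / l))
       = exp (- (2 * l)) * exp (- (4 * l * u ^ 2))).
    { change (exp (- (w u / l)) * exp (- (w u / l)) ^ k) with (exp (- (w u / l)) ^ S k).
      rewrite <- Rpower_pow by apply exp_pos. unfold Rpower. rewrite ln_exp, <- !exp_plus.
      f_equal. rewrite <- Hll.
      assert (Ew : forall W, 0 < W -> l * l * - (W / l) + - / (W / l) = - l * (W + / W)).
      { intros W HW. field. lra. }
      rewrite (Ew _ Hw). rewrite w_sum. ring. }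
    transitivity (2 * w u * / root u * / l * exp (1 / 2) * exp (mu (w u / l)) *
      (exp (- (w u / l)) * exp (- (w u / l)) ^ k * exp (- / (w u / l)))).
    + unfold Rdiv. ring.
    + rewrite E. simpl. ring.
  - intros u _. apply pow_phi_continuous.
  - intros u _. split.
    + apply exp_w_derive.
    + apply continuous_Rmult.
      * apply (continuous_opp (V := R_NormedModule)).
        apply continuous_Rmult; [|apply continuous_const].
        apply continuous_Rmult; [|apply inv_root_cont].
        apply continuous_Rmult; [apply continuous_const|apply w_cont].
      * apply exp_w_cont.
Qed.

Lemma w_half_ge1 : 1 <= w (/ 2).
Proof. unfold w. pose proof (root_ge1 (/ 2)). simpl. nra. Qed.

(** Outside the main range y = l h satisfies y + 1/y >= 3, while w + 1/w = 2
    at the saddle point; this gains a factor e^{-l}. *)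
Lemma moment_tail_bound k l p :
  l * l = INR (S k) -> 12 <= l ->
  0 < p < 1 -> p <= exp (- (w (/ 2) / l)) \/ exp (- (w (- / 2) / l)) <= p ->
  0 <= p ^ k * phi p <= exp (4 - 3 * l).
Proof.
  intros Hll Hl Hp Hor. destruct (moment_integrand_bound k p Hp) as [H1 H2].
  split; [exact H1|]. eapply Rle_trans; [exact H2|]. apply exp_le.
  rewrite S_INR in Hll.
  pose proof w_half_ge1 as HW. pose proof (w_sum (/ 2)) as HWs.
  rewrite w_opp in Hor. set (W := w (/ 2)) in *.
  set (y := l * - ln p).
  pose proof (ln_neg p Hp) as Hln.
  assert (Hy : 0 < y) by (unfold y; nra).
  assert (Hor' : W <= y \/ y <= / W).
  { destruct Hor as [H|H]; [left|right].
    - assert (Hle : ln p <= - (W / l)).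
      { rewrite <- (ln_exp (- (W / l))). destruct H as [H|H]; [left; apply ln_increasing; lra|right; rewrite H; reflexivity]. }
      unfold y. replace W with (l * (W / l)) by (field; lra). apply Rmult_le_compat_l; lra.
    - assert (Hle : - (/ W / l) <= ln p).
      { rewrite <- (ln_exp (- (/ W / l))). destruct H as [H|H]; [left; apply ln_increasing; [apply exp_pos|lra]|right; rewrite H; reflexivity]. }
      unfold y. replace (/ W) with (l * (/ W / l)) by (field; lra). apply Rmult_le_compat_l; lra. }
  assert (HWi : 0 < / W <= 1).
  { split; [apply Rinv_0_lt_compat; lra|]. rewrite <- Rinv_1. apply Rinv_le_contravar; lra. }
  assert (Hsum : 3 <= y + / y).
  { assert (HyW : 0 <= (y - W) * (y - / W)) by (destruct Hor'; nra).
    assert (HWW : W * / W = 1) by (apply Rinv_r; lra).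
    apply Rmult_le_reg_r with y; [exact Hy|].
    rewrite Rmult_plus_distr_r, Rinv_l by lra.
    assert (HWy : y * W + y * / W = 3 * y).
    { rewrite <- Rmult_plus_distr_l, HWs. field. }
    replace ((y - W) * (y - / W)) with (y * y - (y * W + y * / W) + W * / W) in HyW by ring.
    lra. }
  assert (Hyi : 0 < / y) by (apply Rinv_0_lt_compat, Hy).
  assert (Hil : 0 < / l <= / 12) by (split; [apply Rinv_0_lt_compat|apply Rinv_le_contravar]; lra).
  assert (E : INR k * - ln p + / - ln p = l * (y + / y) - y * / l).
  { unfold y. replace (INR k) with (l * l - 1) by lra. field. lra. }
  rewrite E.
  assert (y * / l <= (y + / y) * / l) by nra.
  assert ((y + / y) * (l - / l) >= 3 * (l - / l)) by nra.
  lra.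
Qed.

Lemma moment_main_tail (e : nat -> R) (k : nat) (l : R) :
  geometric 2 e -> (forall h, Rabs h < / 2 -> PSeries e h = exp (mu h)) ->
  l * l = INR (S k) -> 12 <= l ->
  Rabs (moment k - 2 * exp (1 / 2) * exp (- (2 * l)) * / l * laplace e l) <= 2 * exp (4 - 3 * l).
Proof.
  intros Hge He Hll Hl.
  set (p1 := exp (- (w (/ 2) / l))). set (p2 := exp (- (w (- / 2) / l))).
  pose proof w_half_ge1 as HW.
  assert (H12 : 0 < p1 <= p2 /\ p2 < 1).
  { unfold p1, p2. rewrite w_opp. 
    assert (HWi : 0 < / w (/ 2) <= 1).
    { split; [apply Rinv_0_lt_compat; lra|]. rewrite <- Rinv_1. apply Rinv_le_contravar; lra. }
    assert (Hil : 0 < / l) by (apply Rinv_0_lt_compat; lra).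
    repeat split; [apply exp_pos|apply exp_le; unfold Rdiv; nra|].
    rewrite <- exp_0. apply exp_increasing. unfold Rdiv; nra. }
  assert (Hex : forall a b, ex_RInt (fun p => p ^ k * phi p) a b).
  { intros a b. apply ex_RInt_cont. intros; apply pow_phi_continuous. }
  assert (Hsplit : moment k = RInt (fun p => p ^ k * phi p) 0 p1
     + RInt (fun p => p ^ k * phi p) p1 p2 + RInt (fun p => p ^ k * phi p) p2 1).
  { unfold moment.
    rewrite <- (RInt_Chasles (V := R_CompleteNormedModule) _ 0 p2 1 (Hex _ _) (Hex _ _)).
    rewrite <- (RInt_Chasles (V := R_CompleteNormedModule) _ 0 p1 p2 (Hex _ _) (Hex _ _)).
    reflexivity. }
  rewrite Hsplit. unfold p1 at 2, p2 at 1. rewrite (moment_main_part e k l Hge He Hll Hl).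
  replace (_ - _) with (RInt (fun p => p ^ k * phi p) 0 p1 + RInt (fun p => p ^ k * phi p) p2 1) by ring.
  assert (Hpos : 0 < exp (4 - 3 * l)) by apply exp_pos.
  assert (B : forall a b, 0 <= a <= b -> b <= 1 ->
    (forall p, a < p < b -> p <= p1 \/ p2 <= p) ->
    0 <= RInt (fun p => p ^ k * phi p) a b <= exp (4 - 3 * l)).
  { intros a b Hab Hb Hor. split.
    - apply RInt_ge_0; [lra|apply Hex|]. intros p Hp.
      apply (moment_tail_bound k l p Hll Hl); [lra|apply Hor, Hp].
    - apply Rle_trans with (RInt (fun _ => exp (4 - 3 * l)) a b).
      + apply RInt_le; [lra|apply Hex|apply ex_RInt_cont; intros; apply continuous_const|].
        intros p Hp. apply (moment_tail_bound k l p Hll Hl); [lra|apply Hor, Hp].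
      + rewrite RInt_const. unfold scal; simpl; unfold mult; simpl. nra. }
  destruct (B 0 p1) as [B1 B2]; [lra|lra|intros; left; lra|].
  destruct (B p2 1) as [B3 B4]; [lra|lra|intros; right; lra|].
  rewrite Rabs_right; lra.
Qed.

(** The factor x^{3/2} e^{2s/x} with x = 1/sqrt n; s = -1 is the recessive and
    s = 1 the dominant exponential behaviour. *)
Definition envelope (s x : R) : R := x * sqrt x * exp (s * (2 / x)).

Lemma exp_mu_maclaurin :
  exists e : nat -> R, e 0%nat = 1 /\ geometric 2 e /\
    (forall h, Rabs h < / 2 -> PSeries e h = exp (mu h)) /\
    forall n, maclaurin (K := R_AbsRing) (fun h : R => exp (mu h)) n = e n.
Proof.
  destruct exp_mu_series as [e [He0 [Heb He]]].
  assert (Hge : geometric 2 e) by (exists 1; intros n; rewrite Rmult_1_l; apply Heb).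
  exists e. repeat split; try assumption.
  apply (maclaurin_R_eq _ _ (/ 2)); [lra|]. intros h Hh.
  rewrite <- He by exact Hh. apply (geometric_pseries 2); [lra|exact Hge|].
  apply Rmult_lt_reg_r with (/ 2); lra.
Qed.

Lemma c_0 : c 0 = 1.
Proof.
  destruct exp_mu_maclaurin as (e & He0 & _ & _ & Hmac).
  rewrite (c_eq_laplace_coeff e Hmac). unfold laplace_coeff. simpl. rewrite He0, cosh_coeff_0. ring.
Qed.

(** The index k stands for n = k + 1, so that [moment k] is -b_n. *)
Lemma moment_asymptotic :
  exists K, 0 < K /\ forall N, exists C k0, forall k, (k0 <= k)%nat ->
    let x := / sqrt (INR (S k)) in
    Rabs (moment k / (K * envelope (-1) x) - psum (fun m => c m * (- x) ^ m) N) <= C * x ^ N.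
Proof.
  destruct exp_mu_maclaurin as (e & He0 & Hge & He & Hmac).
  destruct gauss_0_limit as (K & c0 & HK & Hc0 & Hlow & HKO).
  exists (2 * exp (1 / 2) * K).
  pose proof (exp_pos (1 / 2)) as He12.
  split; [apply Rmult_lt_0_compat; lra|]. intros N.
  (* The main part: multiplying by sqrt l turns the truncated Gaussian integral
     into its limit, up to exponentially small terms. *)
  assert (HA : bigO N (fun l => sqrt l * laplace e l / K - psum (fun i => laplace_coeff e i * (/ l) ^ i) N)).
  { apply (bigO_ext _ (fun l =>
       (laplace e l / gauss_moment 0 l - psum (fun i => laplace_coeff e i * (/ l) ^ i) N) +
       (/ K * (sqrt l * gauss_moment 0 l - K)) *
       ((laplace e l / gauss_moment 0 l - psum (fun i => laplace_coeff e i * (/ l) ^ i) N)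
         + psum (fun i => laplace_coeff e i * (/ l) ^ i) N)) _ 0).
    - intros l Hl _. pose proof (gauss_0_nonzero l Hl). field. lra.
    - apply bigO_plus; [apply laplace_asymptotic, Hge|].
      apply (bigO_weaken (N + 0)); [lia|]. apply bigO_mult; [apply bigO_scal, HKO|].
      apply bigO_plus.
      + apply (bigO_weaken N); [lia|apply laplace_asymptotic, Hge].
      + apply bigO_psum. intros i _. apply bigO_scal, (bigO_weaken i); [lia|apply bigO_pow]. }
  destruct HA as (C1 & L1 & H1 & HC1 & HL1).
  destruct (bigO_exp (N + 2)) as (C2 & L2 & H2 & HC2 & HL2).
  set (L := Rmax 12 (Rmax L1 L2)).
  exists (C1 + exp 4 / (exp (1 / 2) * K) * C2).
  destruct (INR_unbounded (L * L)) as [k0 Hk0].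
  exists k0. intros k Hk. cbv zeta.
  set (l := sqrt (INR (S k))).
  assert (HlL : L <= l).
  { unfold l. rewrite <- (sqrt_square L).
    - apply sqrt_le_1; [apply Rle_0_sqr|apply pos_INR|].
      apply Rlt_le, Rlt_le_trans with (INR k0); [exact Hk0|apply le_INR; lia].
    - unfold L. pose proof (Rmax_l 12 (Rmax L1 L2)). lra. }
  assert (Hl12 : 12 <= l) by (eapply Rle_trans; [apply Rmax_l|exact HlL]).
  assert (HlL1 : L1 <= l).
  { eapply Rle_trans; [|exact HlL]. eapply Rle_trans; [|apply Rmax_r]. apply Rmax_l. }
  assert (HlL2 : L2 <= l).
  { eapply Rle_trans; [|exact HlL]. eapply Rle_trans; [|apply Rmax_r]. apply Rmax_r. }
  pose proof (moment_main_tail e k l Hge He (sqrt_sqrt _ (pos_INR _)) Hl12) as HM.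
  specialize (HL1 l HlL1). specialize (HL2 l HlL2).
  rewrite (psum_ext _ (fun i => laplace_coeff e i * (/ l) ^ i)).
  2:{ intros m _. rewrite (c_eq_laplace_coeff e Hmac).
      replace (- / l) with (-1 * / l) by ring. rewrite Rpow_mult_distr.
      replace ((-1) ^ m * laplace_coeff e m * ((-1) ^ m * (/ l) ^ m)) with ((-1 * -1) ^ m * (laplace_coeff e m * (/ l) ^ m))
        by (rewrite Rpow_mult_distr; ring).
      replace (-1 * -1) with 1 by ring. rewrite pow1. ring. }
  pose proof (sqrt_lt_R0 l ltac:(lra)) as Hs.
  assert (Hs2 : sqrt l * sqrt l = l) by (apply sqrt_sqrt; lra).
  unfold envelope. rewrite sqrt_inv.
  replace (-1 * (2 / / l)) with (- (2 * l)) by (field; lra).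
  set (D := moment k - 2 * exp (1 / 2) * exp (- (2 * l)) * / l * laplace e l) in *.
  replace (moment k / (2 * exp (1 / 2) * K * (/ l * / sqrt l * exp (- (2 * l)))))
    with (sqrt l * laplace e l / K + D * (l * sqrt l * exp (2 * l) * / (2 * exp (1 / 2) * K))).
  2:{ unfold D. rewrite exp_Ropp. pose proof (exp_pos (2 * l)). field. repeat split; lra. }
  replace (_ - _) with ((sqrt l * laplace e l / K - psum (fun i => laplace_coeff e i * (/ l) ^ i) N)
     + D * (l * sqrt l * exp (2 * l) * / (2 * exp (1 / 2) * K))) by ring.
  eapply Rle_trans; [apply Rabs_triang|]. rewrite Rmult_plus_distr_r.
  apply Rplus_le_compat; [exact HL1|].
  assert (Hi : 0 < / (2 * exp (1 / 2) * K)).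
  { apply Rinv_0_lt_compat, Rmult_lt_0_compat; lra. }
  pose proof (exp_pos (2 * l)) as He2l. pose proof (exp_pos 4) as He4.
  assert (Hsl : sqrt l <= l).
  { rewrite <- Hs2 at 2. rewrite <- (Rmult_1_l (sqrt l)) at 1.
    apply Rmult_le_compat_r; [lra|]. rewrite <- sqrt_1. apply sqrt_le_1; lra. }
  rewrite Rabs_mult, (Rabs_right (l * sqrt l * exp (2 * l) * / (2 * exp (1 / 2) * K))).
  2:{ apply Rle_ge. repeat apply Rmult_le_pos; lra. }
  apply Rle_trans with (2 * exp (4 - 3 * l) * (l * l * exp (2 * l) * / (2 * exp (1 / 2) * K))).
  - apply Rmult_le_compat; [apply Rabs_pos|repeat apply Rmult_le_pos; lra|exact HM|].
    repeat apply Rmult_le_compat_r; try lra. apply Rmult_le_compat_l; lra.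
  - rewrite Rabs_right in HL2 by (apply Rle_ge, Rlt_le, exp_pos).
    replace (2 * exp (4 - 3 * l) * (l * l * exp (2 * l) * / (2 * exp (1 / 2) * K)))
      with (exp 4 / (exp (1 / 2) * K) * (exp (- l) * (l * l))).
    2:{ replace (exp (4 - 3 * l)) with (exp 4 * exp (- l) * exp (- (2 * l)))
          by (rewrite <- !exp_plus; f_equal; ring).
        rewrite (exp_Ropp (2 * l)). field. repeat split; lra. }
    rewrite (Rmult_assoc (exp 4 / _)). apply Rmult_le_compat_l.
    { apply Rmult_le_pos; [lra|]. apply Rlt_le, Rinv_0_lt_compat, Rmult_lt_0_compat; lra. }
    apply Rle_trans with (C2 * (/ l) ^ (N + 2) * (l * l)).
    + apply Rmult_le_compat_r; [nra|exact HL2].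
    + right. rewrite pow_add. simpl. field. lra.
Qed.

(** * Two-sided Taylor expansions at 0 *)

Definition near0 (P : R -> Prop) : Prop := exists d, 0 < d /\ forall x, Rabs x < d -> P x.

Lemma near0_and P Q : near0 P -> near0 Q -> near0 (fun x => P x /\ Q x).
Proof.
  intros [d [Hd H]] [d' [Hd' H']]. exists (Rmin d d').
  split; [apply Rmin_glb_lt; assumption|].
  intros x Hx. split; [apply H|apply H'];
    (eapply Rlt_le_trans; [exact Hx|]); [apply Rmin_l|apply Rmin_r].
Qed.

Lemma near0_imp P Q : (forall x, P x -> Q x) -> near0 P -> near0 Q.
Proof. intros H [d [Hd H']]. exists d. split; [exact Hd|auto]. Qed.

Lemma near0_all (P : R -> Prop) : (forall x, P x) -> near0 P.
Proof. intros H. exists 1. split; [lra|auto]. Qed.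

Lemma near0_at0 P : near0 P -> P 0.
Proof. intros [d [Hd H]]. apply H. rewrite Rabs_R0. exact Hd. Qed.

(** [jet N f] means that f has a two-sided expansion a_0 + a_1 x + ... +
    O(x^N) at 0. The recursive form, dividing by x at each level, makes all
    closure properties short inductions and never exhibits the coefficients. *)
Fixpoint jet (N : nat) (f : R -> R) : Prop :=
  match N with
  | O => exists C, near0 (fun x => Rabs (f x) <= C)
  | S N' => exists a g, jet N' g /\ near0 (fun x => f x = a + x * g x)
  end.

Lemma jet_0_of f a g :
  jet 0 g -> near0 (fun x => f x = a + x * g x) -> jet 0 f.
Proof.
  intros [C HC] Hf. exists (Rabs a + C).
  pose proof (near0_and _ _ HC Hf) as H.
  pose proof (near0_and _ _ H (ex_intro _ 1 (conj Rlt_0_1 (fun x Hx => Hx)))) as H'.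
  revert H'. apply near0_imp. intros x [[H1 H2] H3]. rewrite H2.
  eapply Rle_trans; [apply Rabs_triang|]. apply Rplus_le_compat_l.
  rewrite Rabs_mult. pose proof (Rabs_pos (g x)). pose proof (Rabs_pos x). nra.
Qed.

Lemma jet_down N f : jet (S N) f -> jet N f.
Proof.
  revert f; induction N as [|N IH]; intros f (a & g & Hg & Hf).
  - exact (jet_0_of f a g Hg Hf).
  - exists a, g. split; [apply IH, Hg|exact Hf].
Qed.

Lemma jet_bounded N f : jet N f -> jet 0 f.
Proof. induction N as [|N IH]; [auto|]. intros H. apply IH, jet_down, H. Qed.

Lemma jet_ext N f g : near0 (fun x => f x = g x) -> jet N f -> jet N g.
Proof.
  destruct N as [|N]; intros H.
  - intros [C HC]. exists C. generalize (near0_and _ _ H HC). apply near0_imp.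
    intros x [E Hx]. rewrite <- E. exact Hx.
  - intros (a & h & Hh & Hf). exists a, h. split; [exact Hh|].
    generalize (near0_and _ _ H Hf). apply near0_imp. intros x [E Hx]. rewrite <- E. exact Hx.
Qed.

Lemma jet_const N a : jet N (fun _ => a).
Proof.
  revert a; induction N as [|N IH]; intros a.
  - exists (Rabs a). apply near0_all. intros; lra.
  - exists a, (fun _ => 0). split; [apply IH|]. apply near0_all. intros; ring.
Qed.

Lemma jet_id N : jet N (fun x => x).
Proof.
  destruct N as [|N].
  - exists 1. exists 1. split; [lra|]. intros; lra.
  - exists 0, (fun _ => 1). split; [apply jet_const|]. apply near0_all. intros; ring.
Qed.

Lemma jet_plus N f g : jet N f -> jet N g -> jet N (fun x => f x + g x).
Proof.
  revert f g; induction N as [|N IH]; intros f g.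
  - intros [C HC] [C' HC']. exists (C + C'). generalize (near0_and _ _ HC HC').
    apply near0_imp. intros x [H H']. eapply Rle_trans; [apply Rabs_triang|lra].
  - intros (a & h & Hh & Hf) (a' & h' & Hh' & Hf').
    exists (a + a'), (fun x => h x + h' x). split; [apply IH; assumption|].
    generalize (near0_and _ _ Hf Hf'). apply near0_imp. intros x [-> ->]. ring.
Qed.

Lemma jet_mult N f g : jet N f -> jet N g -> jet N (fun x => f x * g x).
Proof.
  revert f g; induction N as [|N IH]; intros f g.
  - intros [C HC] [C' HC']. exists (C * C'). generalize (near0_and _ _ HC HC').
    apply near0_imp. intros x [H H']. rewrite Rabs_mult.
    apply Rmult_le_compat; auto using Rabs_pos.
  - intros (a & h & Hh & Hf) (a' & h' & Hh' & Hf').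
    exists (a * a'), (fun x => a * h' x + (a' * h x + x * (h x * h' x))). split.
    + repeat apply jet_plus; repeat apply IH; auto using jet_const, jet_id.
    + generalize (near0_and _ _ Hf Hf'). apply near0_imp. intros x [-> ->]. ring.
Qed.

Lemma jet_scal N a f : jet N f -> jet N (fun x => a * f x).
Proof. apply jet_mult, jet_const. Qed.

Lemma jet_opp N f : jet N f -> jet N (fun x => - f x).
Proof.
  intros H. apply (jet_ext _ (fun x => -1 * f x)); [apply near0_all; intros; ring|].
  apply jet_scal, H.
Qed.

Lemma jet_minus N f g : jet N f -> jet N g -> jet N (fun x => f x - g x).
Proof. intros Hf Hg. apply jet_plus; [exact Hf|apply jet_opp, Hg]. Qed.

Lemma jet_pow N f n : jet N f -> jet N (fun x => f x ^ n).
Proof.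
  intros Hf. induction n as [|n IH]; simpl; [apply jet_const|apply jet_mult; assumption].
Qed.

Lemma jet_psum N (F : nat -> R -> R) n :
  (forall k, jet N (F k)) -> jet N (fun x => psum (fun k => F k x) n).
Proof.
  intros H. induction n as [|n IH]; simpl; [apply jet_const|apply jet_plus; auto].
Qed.

(** 1/(a + x g) = 1/a - x g / (a (a + x g)), and the right-hand side needs the
    inverse to one order less. *)
Lemma jet_inv N f m : 0 < m -> near0 (fun x => m <= Rabs (f x)) -> jet N f -> jet N (fun x => / f x).
Proof.
  intros Hm Hf. induction N as [|N IH]; intros Hj.
  - exists (/ m). revert Hf. apply near0_imp. intros x Hx.
    rewrite Rabs_inv. apply Rinv_le_contravar; assumption.
  - pose proof (jet_down _ _ Hj) as Hd. specialize (IH Hd).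
    destruct Hj as (a & g & Hg & Hfg).
    assert (Ha : a <> 0).
    { intros Z. pose proof (near0_at0 _ Hf) as H0. pose proof (near0_at0 _ Hfg) as H1.
      simpl in H0, H1. rewrite H1, Z, Rmult_0_l, Rplus_0_l, Rabs_R0 in H0. lra. }
    exists (/ a), (fun x => - / a * (g x * / f x)). split.
    + apply jet_scal, jet_mult; assumption.
    + generalize (near0_and _ _ Hf Hfg). apply near0_imp. intros x [H1 H2].
      assert (Hne : f x <> 0) by (intros Z; rewrite Z, Rabs_R0 in H1; lra).
      transitivity (/ a - / a * (x * g x) * / f x); [|ring].
      replace (x * g x) with (f x - a) by lra. field. split; assumption.
Qed.

(** As for the inverse: with f = a + x g, sqrt f = sqrt a + x g / (sqrt a +
    sqrt f). *)
Lemma jet_sqrt N f m : 0 < m -> near0 (fun x => m <= f x) -> jet N f -> jet N (fun x => sqrt (f x)).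
Proof.
  intros Hm Hf. induction N as [|N IH]; intros Hj.
  - destruct Hj as [C HC]. exists (sqrt C). generalize (near0_and _ _ Hf HC).
    apply near0_imp. intros x [H1 H2].
    rewrite Rabs_right by (apply Rle_ge, sqrt_pos). apply sqrt_le_1_alt.
    eapply Rle_trans; [apply Rle_abs|exact H2].
  - pose proof (jet_down _ _ Hj) as Hd. specialize (IH Hd).
    destruct Hj as (a & g & Hg & Hfg).
    assert (Ha : m <= a).
    { pose proof (near0_at0 _ Hf) as H0. pose proof (near0_at0 _ Hfg) as H1.
      simpl in H0, H1. rewrite H1, Rmult_0_l, Rplus_0_r in H0. exact H0. }
    pose proof (sqrt_lt_R0 a ltac:(lra)) as Hsa.
    exists (sqrt a), (fun x => g x * / (sqrt a + sqrt (f x))). split.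
    + apply jet_mult; [exact Hg|]. apply (jet_inv _ _ (sqrt a)); [exact Hsa| |].
      * apply near0_all. intros x. pose proof (sqrt_pos (f x)). rewrite Rabs_right; lra.
      * apply jet_plus; [apply jet_const|exact IH].
    + generalize (near0_and _ _ Hf Hfg). apply near0_imp. intros x [H1 H2].
      pose proof (sqrt_pos (f x)) as Hs.
      assert (E1 : sqrt a * sqrt a = a) by (apply sqrt_sqrt; lra).
      assert (E2 : sqrt (f x) * sqrt (f x) = f x) by (apply sqrt_sqrt; lra).
      apply Rmult_eq_reg_r with (sqrt a + sqrt (f x)); [|lra].
      transitivity (sqrt a * sqrt a + sqrt a * sqrt (f x) + x * g x).
      * rewrite E1. transitivity (sqrt (f x) * sqrt (f x) + sqrt a * sqrt (f x)); [ring|].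
        rewrite E2. lra.
      * field. lra.
Qed.

Lemma jet_comp N F g : jet N F -> jet N g -> jet N (fun x => F (x * g x)).
Proof.
  intros HF Hg.
  assert (Hsmall : forall d, 0 < d -> near0 (fun x => Rabs (x * g x) < d)).
  { intros d Hd. destruct (jet_bounded _ _ Hg) as [C [d0 [Hd0 HC]]].
    assert (HC1 : 0 < Rabs C + 1) by (pose proof (Rabs_pos C); lra).
    exists (Rmin d0 (d / (Rabs C + 1))). split.
    - apply Rmin_glb_lt; [exact Hd0|apply Rdiv_lt_0_compat; assumption].
    - intros x Hx.
      assert (H1 : Rabs x < d0) by (eapply Rlt_le_trans; [exact Hx|apply Rmin_l]).
      assert (H2 : Rabs x < d / (Rabs C + 1)) by (eapply Rlt_le_trans; [exact Hx|apply Rmin_r]).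
      specialize (HC x H1). rewrite Rabs_mult. pose proof (Rle_abs C).
      apply Rle_lt_trans with (Rabs x * (Rabs C + 1)).
      + apply Rmult_le_compat_l; [apply Rabs_pos|lra].
      + replace d with (d / (Rabs C + 1) * (Rabs C + 1)) by (field; lra).
        apply Rmult_lt_compat_r; assumption. }
  revert F HF Hg. induction N as [|N IH]; intros F HF Hg.
  - destruct HF as [C [d [Hd HC]]]. exists C.
    generalize (Hsmall d Hd). apply near0_imp. intros x Hx. apply HC, Hx.
  - destruct HF as (a & F1 & HF1 & [d [Hd HFd]]).
    pose proof (jet_down _ _ Hg) as Hg'.
    exists a, (fun x => g x * F1 (x * g x)). split.
    + apply jet_mult; [exact Hg'|apply IH; assumption].
    + generalize (Hsmall d Hd). apply near0_imp. intros x Hx. rewrite (HFd _ Hx). ring.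
Qed.

Lemma jet_PSeries N a : geometric 1 a -> jet N (PSeries a).
Proof.
  revert a; induction N as [|N IH]; intros a [M HM].
  - exists (2 * M), (/ 2). split; [lra|]. intros x Hx.
    apply (PSeries_bound 1); [lra| |exact HM|lra].
    specialize (HM 0%nat). simpl in HM. pose proof (Rabs_pos (a 0%nat)). lra.
  - exists (a 0%nat), (PSeries (PS_decr_1 a)). split.
    + apply IH. exists M. intros n. unfold PS_decr_1. rewrite pow1. specialize (HM (S n)).
      rewrite pow1 in HM. exact HM.
    + exists 1. split; [lra|]. intros x Hx. apply PSeries_decr_1.
      exists (PSeries a x). apply (geometric_pseries 1); [lra|exists M; exact HM|lra].
Qed.

Lemma inv_fact_geometric : geometric 1 (fun n => / INR (fact n)).
Proof.
  exists 1. intros n. rewrite pow1, Rmult_1_l.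
  rewrite Rabs_right by (apply Rle_ge, Rlt_le, Rinv_0_lt_compat, INR_fact_lt_0).
  rewrite <- Rinv_1. apply Rinv_le_contravar; [lra|]. apply (le_INR 1), lt_O_fact.
Qed.

Lemma jet_exp N f : jet N f -> jet N (fun x => exp (f x)).
Proof.
  destruct N as [|N].
  - intros [C HC]. exists (exp C). revert HC. apply near0_imp. intros x Hx.
    rewrite Rabs_right by (apply Rle_ge, Rlt_le, exp_pos).
    apply exp_le. eapply Rle_trans; [apply Rle_abs|exact Hx].
  - intros (a & g & Hg & Hf).
    set (h := PSeries (PS_decr_1 (fun n => / INR (fact n)))).
    exists (exp a), (fun x => exp a * (g x * h (x * g x))). split.
    + apply jet_scal, jet_mult; [exact Hg|]. apply jet_comp; [|exact Hg].
      apply jet_PSeries. destruct inv_fact_geometric as [M HM].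
      exists M. intros n. unfold PS_decr_1. specialize (HM (S n)). rewrite pow1 in *. exact HM.
    + revert Hf. apply near0_imp. intros x ->. rewrite exp_plus.
      rewrite (exp_Reals (x * g x)), PSeries_decr_1 by (exists (exp (x * g x)); apply is_exp_Reals).
      fold h. simpl. field.
Qed.

(** If f = a + x g is small along positive points tending to 0, then a = 0 and
    g is small along the same points to one order less; so every coefficient
    vanishes, and f is small on both sides of 0. *)
Lemma jet_reflection N f (X : nat -> R) C k0 :
  jet N f -> (forall k, 0 < X k) -> is_lim_seq X 0 ->
  (forall k, (k0 <= k)%nat -> Rabs (f (X k)) <= C * X k ^ N) ->
  exists C', 0 <= C' /\ near0 (fun x => Rabs (f x) <= C' * Rabs x ^ N).
Proof.
  intros Hf HX Hlim. revert f C k0 Hf.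
  induction N as [|N IH]; intros f C k0 Hf Hk.
  - destruct Hf as [C' HC]. exists (Rabs C'). split; [apply Rabs_pos|]. revert HC. apply near0_imp.
    intros x Hx. simpl. pose proof (Rle_abs C'). lra.
  - destruct Hf as (a & g & Hg & Hfg).
    destruct (jet_bounded _ _ Hg) as [B HB].
    destruct (near0_and _ _ Hfg HB) as [d [Hd Hnear]].
    assert (HlimX : forall eps, 0 < eps -> exists k1, forall k, (k1 <= k)%nat -> X k < eps).
    { intros eps He. apply is_lim_seq_spec in Hlim. destruct (Hlim (mkposreal eps He)) as [k1 H1].
      exists k1. intros k Hk1. specialize (H1 k Hk1). simpl in H1.
      rewrite Rminus_0_r in H1. apply Rabs_def2 in H1. lra. }
    assert (Ha : a = 0).
    { destruct (Req_dec a 0) as [E|E]; [exact E|exfalso].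
      assert (Hap : 0 < Rabs a) by (apply Rabs_pos_lt, E).
      set (T := Rabs C + Rabs B + 1).
      assert (HT : 1 <= T) by (unfold T; pose proof (Rabs_pos C); pose proof (Rabs_pos B); lra).
      destruct (HlimX (Rmin d (Rmin 1 (Rabs a / T)))) as [k1 H1].
      { repeat apply Rmin_glb_lt; try lra. apply Rdiv_lt_0_compat; lra. }
      set (k := (k0 + k1)%nat). specialize (H1 k ltac:(lia)). specialize (Hk k ltac:(lia)).
      specialize (HX k).
      assert (Hxd : X k < d) by (eapply Rlt_le_trans; [exact H1|apply Rmin_l]).
      assert (Hx1 : X k < 1) by (eapply Rlt_le_trans; [exact H1|eapply Rle_trans; [apply Rmin_r|apply Rmin_l]]).
      assert (HxT : X k < Rabs a / T) by (eapply Rlt_le_trans; [exact H1|eapply Rle_trans; [apply Rmin_r|apply Rmin_r]]).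
      destruct (Hnear (X k)) as [E1 E2]; [rewrite Rabs_right; lra|].
      assert (Hcontra : Rabs a <= X k * T).
      { replace a with (f (X k) + - (X k * g (X k))) by (rewrite E1; ring).
        eapply Rle_trans; [apply Rabs_triang|]. rewrite Rabs_Ropp, Rabs_mult, (Rabs_right (X k)) by lra.
        assert (Hp : X k ^ S N <= X k).
        { simpl. rewrite <- (Rmult_1_r (X k)) at 3. apply Rmult_le_compat_l; [lra|].
          rewrite <- (pow1 N). apply pow_incr; lra. }
        assert (Hp0 : 0 <= X k ^ S N) by (apply pow_le; lra).
        pose proof (Rle_abs C). pose proof (Rabs_pos C). pose proof (Rle_abs B).
        assert (C * X k ^ S N <= Rabs C * X k) by nra.
        assert (X k * Rabs (g (X k)) <= X k * Rabs B) by (apply Rmult_le_compat_l; lra).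
        unfold T. lra. }
      assert (X k * T < Rabs a).
      { replace (Rabs a) with (Rabs a / T * T) by (field; lra). apply Rmult_lt_compat_r; lra. }
      lra. }
    subst a.
    destruct (HlimX d Hd) as [k1 H1].
    destruct (IH g C (k0 + k1)%nat Hg) as [C' [HC' Hn]].
    + intros k Hkk. specialize (HX k). specialize (H1 k ltac:(lia)). specialize (Hk k ltac:(lia)).
      destruct (Hnear (X k)) as [E1 _]; [rewrite Rabs_right; lra|].
      rewrite E1, Rplus_0_l, Rabs_mult, (Rabs_right (X k)) in Hk by lra. simpl in Hk.
      apply Rmult_le_reg_l with (X k); [exact HX|]. lra.
    + exists C'. split; [exact HC'|]. generalize (near0_and _ _ Hn Hfg). apply near0_imp.
      intros x [Hx1 ->]. rewrite Rplus_0_l, Rabs_mult. simpl. pose proof (Rabs_pos x). nra.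
Qed.

(** * The residual of the recurrence *)

(** For t = 1 and t = -1, x / stretch t x is the point 1/sqrt(n+t) when x =
    1/sqrt n. *)
Definition stretch (t x : R) : R := sqrt (1 + t * x ^ 2).

(** The ratio (1 + t x^2) x_t^{3/2} e^{2/x_t} / (x^{3/2} e^{2/x}) with x_t =
    1/sqrt(n+t); the exponent is the difference 2 sqrt(n+t) - 2 sqrt n, which
    is analytic in x. *)
Definition step (t x : R) : R := sqrt (stretch t x) * exp (t * (2 * x / (1 + stretch t x))).

Definition cpoly (N : nat) (y : R) : R := psum (fun m => c m * y ^ m) N.

(** The recurrence applied to the envelope times [cpoly], divided by n times
    the envelope. Changing x into -x exchanges the recessive and the dominant
    ansatz. *)
Definition residual (N : nat) (x : R) : R :=
  step 1 x * cpoly N (x / stretch 1 x) - (2 + x ^ 2) * cpoly N x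
  + step (-1) x * cpoly N (x / stretch (-1) x).

Lemma sign_mult_sqr (s x : R) : s = 1 \/ s = -1 -> (s * x) ^ 2 = x ^ 2.
Proof. intros [-> | ->]; ring. Qed.

Lemma stretch_sign t s x : s = 1 \/ s = -1 -> stretch t (s * x) = stretch t x.
Proof. intros Hs. unfold stretch. rewrite (sign_mult_sqr s x Hs). reflexivity. Qed.

(** A sign s in the exponent amounts to replacing x by s x, because [stretch]
    is even. *)
Lemma envelope_step t s x :
  s = 1 \/ s = -1 -> 0 < x -> 0 < 1 + t * x ^ 2 ->
  (1 + t * x ^ 2) * envelope s (x / stretch t x) = envelope s x * step t (s * x).
Proof.
  intros Hs Hx Ht. unfold envelope, step. rewrite (stretch_sign t s x Hs).
  assert (Hr : stretch t x * stretch t x = 1 + t * x ^ 2) by (apply sqrt_sqrt; lra).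
  assert (Hr0 : 0 < stretch t x) by (apply sqrt_lt_R0; exact Ht).
  set (r := stretch t x) in *.
  assert (Hsr : sqrt r * sqrt r = r) by (apply sqrt_sqrt; lra).
  pose proof (sqrt_lt_R0 r Hr0) as Hsr0.
  rewrite sqrt_div by lra.
  replace (s * (2 / (x / r))) with (s * (2 / x) + t * (2 * (s * x) / (1 + r))).
  - rewrite exp_plus, <- Hr.
    transitivity (r * x * sqrt x * (r / sqrt r) * (exp (s * (2 / x)) * exp (t * (2 * (s * x) / (1 + r)))) / r);
      [field; split; lra|].
    replace (r / sqrt r) with (sqrt r).
    + field. lra.
    + rewrite <- Hsr at 2. field. lra.
  - transitivity (s * (2 / x) + 2 * s * (t * x ^ 2) / (x * (1 + r))); [field; split; lra|].
    replace (t * x ^ 2) with ((r - 1) * (r + 1)) by lra. field. repeat split; lra.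
Qed.

Lemma jet_sqr N : jet N (fun x => x ^ 2).
Proof. apply jet_pow, jet_id. Qed.

Lemma near0_sqr t : t = 1 \/ t = -1 -> near0 (fun x => / 4 <= 1 + t * x ^ 2).
Proof.
  intros Ht. exists (/ 2). split; [lra|]. intros x Hx. apply Rabs_def2 in Hx.
  assert (0 <= x ^ 2 <= / 4) by (simpl; nra). destruct Ht; subst t; lra.
Qed.

Lemma near0_stretch t : t = 1 \/ t = -1 -> near0 (fun x => / 2 <= stretch t x).
Proof.
  intros Ht. generalize (near0_sqr t Ht). apply near0_imp. intros x Hx.
  unfold stretch. rewrite <- (sqrt_square (/ 2)) by lra. apply sqrt_le_1_alt. lra.
Qed.

Lemma jet_stretch t N : t = 1 \/ t = -1 -> jet N (stretch t).
Proof.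
  intros Ht. apply (jet_sqrt _ _ (/ 4)); [lra|apply near0_sqr, Ht|].
  apply jet_plus; [apply jet_const|apply jet_scal, jet_sqr].
Qed.

Lemma jet_step t N : t = 1 \/ t = -1 -> jet N (step t).
Proof.
  intros Ht. unfold step. apply jet_mult.
  - apply (jet_sqrt _ _ (/ 2)); [lra|apply near0_stretch, Ht|apply jet_stretch, Ht].
  - apply jet_exp, jet_scal, jet_mult; [apply jet_scal, jet_id|].
    apply (jet_inv _ _ 1); [lra| |apply jet_plus; [apply jet_const|apply jet_stretch, Ht]].
    generalize (near0_stretch t Ht). apply near0_imp. intros x Hx. rewrite Rabs_right; lra.
Qed.

Lemma jet_cpoly N n f : jet N f -> jet N (fun x => cpoly n (f x)).
Proof. intros Hf. apply jet_psum. intros k. apply jet_scal, jet_pow, Hf. Qed.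

Lemma jet_residual N n : jet N (residual n).
Proof.
  assert (Hshift : forall t, t = 1 \/ t = -1 -> jet N (fun x => step t x * cpoly n (x / stretch t x))).
  { intros t Ht. apply jet_mult; [apply jet_step, Ht|].
    apply jet_cpoly, jet_mult; [apply jet_id|].
    apply (jet_inv _ _ (/ 2)); [lra| |apply jet_stretch, Ht].
    generalize (near0_stretch t Ht). apply near0_imp. intros x Hx. rewrite Rabs_right; lra. }
  unfold residual. apply jet_plus; [apply jet_minus|].
  - apply Hshift. left; reflexivity.
  - apply jet_mult; [apply jet_plus; [apply jet_const|apply jet_sqr]|apply jet_cpoly, jet_id].
  - apply Hshift. right; reflexivity.
Qed.

(** * The sample points 1/sqrt n *)

Definition node (k : nat) : R := / sqrt (INR (S k)).

Lemma INR_S_pos k : 0 < INR (S k).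
Proof. apply lt_0_INR; lia. Qed.

Lemma node_pos k : 0 < node k.
Proof. apply Rinv_0_lt_compat, sqrt_lt_R0, INR_S_pos. Qed.

Lemma node_sqr k : node k ^ 2 = / INR (S k).
Proof.
  unfold node. rewrite pow_inv. f_equal.
  apply pow2_sqrt, pos_INR.
Qed.

Lemma node_le1 k : node k <= 1.
Proof.
  unfold node. rewrite <- Rinv_1. apply Rinv_le_contravar; [lra|].
  rewrite <- sqrt_1. apply sqrt_le_1_alt. apply (le_INR 1). lia.
Qed.

Lemma node_lt1 k : node (S k) < 1.
Proof.
  pose proof (node_pos (S k)) as H0. pose proof (node_sqr (S k)) as H.
  assert (Hlt : / INR (S (S k)) < 1).
  { rewrite <- Rinv_1. apply Rinv_lt_contravar; [|apply (lt_INR 1); lia].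
    rewrite Rmult_1_l. apply INR_S_pos. }
  simpl in H. simpl in Hlt. nra.
Qed.

Lemma node_succ k : node (S k) = node k / stretch 1 (node k).
Proof.
  unfold stretch. rewrite Rmult_1_l, node_sqr. unfold node.
  pose proof (INR_S_pos k) as H. pose proof (INR_S_pos (S k)) as H'.
  replace (1 + / INR (S k)) with (INR (S (S k)) / INR (S k))
    by (rewrite (S_INR (S k)); field; lra).
  rewrite sqrt_div by lra.
  pose proof (sqrt_lt_R0 _ H). pose proof (sqrt_lt_R0 _ H').
  field. split; lra.
Qed.

Lemma node_pred k : node k = node (S k) / stretch (-1) (node (S k)).
Proof.
  unfold stretch. rewrite node_sqr. unfold node.
  pose proof (INR_S_pos k) as H. pose proof (INR_S_pos (S k)) as H'.
  replace (1 + -1 * / INR (S (S k))) with (INR (S k) / INR (S (S k)))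
    by (rewrite (S_INR (S k)) in *; field; lra).
  rewrite sqrt_div by lra.
  pose proof (sqrt_lt_R0 _ H). pose proof (sqrt_lt_R0 _ H').
  field. split; lra.
Qed.

Lemma node_decr k : node (S k) <= node k <= 2 * node (S k).
Proof.
  unfold node. pose proof (INR_S_pos k) as Hk.
  assert (H4 : sqrt (INR (S (S k))) <= 2 * sqrt (INR (S k))).
  { rewrite <- (sqrt_square 2) by lra. rewrite <- sqrt_mult_alt by lra.
    apply sqrt_le_1_alt. rewrite (S_INR (S k)), S_INR in *. pose proof (pos_INR k). lra. }
  pose proof (sqrt_lt_R0 _ Hk) as Hs.
  assert (H1 : sqrt (INR (S k)) <= sqrt (INR (S (S k)))) by (apply sqrt_le_1_alt, le_INR; lia).
  split; [apply Rinv_le_contravar; lra|].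
  apply Rmult_le_reg_r with (sqrt (INR (S k))); [exact Hs|]. rewrite Rinv_l by lra.
  apply Rmult_le_reg_r with (sqrt (INR (S (S k)))); [lra|].
  replace (2 * / sqrt (INR (S (S k))) * sqrt (INR (S k)) * sqrt (INR (S (S k))))
    with (2 * sqrt (INR (S k))) by (field; lra). lra.
Qed.

Lemma node_lim : is_lim_seq node 0.
Proof.
  apply is_lim_seq_spec. intros eps. pose proof (cond_pos eps) as He.
  destruct (INR_unbounded (/ eps * / eps)) as [k0 Hk0]. exists k0. intros k Hk.
  rewrite Rminus_0_r, Rabs_right by (apply Rle_ge, Rlt_le, node_pos).
  unfold node. rewrite <- (Rinv_inv eps).
  assert (Hie : 0 < / eps) by (apply Rinv_0_lt_compat, He).
  assert (Hlt : / eps < sqrt (INR (S k))).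
  { rewrite <- (sqrt_square (/ eps)) by lra. apply sqrt_lt_1_alt. split; [nra|].
    apply Rlt_le_trans with (INR k0); [exact Hk0|apply le_INR; lia]. }
  apply Rinv_lt_contravar; [|exact Hlt]. nra.
Qed.

Lemma node_eventually (P : R -> Prop) : near0 P -> exists k0, forall k, (k0 <= k)%nat -> P (node k) /\ P (- node k).
Proof.
  intros [d [Hd H]]. pose proof node_lim as Hlim. apply is_lim_seq_spec in Hlim.
  destruct (Hlim (mkposreal d Hd)) as [k0 Hk0]. exists k0. intros k Hk.
  specialize (Hk0 k Hk). simpl in Hk0. rewrite Rminus_0_r in Hk0.
  split; apply H; [exact Hk0|rewrite Rabs_Ropp; exact Hk0].
Qed.

Definition approx_solution (s : R) (N k : nat) : R := envelope s (node k) * cpoly N (s * node k).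

Lemma envelope_recurrence s k :
  s = 1 \/ s = -1 ->
  (INR k + 3) * envelope s (node (S (S k))) = (INR k + 2) * (envelope s (node (S k)) * step 1 (s * node (S k)))
  /\ (INR k + 1) * envelope s (node k) = (INR k + 2) * (envelope s (node (S k)) * step (-1) (s * node (S k))).
Proof.
  intros Hs. pose proof (node_pos (S k)) as Hx0. pose proof (node_lt1 k) as Hx1.
  pose proof (node_sqr (S k)) as Hx2. rewrite !S_INR in Hx2. pose proof (pos_INR k).
  assert (Hxs : 0 <= node (S k) ^ 2 < 1) by (simpl; nra).
  rewrite <- (envelope_step 1 s _ Hs Hx0), <- (envelope_step (-1) s _ Hs Hx0) by lra.
  rewrite <- node_succ, <- node_pred, Hx2. split; field; lra.
Qed.

Lemma approx_solution_recurrence s N k :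
  s = 1 \/ s = -1 ->
  (INR k + 3) * approx_solution s N (S (S k)) - (2 * INR k + 5) * approx_solution s N (S k) + (INR k + 1) * approx_solution s N k
  = (INR k + 2) * envelope s (node (S k)) * residual N (s * node (S k)).
Proof.
  intros Hs. destruct (envelope_recurrence s k Hs) as [E1 E2].
  pose proof (node_sqr (S k)) as Hx2. rewrite !S_INR in Hx2. pose proof (pos_INR k).
  unfold approx_solution, residual.
  rewrite !(stretch_sign _ s _ Hs), (sign_mult_sqr s _ Hs), Hx2.
  replace (s * node (S k) / stretch 1 (node (S k))) with (s * node (S (S k)))
    by (rewrite (node_succ (S k)); unfold Rdiv; ring).
  replace (s * node (S k) / stretch (-1) (node (S k))) with (s * node k)
    by (rewrite (node_pred k) at 1; unfold Rdiv; ring).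
  rewrite <- !Rmult_assoc, E1, E2. field. lra.
Qed.

(** The exact recurrence for the moments bounds the residual at -x by the
    error of their expansion; [jet_reflection] carries the bound over to x. *)
Lemma residual_small K N C k0 :
  0 < K ->
  (forall k, (k0 <= k)%nat ->
    Rabs (moment k / (K * envelope (-1) (node k)) - cpoly N (- node k)) <= C * node k ^ N) ->
  exists C' k1, 0 <= C' /\ forall k, (k1 <= k)%nat -> Rabs (residual N (node k)) <= C' * node k ^ N.
Proof.
  intros HK Hm.
  set (eps := fun k => moment k / (K * envelope (-1) (node k)) - cpoly N (- node k)).
  assert (Hs : -1 = 1 \/ -1 = -1) by (right; reflexivity).
  assert (Henv : forall k, 0 < envelope (-1) (node k)).
  { intros k. unfold envelope. pose proof (node_pos k).
    repeat apply Rmult_lt_0_compat; [assumption|apply sqrt_lt_R0; assumption|apply exp_pos]. }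
  assert (Hmom : forall k, moment k = K * (approx_solution (-1) N k + envelope (-1) (node k) * eps k)).
  { intros k. unfold approx_solution, eps. replace (-1 * node k) with (- node k) by ring.
    specialize (Henv k). field. split; lra. }
  assert (Hres : forall k, residual N (- node (S k)) =
     - (step 1 (- node (S k)) * eps (S (S k)) - (2 + node (S k) ^ 2) * eps (S k)
        + step (-1) (- node (S k)) * eps k)).
  { intros k. pose proof (moment_recurrence k) as Hrec. rewrite !Hmom in Hrec.
    pose proof (approx_solution_recurrence (-1) N k Hs) as Ha.
    destruct (envelope_recurrence (-1) k Hs) as [E1 E2].
    replace (-1 * node (S k)) with (- node (S k)) in * by ring.
    pose proof (pos_INR k). specialize (Henv (S k)).
    pose proof (node_sqr (S k)) as Hx2. rewrite !S_INR in Hx2.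
    apply Rmult_eq_reg_l with (K * ((INR k + 2) * envelope (-1) (node (S k)))).
    2:{ apply Rgt_not_eq, Rmult_lt_0_compat; [lra|]. apply Rmult_lt_0_compat; lra. }
    rewrite Rmult_assoc, <- Ha.
    match type of Hrec with ?L = 0 => apply Rminus_diag_uniq; transitivity L; [|exact Hrec] end.
    transitivity (K * ((INR k + 3) * approx_solution (-1) N (S (S k)) - (2 * INR k + 5) * approx_solution (-1) N (S k) + (INR k + 1) * approx_solution (-1) N k)
       + K * (((INR k + 2) * (envelope (-1) (node (S k)) * step 1 (- node (S k)))) * eps (S (S k))
       - (INR k + 2) * (2 + node (S k) ^ 2) * envelope (-1) (node (S k)) * eps (S k)
       + ((INR k + 2) * (envelope (-1) (node (S k)) * step (-1) (- node (S k)))) * eps k)); [ring|].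
    rewrite <- E1, <- E2, Hx2. field. lra. }
  destruct (jet_step 1 0 (or_introl eq_refl)) as [B1 HB1]. destruct (jet_step (-1) 0 (or_intror eq_refl)) as [B2 HB2].
  destruct (node_eventually _ (near0_and _ _ HB1 HB2)) as [k2 Hk2].
  set (C1 := (Rabs B1 + 3 + Rabs B2) * (Rabs C * 2 ^ N)).
  assert (Hj : jet N (fun x => residual N (- x))).
  { apply (jet_ext _ (fun x => residual N (x * (-1)))); [apply near0_all; intros x; f_equal; ring|].
    apply (jet_comp N (residual N) (fun _ => -1)); [apply jet_residual|apply jet_const]. }
  assert (Hsmall : forall k, (S (k0 + k2) <= k)%nat -> Rabs (residual N (- node k)) <= C1 * node k ^ N).
  { intros [|k] Hk; [lia|]. rewrite Hres, Rabs_Ropp.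
    destruct (Hk2 (S k) ltac:(lia)) as [_ [HP HM]].
    pose proof (node_pos (S k)) as Hx0. pose proof (node_lt1 k) as Hx1.
    pose proof (node_decr k) as [D1 D2]. pose proof (node_decr (S k)) as [D3 D4].
    assert (Heps : forall j, (k0 <= j)%nat -> 0 < node j <= 2 * node (S k) ->
      Rabs (eps j) <= Rabs C * 2 ^ N * node (S k) ^ N).
    { intros j Hjk Hjn. apply Rle_trans with (C * node j ^ N); [exact (Hm j Hjk)|].
      apply Rle_trans with (Rabs C * node j ^ N).
      - apply Rmult_le_compat_r; [apply pow_le; lra|apply Rle_abs].
      - rewrite Rmult_assoc, <- Rpow_mult_distr.
        apply Rmult_le_compat_l; [apply Rabs_pos|]. apply pow_incr. lra. }
    pose proof (Heps (S (S k)) ltac:(lia) ltac:(split; [apply node_pos|lra])) as He2.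
    pose proof (Heps (S k) ltac:(lia) ltac:(split; [apply node_pos|lra])) as He1.
    pose proof (Heps k ltac:(lia) ltac:(split; [apply node_pos|lra])) as He0.
    unfold C1. set (T := Rabs C * 2 ^ N * node (S k) ^ N) in *.
    replace ((Rabs B1 + 3 + Rabs B2) * (Rabs C * 2 ^ N) * node (S k) ^ N)
      with (Rabs B1 * T + 3 * T + Rabs B2 * T) by (unfold T; ring).
    eapply Rle_trans; [apply Rabs_triang|]. apply Rplus_le_compat.
    - eapply Rle_trans; [apply Rabs_triang|]. rewrite Rabs_Ropp. apply Rplus_le_compat.
      + rewrite Rabs_mult. apply Rmult_le_compat; auto using Rabs_pos.
        eapply Rle_trans; [exact HP|apply Rle_abs].
      + rewrite Rabs_mult. apply Rmult_le_compat; auto using Rabs_pos.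
        assert (0 <= node (S k) ^ 2 <= 1) by (simpl; nra). rewrite Rabs_right; lra.
    - rewrite Rabs_mult. apply Rmult_le_compat; auto using Rabs_pos.
      eapply Rle_trans; [exact HM|apply Rle_abs]. }
  destruct (jet_reflection N _ node C1 _ Hj node_pos node_lim Hsmall) as [C' [HC' Hn]].
  destruct (node_eventually _ Hn) as [k3 Hk3].
  exists C', k3. split; [exact HC'|]. intros k Hk. destruct (Hk3 k Hk) as [_ H].
  rewrite Ropp_involutive, Rabs_Ropp, (Rabs_right (node k)) in H by (apply Rle_ge, Rlt_le, node_pos).
  exact H.
Qed.

(** * First-order behaviour at the sample points *)

Lemma cpoly_0 N : cpoly (S N) 0 = 1.
Proof.
  unfold cpoly. rewrite psum_Sl, c_0.
  rewrite (psum_ext _ (fun _ => 0 * 0)) by (intros; simpl; ring). rewrite psum_scal. simpl. ring.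
Qed.

Lemma cpoly_derive N y : exists l, is_derive (cpoly N) y l.
Proof.
  induction N as [|N [l IH]].
  - exists 0. apply (is_derive_const (K := R_AbsRing) (V := R_NormedModule)).
  - exists (l + c N * (INR N * y ^ Nat.pred N)).
    apply (is_derive_plus (K := R_AbsRing) (V := R_NormedModule) (cpoly N)); [exact IH|].
    auto_derive; [trivial|ring].
Qed.

Lemma stretch_0 t : stretch t 0 = 1.
Proof. unfold stretch. rewrite pow_i, Rmult_0_r, Rplus_0_r by lia. apply sqrt_1. Qed.

Lemma stretch_derive_0 t : is_derive (stretch t) 0 0.
Proof.
  unfold stretch. auto_derive.
  - replace (1 + t * (0 * (0 * 1))) with 1 by ring. lra.
  - simpl. rewrite !Rmult_0_l, !Rmult_0_r, Rmult_0_l. reflexivity.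
Qed.

Lemma step_0 : step 1 0 = 1.
Proof.
  unfold step. rewrite stretch_0, sqrt_1. replace (1 * (2 * 0 / (1 + 1))) with 0 by field.
  rewrite exp_0. ring.
Qed.

Lemma step_derive_0 : is_derive (step 1) 0 1.
Proof.
  pose proof (stretch_derive_0 1) as Hr.
  unfold step. auto_derive.
  - rewrite stretch_0. repeat split; try (eexists; exact Hr); lra.
  - derive_by (is_derive_unique (stretch 1) 0 _ Hr). rewrite stretch_0, sqrt_1.
    replace (1 * (2 * 0 * / (1 + 1))) with 0 by field. rewrite exp_0. field.
Qed.

(** The factor [step] at -x together with the polynomial at the next sample
    point: up to the factors K and 1 + x^2 and an error term, it is the next
    moment divided by the envelope at x. *)
Definition recessive_step (N : nat) (x : R) : R := step 1 (- x) * cpoly N (- (x / stretch 1 x)).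

Lemma recessive_step_0 N : recessive_step (S N) 0 = 1.
Proof.
  unfold recessive_step. rewrite Ropp_0, stretch_0. replace (- (0 / 1)) with 0 by field.
  rewrite step_0, cpoly_0. ring.
Qed.

Lemma recessive_step_derive_0 N l :
  is_derive (cpoly (S N)) 0 l -> is_derive (recessive_step (S N)) 0 (- 1 - l).
Proof.
  intros Hl. pose proof (stretch_derive_0 1) as Hr.
  assert (Hy : is_derive (fun x => - (x / stretch 1 x)) 0 (- 1)).
  { auto_derive.
    - rewrite stretch_0. repeat split; try (eexists; exact Hr); lra.
    - derive_by (is_derive_unique (stretch 1) 0 _ Hr). rewrite stretch_0. field. }
  assert (Hy0 : - (0 / stretch 1 0) = 0) by (rewrite stretch_0; field).
  assert (Hs : is_derive (fun x => step 1 (- x)) 0 (- 1 * 1)).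
  { apply (is_derive_comp (step 1) (fun x => - x)).
    - rewrite Ropp_0. exact step_derive_0.
    - apply is_derive_Ropp, (is_derive_id (K := R_AbsRing)). }
  assert (Hp : is_derive (fun x => cpoly (S N) (- (x / stretch 1 x))) 0 (- 1 * l)).
  { apply (is_derive_comp (cpoly (S N)) (fun x => - (x / stretch 1 x))); [rewrite Hy0; exact Hl|exact Hy]. }
  evar_last; [exact (is_derive_Rmult _ _ _ _ _ Hs Hp)|].
  cbv beta. rewrite Hy0, Ropp_0, step_0, cpoly_0. simpl. ring.
Qed.

Lemma first_order (F : R -> R) a :
  is_derive F 0 a -> F 0 = 0 -> forall eps, 0 < eps -> near0 (fun x => Rabs (F x - a * x) <= eps * Rabs x).
Proof.
  intros HF H0 eps He. apply is_derive_Reals in HF.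
  destruct (HF eps He) as [d Hd]. exists d. split; [apply cond_pos|].
  intros x Hx. destruct (Req_dec x 0) as [->|Hx0].
  - rewrite H0, Rmult_0_r, Rminus_0_r, Rabs_R0. lra.
  - specialize (Hd x Hx0 Hx). rewrite Rplus_0_l, H0, Rminus_0_r in Hd.
    replace (F x - a * x) with ((F x / x - a) * x) by (field; exact Hx0).
    rewrite Rabs_mult. apply Rmult_le_compat_r; [apply Rabs_pos|lra].
Qed.

Lemma envelope_pos s k : 0 < envelope s (node k).
Proof.
  unfold envelope. pose proof (node_pos k) as H. apply Rmult_lt_0_compat; [|apply exp_pos].
  apply Rmult_lt_0_compat; [exact H|apply sqrt_lt_R0, H].
Qed.

Lemma envelope_product k : envelope (-1) (node k) * envelope 1 (node k) = node k ^ 3.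
Proof.
  unfold envelope. pose proof (node_pos k) as H.
  transitivity (node k * node k * (sqrt (node k) * sqrt (node k)) *
    (exp (-1 * (2 / node k)) * exp (1 * (2 / node k)))); [ring|].
  rewrite <- exp_plus, sqrt_sqrt by lra.
  replace (-1 * (2 / node k) + 1 * (2 / node k)) with 0 by ring. rewrite exp_0. ring.
Qed.

Lemma envelope_next s k :
  s = 1 \/ s = -1 ->
  (1 + node k ^ 2) * envelope s (node (S k)) = envelope s (node k) * step 1 (s * node k).
Proof.
  intros Hs. rewrite node_succ, <- (envelope_step 1 s (node k) Hs (node_pos k)).
  - rewrite Rmult_1_l. reflexivity.
  - pose proof (pow2_ge_0 (node k)). lra.
Qed.

Definition rel_error (K : R) (N k : nat) : R :=
  moment k / (K * envelope (-1) (node k)) - cpoly N (- node k).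

Lemma moment_eq K N k :
  0 < K -> moment k = K * envelope (-1) (node k) * (cpoly N (- node k) + rel_error K N k).
Proof.
  intros HK. pose proof (envelope_pos (-1) k). unfold rel_error. field. split; lra.
Qed.

Lemma cpoly_bounded N : exists B, 0 <= B /\ forall y, Rabs y <= 1 -> Rabs (cpoly N y) <= B.
Proof.
  induction N as [|N [B [HB H]]].
  - exists 0. split; [lra|]. intros y _. unfold cpoly; simpl. rewrite Rabs_R0; lra.
  - exists (B + Rabs (c N)). split; [pose proof (Rabs_pos (c N)); lra|]. intros y Hy.
    change (cpoly (S N) y) with (cpoly N y + c N * y ^ N).
    eapply Rle_trans; [apply Rabs_triang|]. apply Rplus_le_compat; [apply H, Hy|].
    rewrite Rabs_mult, <- RPow_abs. rewrite <- (Rmult_1_r (Rabs (c N))) at 2.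
    apply Rmult_le_compat_l; [apply Rabs_pos|]. rewrite <- (pow1 N).
    apply pow_incr. split; [apply Rabs_pos|exact Hy].
Qed.

Lemma node_Rabs k : Rabs (node k) <= 1 /\ Rabs (- node k) <= 1.
Proof.
  pose proof (node_pos k). pose proof (node_le1 k).
  rewrite Rabs_Ropp, Rabs_right by lra. lra.
Qed.

Lemma pow_node_le k n : (2 <= n)%nat -> node k ^ n <= node k * node k.
Proof.
  intros Hn. pose proof (node_pos k). pose proof (node_le1 k).
  replace n with (2 + (n - 2))%nat by lia. rewrite pow_add.
  rewrite <- (Rmult_1_r (node k * node k)). simpl (node k ^ 2). rewrite Rmult_1_r.
  apply Rmult_le_compat_l; [nra|]. rewrite <- (pow1 (n - 2)). apply pow_incr. lra.
Qed.

Lemma rel_error_quadratic K C N k0 k :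
  (2 <= N)%nat -> (k0 <= k)%nat ->
  (forall k, (k0 <= k)%nat -> Rabs (rel_error K N k) <= C * node k ^ N) ->
  Rabs (rel_error K N k) <= Rabs C * (node k * node k) /\
  Rabs (rel_error K N (S k)) <= Rabs C * (node k * node k).
Proof.
  intros HN Hk Heps. pose proof (node_pos k). pose proof (node_pos (S k)).
  pose proof (node_decr k) as [D _]. pose proof (pow_node_le k N HN) as Hp.
  assert (Hp' : node (S k) ^ N <= node k ^ N) by (apply pow_incr; lra).
  split; (eapply Rle_trans; [apply Heps; lia|]);
    (eapply Rle_trans; [apply Rmult_le_compat_r; [apply pow_le; lra|apply Rle_abs]|]);
    apply Rmult_le_compat_l; try apply Rabs_pos; lra.
Qed.

(** To first order consecutive moments have ratio 1 - x; the weaker rate 1 -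
    x/2 absorbs all error terms. *)
Lemma moment_ratio K C N k0 :
  0 < K -> (2 <= N)%nat ->
  (forall k, (k0 <= k)%nat -> Rabs (rel_error K N k) <= C * node k ^ N) ->
  exists k1, forall k, (k1 <= k)%nat -> moment (S k) <= (1 - node k / 2) * moment k.
Proof.
  intros HK HN Heps. destruct N as [|N]; [lia|].
  destruct (cpoly_derive (S N) 0) as [l Hl].
  (* F vanishes at 0 with slope -1/2, hence lies below any term of order x^2. *)
  set (F := fun x => recessive_step (S N) x - (1 - x / 2) * (1 + x ^ 2) * cpoly (S N) (- x)).
  assert (HF : is_derive F 0 (- 1 / 2)).
  { assert (H1 : is_derive (fun x => cpoly (S N) (- x)) 0 (- 1 * l)).
    { apply (is_derive_comp (cpoly (S N)) (fun x => - x)); [rewrite Ropp_0; exact Hl|].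
      apply is_derive_Ropp, (is_derive_id (K := R_AbsRing)). }
    assert (H2 : is_derive (fun x => (1 - x / 2) * (1 + x ^ 2)) 0 (- 1 / 2)).
    { auto_derive; [trivial|]. field. }
    evar_last.
    - exact (is_derive_minus _ _ _ _ _ (recessive_step_derive_0 N l Hl) (is_derive_Rmult _ _ _ _ _ H2 H1)).
    - unfold minus, plus, opp; simpl. rewrite Ropp_0, cpoly_0. field. }
  assert (HF0 : F 0 = 0).
  { unfold F. rewrite recessive_step_0, Ropp_0, cpoly_0. field. }
  pose proof (first_order F _ HF HF0 (/ 8) ltac:(lra)) as Hn.
  destruct (jet_step 1 0 (or_introl eq_refl)) as [B HB].
  set (T := (3 + Rabs B) * Rabs C + 1).
  assert (HT : 1 <= T).
  { unfold T. pose proof (Rabs_pos B). pose proof (Rabs_pos C). nra. }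
  assert (Hsm : near0 (fun x => Rabs x < / (8 * T))).
  { exists (/ (8 * T)). split; [apply Rinv_0_lt_compat; lra|auto]. }
  destruct (node_eventually _ (near0_and _ _ (near0_and _ _ Hn HB) Hsm)) as [k1 Hk1].
  exists (k0 + k1)%nat. intros k Hk.
  destruct (Hk1 k ltac:(lia)) as [[[H1 _] H3] [[_ H2] _]].
  pose proof (node_pos k) as Hx0. pose proof (node_le1 k) as Hx1.
  pose proof (envelope_next (-1) k (or_intror eq_refl)) as Henv.
  pose proof (envelope_pos (-1) k) as Hp.
  destruct (rel_error_quadratic K C (S N) k0 k HN ltac:(lia) Heps) as [E0' E1'].
  rewrite (moment_eq K (S N) (S k) HK), (moment_eq K (S N) k HK).
  replace (-1 * node k) with (- node k) in Henv by ring.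
  set (x := node k) in *. set (e0 := rel_error K (S N) k) in *. set (e1 := rel_error K (S N) (S k)) in *.
  rewrite (Rabs_right x) in H1, H3 by lra.
  assert (Hx2 : 0 < 1 + x ^ 2) by (pose proof (pow2_ge_0 x); lra).
  apply Rmult_le_reg_l with (1 + x ^ 2); [exact Hx2|].
  transitivity (K * envelope (-1) x * (recessive_step (S N) x + step 1 (- x) * e1)).
  { right. transitivity (K * ((1 + x ^ 2) * envelope (-1) (node (S k))) * (cpoly (S N) (- node (S k)) + e1)); [ring|].
    rewrite Henv. unfold recessive_step. rewrite node_succ. fold x. ring. }
  transitivity (K * envelope (-1) x * ((1 - x / 2) * (1 + x ^ 2) * (cpoly (S N) (- x) + e0))); [|right; ring].
  apply Rmult_le_compat_l; [apply Rlt_le, Rmult_lt_0_compat; assumption|].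
  assert (HFx : F x <= - (3 / 8) * x).
  { pose proof (Rle_abs (F x - -1 / 2 * x)). lra. }
  assert (A1 : - (step 1 (- x) * e1) >= - (Rabs B * (Rabs C * (x * x)))).
  { apply Rle_ge, Ropp_le_contravar. eapply Rle_trans; [apply Rle_abs|]. rewrite Rabs_mult.
    apply Rmult_le_compat; auto using Rabs_pos. eapply Rle_trans; [exact H2|apply Rle_abs]. }
  assert (A2 : (1 - x / 2) * (1 + x ^ 2) * e0 >= - (3 * (Rabs C * (x * x)))).
  { apply Rle_ge. apply Rle_trans with (- Rabs ((1 - x / 2) * (1 + x ^ 2) * e0)).
    - apply Ropp_le_contravar. rewrite Rabs_mult. apply Rmult_le_compat; auto using Rabs_pos.
      rewrite Rabs_right; simpl; nra.
    - pose proof (Rle_abs (- ((1 - x / 2) * (1 + x ^ 2) * e0))) as Ha. rewrite Rabs_Ropp in Ha. lra. }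
  assert (A3 : (3 + Rabs B) * Rabs C * (x * x) <= x / 8).
  { apply Rle_trans with (T * (x * x)); [unfold T; nra|].
    assert (x * T <= / 8).
    { apply Rle_trans with (/ (8 * T) * T); [apply Rmult_le_compat_r; lra|]. right. field. lra. }
    nra. }
  unfold F in HFx. lra.
Qed.

Lemma moment_bound K C N k0 :
  0 < K ->
  (forall k, (k0 <= k)%nat -> Rabs (rel_error K N k) <= C * node k ^ N) ->
  exists B, 0 <= B /\ forall k, (k0 <= k)%nat -> moment k <= B * envelope (-1) (node k).
Proof.
  intros HK Heps. destruct (cpoly_bounded N) as [B [HB Hpoly]].
  exists (K * (B + Rabs C)). pose proof (Rabs_pos C) as HC.
  split; [apply Rmult_le_pos; lra|]. intros k Hk.
  rewrite (moment_eq K N k HK).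
  pose proof (envelope_pos (-1) k) as He. pose proof (node_pos k). pose proof (node_le1 k).
  replace (K * (B + Rabs C) * envelope (-1) (node k)) with (K * envelope (-1) (node k) * (B + Rabs C)) by ring.
  apply Rmult_le_compat_l; [apply Rlt_le, Rmult_lt_0_compat; assumption|].
  specialize (Hpoly (- node k) (proj2 (node_Rabs k))). specialize (Heps k Hk).
  pose proof (Rle_abs (cpoly N (- node k))). pose proof (Rle_abs (rel_error K N k)).
  assert (Hp : 0 <= node k ^ N <= 1).
  { split; [apply pow_le; lra|]. rewrite <- (pow1 N). apply pow_incr; lra. }
  pose proof (Rle_abs C). assert (C * node k ^ N <= Rabs C) by nra. lra.
Qed.

(** * The Casoratian with the approximate solution *)

Definition casoratian (N k : nat) : R :=
  (INR k + 1) * (INR k + 2) * (moment k * approx_solution 1 N (S k) - approx_solution 1 N k * moment (S k)).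

(** The sequence (k+1)(k+2) W_k is constant for two exact solutions; here its
    increments measure the residual of the approximate one. *)
Lemma casoratian_step N k :
  casoratian N (S k) - casoratian N k =
  (INR k + 2) * moment (S k) * ((INR k + 2) * envelope 1 (node (S k)) * residual N (node (S k))).
Proof.
  pose proof (approx_solution_recurrence 1 N k (or_introl eq_refl)) as Ha.
  rewrite Rmult_1_l in Ha. rewrite <- Ha.
  unfold casoratian. rewrite S_INR.
  transitivity ((INR k + 2) * (moment (S k) * ((INR k + 3) * approx_solution 1 N (S (S k)) + (INR k + 1) * approx_solution 1 N k)
    - approx_solution 1 N (S k) * ((INR k + 1) * moment k + (INR k + 3) * moment (S (S k))))); [ring|].
  replace ((INR k + 1) * moment k + (INR k + 3) * moment (S (S k))) with ((2 * INR k + 5) * moment (S k))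
    by (pose proof (moment_recurrence k); lra).
  ring.
Qed.

(** The envelopes of the two solutions multiply to x^3, so no exponential
    factor remains. *)
Lemma casoratian_step_small K C q k0 :
  let N := (2 * q + 5)%nat in
  0 < K ->
  (forall k, (k0 <= k)%nat -> Rabs (rel_error K N k) <= C * node k ^ N) ->
  exists T k1, 0 <= T /\ forall k, (k1 <= k)%nat ->
    Rabs (casoratian N (S k) - casoratian N k) <= T * (/ INR (S (S k))) ^ (q + 2).
Proof.
  intros N HK Heps.
  destruct (moment_bound K C N k0 HK Heps) as [B [HB HBm]].
  destruct (residual_small K N C k0 HK Heps) as (C' & k1 & HC' & Hres).
  exists (B * C'), (k0 + k1)%nat. split; [apply Rmult_le_pos; assumption|]. intros k Hk.
  rewrite casoratian_step.
  specialize (HBm (S k) ltac:(lia)). specialize (Hres (S k) ltac:(lia)).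
  pose proof (node_pos (S k)) as Hx. pose proof (moment_pos (S k)) as Hm.
  pose proof (envelope_pos 1 (S k)) as He1. pose proof (envelope_product (S k)) as Hee.
  pose proof (pos_INR k) as Hk0.
  pose proof (node_sqr (S k)) as Hx2. rewrite <- Hx2.
  assert (Hk2 : INR k + 2 = / (node (S k) ^ 2)).
  { rewrite Hx2, Rinv_inv, !S_INR. ring. }
  rewrite !Rabs_mult.
  rewrite (Rabs_right (INR k + 2)), (Rabs_right (moment (S k))), (Rabs_right (envelope 1 (node (S k)))) by lra.
  apply Rle_trans with ((INR k + 2) * (B * envelope (-1) (node (S k))) *
     ((INR k + 2) * envelope 1 (node (S k)) * (C' * node (S k) ^ N))).
  - apply Rmult_le_compat.
    + apply Rmult_le_pos; lra.
    + apply Rmult_le_pos; [apply Rmult_le_pos; lra|apply Rabs_pos].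
    + apply Rmult_le_compat_l; lra.
    + apply Rmult_le_compat_l; [apply Rmult_le_pos; lra|exact Hres].
  - right.
    transitivity (B * C' * ((INR k + 2) * (INR k + 2) * (envelope (-1) (node (S k)) * envelope 1 (node (S k))) * node (S k) ^ N));
      [ring|].
    rewrite Hee, Hk2. unfold N. replace (2 * q + 5)%nat with (2 * (q + 2) + 1)%nat by lia.
    rewrite pow_add, <- pow_mult. f_equal. field. lra.
Qed.

(** Relative to the envelopes the Casoratian is an odd function of x, up to
    errors of order x^2; its derivative 2 at 0 is the limit, up to the factor
    K. *)
Lemma casoratian_limit K C N k0 :
  0 < K -> (2 <= N)%nat ->
  (forall k, (k0 <= k)%nat -> Rabs (rel_error K N k) <= C * node k ^ N) ->
  forall eps, 0 < eps -> exists k1, forall k, (k1 <= k)%nat -> Rabs (casoratian N k - 2 * K) <= eps.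
Proof.
  intros HK HN Heps eps He. destruct N as [|N]; [lia|].
  destruct (cpoly_derive (S N) 0) as [l Hl].
  set (Psi := fun x => recessive_step (S N) (- x) * cpoly (S N) (- x) - recessive_step (S N) x * cpoly (S N) x).
  (* recessive_step at -x is its dominant counterpart at x. *)
  assert (HPsi : is_derive Psi 0 2).
  { assert (H1 : is_derive (fun x => cpoly (S N) (- x)) 0 (- 1 * l)).
    { apply (is_derive_comp (cpoly (S N)) (fun x => - x)); [rewrite Ropp_0; exact Hl|].
      apply is_derive_Ropp, (is_derive_id (K := R_AbsRing)). }
    pose proof (recessive_step_derive_0 N l Hl) as HG.
    assert (H2 : is_derive (fun x => recessive_step (S N) (- x)) 0 (- 1 * (- 1 - l))).
    { apply (is_derive_comp (recessive_step (S N)) (fun x => - x)); [rewrite Ropp_0; exact HG|].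
      apply is_derive_Ropp, (is_derive_id (K := R_AbsRing)). }
    evar_last.
    - exact (is_derive_minus _ _ _ _ _ (is_derive_Rmult _ _ _ _ _ H2 H1) (is_derive_Rmult _ _ _ _ _ HG Hl)).
    - unfold minus, plus, opp; simpl. rewrite Ropp_0, cpoly_0, recessive_step_0. ring. }
  assert (HPsi0 : Psi 0 = 0).
  { unfold Psi. rewrite Ropp_0. ring. }
  set (e := eps / (2 * K)).
  assert (Hepos : 0 < e) by (apply Rdiv_lt_0_compat; lra).
  pose proof (first_order Psi _ HPsi HPsi0 e Hepos) as Hn.
  destruct (jet_step 1 0 (or_introl eq_refl)) as [B HB].
  destruct (cpoly_bounded (S N)) as [D [HD Hpoly]].
  set (T := 2 * (Rabs B * D * Rabs C) + 1).
  assert (HT : 1 <= T).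
  { unfold T. pose proof (Rabs_pos B). pose proof (Rabs_pos C).
    assert (0 <= Rabs B * D * Rabs C) by (repeat apply Rmult_le_pos; assumption). lra. }
  assert (Hsm : near0 (fun x => Rabs x < e / T)).
  { exists (e / T). split; [apply Rdiv_lt_0_compat; lra|auto]. }
  destruct (node_eventually _ (near0_and _ _ (near0_and _ _ Hn HB) Hsm)) as [k1 Hk1].
  exists (k0 + k1)%nat. intros k Hk.
  destruct (Hk1 k ltac:(lia)) as [[[H1 H2] H3] [[_ H2'] _]].
  pose proof (node_pos k) as Hx0. pose proof (node_le1 k) as Hx1.
  pose proof (envelope_next (-1) k (or_intror eq_refl)) as Envm.
  pose proof (envelope_next 1 k (or_introl eq_refl)) as Envp.
  pose proof (envelope_product k) as Hee.
  destruct (rel_error_quadratic K C (S N) k0 k HN ltac:(lia) Heps) as [E0' E1'].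
  pose proof (Hpoly (node k) (proj1 (node_Rabs k))) as P0.
  pose proof (Hpoly (node (S k)) (proj1 (node_Rabs (S k)))) as P1.
  pose proof (node_sqr k) as Hx2.
  assert (Hkk : (INR k + 1) * (INR k + 2) = (1 + node k ^ 2) / node k ^ 4).
  { replace (node k ^ 4) with (node k ^ 2 * node k ^ 2) by ring. rewrite Hx2, S_INR.
    pose proof (pos_INR k). field. lra. }
  unfold casoratian, approx_solution. rewrite Hkk, !Rmult_1_l.
  rewrite (moment_eq K (S N) (S k) HK), (moment_eq K (S N) k HK).
  replace (-1 * node k) with (- node k) in Envm by ring. rewrite Rmult_1_l in Envp.
  set (x := node k) in *. set (e0 := rel_error K (S N) k) in *. set (e1 := rel_error K (S N) (S k)) in *.
  assert (HV : (1 + x ^ 2) / x ^ 4 *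
    (K * envelope (-1) x * (cpoly (S N) (- x) + e0) * (envelope 1 (node (S k)) * cpoly (S N) (node (S k))) -
     envelope 1 x * cpoly (S N) x * (K * envelope (-1) (node (S k)) * (cpoly (S N) (- node (S k)) + e1)))
    = K * / x * (Psi x + (step 1 x * cpoly (S N) (node (S k)) * e0 - step 1 (- x) * cpoly (S N) x * e1))).
  { transitivity (K * / x ^ 4 * (envelope (-1) x * ((1 + x ^ 2) * envelope 1 (node (S k))) * (cpoly (S N) (- x) + e0) * cpoly (S N) (node (S k))
       - envelope 1 x * ((1 + x ^ 2) * envelope (-1) (node (S k))) * cpoly (S N) x * (cpoly (S N) (- node (S k)) + e1)));
      [unfold Rdiv; ring|].
    rewrite Envm, Envp.
    transitivity (K * / x ^ 4 * (envelope (-1) x * envelope 1 x) * (step 1 x * (cpoly (S N) (- x) + e0) * cpoly (S N) (node (S k))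
       - step 1 (- x) * cpoly (S N) x * (cpoly (S N) (- node (S k)) + e1))); [ring|].
    rewrite Hee. unfold Psi, recessive_step.
    replace (stretch 1 (- x)) with (stretch 1 x) by (unfold stretch; do 3 f_equal; ring).
    rewrite Ropp_involutive. replace (- (- x / stretch 1 x)) with (x / stretch 1 x) by (unfold Rdiv; ring).
    replace (x / stretch 1 x) with (node (S k)) by (apply node_succ). field. lra. }
  rewrite HV.
  rewrite (Rabs_right x) in H1, H3 by lra.
  replace (K * / x * (Psi x + (step 1 x * cpoly (S N) (node (S k)) * e0 - step 1 (- x) * cpoly (S N) x * e1)) - 2 * K)
    with (K * / x * ((Psi x - 2 * x) + (step 1 x * cpoly (S N) (node (S k)) * e0 - step 1 (- x) * cpoly (S N) x * e1)))
    by (field; lra).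
  assert (Hrest : Rabs (step 1 x * cpoly (S N) (node (S k)) * e0 - step 1 (- x) * cpoly (S N) x * e1) <= T * (x * x)).
  { eapply Rle_trans; [apply Rabs_triang|]. rewrite Rabs_Ropp, !Rabs_mult.
    assert (Hb : Rabs (step 1 x) <= Rabs B) by (eapply Rle_trans; [exact H2|apply Rle_abs]).
    assert (Hb' : Rabs (step 1 (- x)) <= Rabs B) by (eapply Rle_trans; [exact H2'|apply Rle_abs]).
    assert (G1 : Rabs (step 1 x) * Rabs (cpoly (S N) (node (S k))) * Rabs e0 <= Rabs B * D * (Rabs C * (x * x))).
    { apply Rmult_le_compat; try apply Rabs_pos; [apply Rmult_le_pos; apply Rabs_pos| |exact E0'].
      apply Rmult_le_compat; auto using Rabs_pos. }
    assert (G2 : Rabs (step 1 (- x)) * Rabs (cpoly (S N) x) * Rabs e1 <= Rabs B * D * (Rabs C * (x * x))).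
    { apply Rmult_le_compat; try apply Rabs_pos; [apply Rmult_le_pos; apply Rabs_pos| |exact E1'].
      apply Rmult_le_compat; auto using Rabs_pos. }
    unfold T. nra. }
  rewrite Rabs_mult, (Rabs_right (K * / x)).
  2:{ apply Rle_ge, Rmult_le_pos; [lra|apply Rlt_le, Rinv_0_lt_compat, Hx0]. }
  apply Rle_trans with (K * / x * (e * x + T * (x * x))).
  - apply Rmult_le_compat_l; [apply Rmult_le_pos; [lra|apply Rlt_le, Rinv_0_lt_compat, Hx0]|].
    eapply Rle_trans; [apply Rabs_triang|]. apply Rplus_le_compat; [lra|exact Hrest].
  - replace (K * / x * (e * x + T * (x * x))) with (K * (e + x * T)) by (field; lra).
    assert (x * T <= e).
    { apply Rle_trans with (e / T * T); [apply Rmult_le_compat_r; lra|]. right. field. lra. }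
    replace eps with (K * (e + e)) by (unfold e; field; lra).
    apply Rmult_le_compat_l; lra.
Qed.

Lemma telescoping_tail (u : nat -> R) T q k0 :
  0 <= T ->
  (forall k, (k0 <= k)%nat -> Rabs (u (S k) - u k) <= T * (/ INR (S (S k))) ^ (q + 2)) ->
  forall k d, (k0 <= k)%nat ->
    Rabs (u (k + d)%nat - u k) <= T * (/ INR (S k)) ^ q * (/ INR (S k) - / INR (S (k + d))).
Proof.
  intros HT Hu k d Hk. induction d as [|d IH].
  - rewrite Nat.add_0_r, !Rminus_diag, Rabs_R0. lra.
  - rewrite <- plus_n_Sm.
    replace (u (S (k + d)) - u k) with ((u (S (k + d)) - u (k + d)%nat) + (u (k + d)%nat - u k)) by ring.
    eapply Rle_trans; [apply Rabs_triang|].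
    specialize (Hu (k + d)%nat ltac:(lia)).
    pose proof (INR_S_pos k) as H1. pose proof (INR_S_pos (k + d)) as H2. pose proof (INR_S_pos (S (k + d))) as H3.
    assert (Hle : INR (S k) <= INR (S (k + d))) by (apply le_INR; lia).
    pose proof (S_INR (S (k + d))) as Hs.
    set (a := INR (S k)) in *. set (b := INR (S (k + d))) in *. set (b' := INR (S (S (k + d)))) in *.
    assert (Hstep : T * (/ b') ^ (q + 2) <= T * (/ a) ^ q * (/ b - / b')).
    { rewrite Rmult_assoc. apply Rmult_le_compat_l; [exact HT|]. rewrite pow_add.
      assert (Ib' : 0 < / b') by (apply Rinv_0_lt_compat; lra).
      apply Rmult_le_compat.
      - apply pow_le; lra.
      - apply pow_le; lra.
      - apply pow_incr. split; [lra|]. apply Rinv_le_contravar; lra.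
      - replace (/ b - / b') with (/ b * / b') by (rewrite Hs in *; field; lra).
        simpl. rewrite Rmult_1_r. apply Rmult_le_compat_r; [lra|].
        apply Rinv_le_contravar; lra. }
    lra.
Qed.

(** Sum the increments from k to infinity, where the limit is known. *)
Lemma casoratian_rate K C q k0 :
  let N := (2 * q + 5)%nat in
  0 < K ->
  (forall k, (k0 <= k)%nat -> Rabs (rel_error K N k) <= C * node k ^ N) ->
  exists T k1, 0 <= T /\ forall k, (k1 <= k)%nat ->
    Rabs (casoratian N k - 2 * K) <= T * (/ INR (S k)) ^ (q + 1).
Proof.
  intros N HK Heps.
  destruct (casoratian_step_small K C q k0 HK Heps) as (T & k1 & HT & Hstep). fold N in Hstep.
  pose proof (casoratian_limit K C N k0 HK ltac:(unfold N; lia) Heps) as Hlim.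
  exists T, k1. split; [exact HT|]. intros k Hk.
  apply le_epsilon. intros eps He. destruct (Hlim eps He) as [k2 Hk2].
  pose proof (telescoping_tail (casoratian N) T q k1 HT Hstep k k2 Hk) as Htel.
  specialize (Hk2 (k + k2)%nat ltac:(lia)).
  replace (casoratian N k - 2 * K) with
    (- (casoratian N (k + k2) - casoratian N k) + (casoratian N (k + k2) - 2 * K)) by ring.
  eapply Rle_trans; [apply Rabs_triang|]. rewrite Rabs_Ropp.
  apply Rplus_le_compat; [|exact Hk2]. eapply Rle_trans; [exact Htel|].
  rewrite pow_add, pow_1, <- Rmult_assoc. apply Rmult_le_compat_l.
  - apply Rmult_le_pos; [exact HT|]. apply pow_le, Rlt_le, Rinv_0_lt_compat, INR_S_pos.
  - pose proof (Rinv_0_lt_compat _ (INR_S_pos (k + k2))). lra.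
Qed.

(** * Comparison with the dominant solution *)

Lemma inv_succ_pow_ge z M : 0 <= z -> 1 - INR M * z <= (/ (1 + z)) ^ M.
Proof.
  intros Hz.
  assert (Ha : 0 < / (1 + z)) by (apply Rinv_0_lt_compat; lra).
  assert (Ha1 : 1 - z <= / (1 + z)).
  { apply Rmult_le_reg_r with (1 + z); [lra|]. rewrite Rinv_l by lra. nra. }
  induction M as [|M IH]; [simpl; lra|].
  rewrite S_INR. simpl pow. pose proof (pos_INR M) as HM.
  pose proof (pow_lt _ M Ha) as Hp.
  destruct (Rle_dec (1 - (INR M + 1) * z) 0) as [H|H]; [nra|].
  assert (0 <= INR M * z) by nra.
  apply Rle_trans with ((1 - z) * (1 - INR M * z)); [nra|].
  apply Rmult_le_compat; nra.
Qed.

(** A contraction by 1 - x/2 with x = 1/sqrt(k+1) is much stronger than the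
    decrease of (k+1)^{-M}, whose relative step is of order x^2; it therefore
    loses at most one power of k against the forcing term. *)
Lemma contraction_decay (y : nat -> R) T M k0 :
  (forall k, 0 <= y k) -> 0 <= T ->
  (forall k, (k0 <= k)%nat -> y (S k) <= (1 - node k / 2) * y k + T * (/ INR (S k)) ^ (M + 1)) ->
  exists T' k1, 0 <= T' /\ forall k, (k1 <= k)%nat -> y k <= T' * (/ INR (S k)) ^ M.
Proof.
  intros Hy HT Hrec.
  (* Below d the loss M x^2 is at most half of the gain x/2. *)
  set (d := / (4 * INR M + 4)).
  pose proof (pos_INR M) as HM.
  assert (Hd : 0 < d) by (apply Rinv_0_lt_compat; lra).
  assert (Hnear : near0 (fun x => Rabs x < d)) by (exists d; split; [exact Hd|auto]).
  destruct (node_eventually _ Hnear) as [k2 Hk2].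
  set (k1 := (k0 + k2)%nat).
  set (T' := 4 * T + y k1 * INR (S k1) ^ M).
  pose proof (INR_S_pos k1) as Hk1p.
  assert (HT' : 4 * T <= T').
  { unfold T'. pose proof (Hy k1). pose proof (pow_lt _ M Hk1p). nra. }
  exists T', k1. split; [lra|]. intros k Hk.
  induction Hk as [|k Hk IH].
  - assert (E : INR (S k1) ^ M * (/ INR (S k1)) ^ M = 1).
    { rewrite <- Rpow_mult_distr, Rinv_r by lra. apply pow1. }
    assert (0 <= (/ INR (S k1)) ^ M) by (apply pow_le, Rlt_le, Rinv_0_lt_compat, Hk1p).
    unfold T'. replace ((4 * T + y k1 * INR (S k1) ^ M) * (/ INR (S k1)) ^ M)
      with (4 * T * (/ INR (S k1)) ^ M + y k1 * (INR (S k1) ^ M * (/ INR (S k1)) ^ M)) by ring.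
    rewrite E. nra.
  - assert (Hk0 : (k0 <= k)%nat) by (unfold k1 in *; lia).
    destruct (Hk2 k ltac:(unfold k1 in *; lia)) as [Hx _].
    pose proof (node_pos k) as Hx0. rewrite Rabs_right in Hx by lra.
    pose proof (node_le1 k) as Hx1.
    eapply Rle_trans; [apply Hrec, Hk0|].
    pose proof (node_sqr k) as Hz.
    pose proof (INR_S_pos k) as Hkp.
    assert (Hz' : / INR (S (S k)) = / INR (S k) * / (1 + / INR (S k))).
    { rewrite (S_INR (S k)). field. lra. }
    rewrite Hz', Rpow_mult_distr.
    rewrite pow_add, pow_1. rewrite <- Hz in IH |- *.
    set (x := node k) in *.
    assert (Hzp : 0 <= (x ^ 2) ^ M) by (apply pow_le, pow2_ge_0).
    pose proof (inv_succ_pow_ge (x ^ 2) M (pow2_ge_0 x)) as Hb.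
    apply Rle_trans with (T' * ((x ^ 2) ^ M * (1 - INR M * x ^ 2))).
    2:{ apply Rmult_le_compat_l; [lra|]. apply Rmult_le_compat_l; [exact Hzp|exact Hb]. }
    apply Rle_trans with ((1 - x / 2) * (T' * (x ^ 2) ^ M) + T * ((x ^ 2) ^ M * x ^ 2)).
    + apply Rplus_le_compat_r. apply Rmult_le_compat_l; [lra|exact IH].
    + assert (Hmx : INR M * x <= / 4).
      { apply Rle_trans with (INR M * d); [apply Rmult_le_compat_l; lra|].
        unfold d. apply Rmult_le_reg_r with (4 * INR M + 4); [lra|].
        rewrite Rmult_assoc, Rinv_l by lra. lra. }
      assert (Hkey : 0 <= T' * (x / 2 - INR M * x ^ 2) - T * x ^ 2).
      { assert (x / 4 <= x / 2 - INR M * x ^ 2) by (simpl; nra).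
        assert (T' * (x / 4) <= T' * (x / 2 - INR M * x ^ 2)) by (apply Rmult_le_compat_l; lra).
        assert (T * x ^ 2 <= T * x) by (apply Rmult_le_compat_l; [lra|simpl; nra]).
        nra. }
      pose proof (Rmult_le_pos _ _ Hzp Hkey) as Hfin. lra.
Qed.

Definition defect (K : R) (N k : nat) : R := moment k * (acoef (S k) - approx_solution 1 N k / (2 * K)).

(** Dividing the two Casoratian relations by [moment k] gives a recursion
    whose multiplier is the squared ratio of consecutive moments. *)
Lemma defect_small K C q k0 :
  let N := (2 * q + 5)%nat in
  0 < K ->
  (forall k, (k0 <= k)%nat -> Rabs (rel_error K N k) <= C * node k ^ N) ->
  exists T k1, 0 <= T /\ forall k, (k1 <= k)%nat -> Rabs (defect K N k) <= T * (/ INR (S k)) ^ (q + 2).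
Proof.
  intros N HK Heps.
  destruct (casoratian_rate K C q k0 HK Heps) as (T & k1 & HT & Hrate). fold N in Hrate.
  destruct (moment_ratio K C N k0 HK ltac:(unfold N; lia) Heps) as [k2 Hratio].
  apply (contraction_decay (fun k => Rabs (defect K N k)) (T / (2 * K)) (q + 2) (k1 + k2)).
  - intros k; apply Rabs_pos.
  - apply Rmult_le_pos; [exact HT|]. apply Rlt_le, Rinv_0_lt_compat; lra.
  - intros k Hk. specialize (Hrate k ltac:(lia)). specialize (Hratio k ltac:(lia)).
    pose proof (moment_pos k) as Hm. pose proof (moment_pos (S k)) as Hm'.
    pose proof (moment_wronskian k) as HW.
    pose proof (node_pos k) as Hx0. pose proof (node_le1 k) as Hx1. pose proof (pos_INR k) as Hk0.
    set (r := moment (S k) / moment k).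
    set (eta := 1 - casoratian N k / (2 * K)).
    assert (Hgap : defect K N (S k) = r * (r * defect K N k) + r * (eta / ((INR k + 1) * (INR k + 2)))).
    { transitivity (r * (r * defect K N k) + r * (((INR k + 1) * (INR k + 2) *
         (moment k * acoef (S (S k)) - acoef (S k) * moment (S k)) - casoratian N k / (2 * K)) / ((INR k + 1) * (INR k + 2)))).
      - unfold defect, casoratian, r. field. repeat split; lra.
      - rewrite HW. reflexivity. }
    assert (Hr : 0 < r <= 1 - node k / 2).
    { unfold r. split; [apply Rdiv_lt_0_compat; assumption|].
      apply Rmult_le_reg_r with (moment k); [exact Hm|]. unfold Rdiv at 1. rewrite Rmult_assoc, Rinv_l; lra. }
    rewrite Hgap. eapply Rle_trans; [apply Rabs_triang|]. apply Rplus_le_compat.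
    + rewrite !Rabs_mult, (Rabs_right r) by lra. pose proof (Rabs_pos (defect K N k)).
      apply Rmult_le_compat; [lra|apply Rmult_le_pos; lra|lra|].
      rewrite <- (Rmult_1_l (Rabs (defect K N k))) at 2. apply Rmult_le_compat_r; lra.
    + rewrite Rabs_mult, (Rabs_right r) by lra.
      assert (Heta : Rabs eta <= T / (2 * K) * (/ INR (S k)) ^ (q + 1)).
      { unfold eta. replace (1 - casoratian N k / (2 * K)) with (- (casoratian N k - 2 * K) * / (2 * K)) by (field; lra).
        rewrite Rabs_mult, Rabs_Ropp, (Rabs_right (/ (2 * K))) by (apply Rle_ge, Rlt_le, Rinv_0_lt_compat; lra).
        unfold Rdiv. rewrite (Rmult_comm T), Rmult_assoc, (Rmult_comm (/ (2 * K))).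
        apply Rmult_le_compat_r; [apply Rlt_le, Rinv_0_lt_compat; lra|exact Hrate]. }
      assert (Hi : 0 < / ((INR k + 1) * (INR k + 2)) <= (/ INR (S k)) ^ 2).
      { split; [apply Rinv_0_lt_compat; nra|]. rewrite S_INR, pow_inv. apply Rinv_le_contravar; simpl; nra. }
      replace (q + 2 + 1)%nat with (q + 1 + 2)%nat by lia. rewrite pow_add, <- Rmult_assoc.
      unfold Rdiv at 1. rewrite Rabs_mult, (Rabs_right (/ ((INR k + 1) * (INR k + 2)))) by lra.
      apply Rle_trans with (1 * (Rabs eta * / ((INR k + 1) * (INR k + 2)))).
      * apply Rmult_le_compat_r; [|lra]. apply Rmult_le_pos; [apply Rabs_pos|lra].
      * rewrite Rmult_1_l. apply Rmult_le_compat; [apply Rabs_pos|lra|exact Heta|lra].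
Qed.

(** * The product of the two expansions *)

Lemma bigO_psum_tail (a : nat -> R) M N :
  (M <= N)%nat ->
  bigO M (fun l => psum (fun k => a k * (/ l) ^ k) N - psum (fun k => a k * (/ l) ^ k) M).
Proof.
  induction 1 as [|N HMN IH].
  - apply (bigO_ext _ (fun _ => 0) _ 0); [intros; ring|].
    apply (bigO_intro _ _ 0 0). intros; rewrite Rabs_R0; lra.
  - apply (bigO_ext _ (fun l => (psum (fun k => a k * (/ l) ^ k) N - psum (fun k => a k * (/ l) ^ k) M) + a N * (/ l) ^ N) _ 0).
    + intros; simpl; ring.
    + apply bigO_plus; [exact IH|]. apply bigO_scal, (bigO_weaken N); [exact HMN|apply bigO_pow].
Qed.

Lemma bigO_psum_bounded (a : nat -> R) N : bigO 0 (fun l => psum (fun k => a k * (/ l) ^ k) N).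
Proof. apply bigO_psum. intros k _. apply bigO_scal, (bigO_weaken k); [lia|apply bigO_pow]. Qed.

Lemma bigO_cauchy_product (a b : nat -> R) M N :
  (M <= N)%nat ->
  bigO M (fun l => psum (fun k => a k * (/ l) ^ k) N * psum (fun k => b k * (/ l) ^ k) N
    - psum (fun i => psum (fun j => a j * b (i - j)%nat) (S i) * (/ l) ^ i) M).
Proof.
  intros HMN.
  apply (bigO_ext _ (fun l =>
    psum (fun k => a k * (/ l) ^ k) N * (psum (fun k => b k * (/ l) ^ k) N - psum (fun k => b k * (/ l) ^ k) M)
    + psum (fun m => b m * ((/ l) ^ m * (psum (fun k => a k * (/ l) ^ k) N - psum (fun k => a k * (/ l) ^ k) (M - m)))) M) _ 0).
  - intros l _ _.
    assert (Etri : psum (fun i => psum (fun j => a j * b (i - j)%nat) (S i) * (/ l) ^ i) M =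
       psum (fun m => psum (fun j => b m * (/ l) ^ m * (a j * (/ l) ^ j)) (M - m)) M).
    { rewrite psum_triangle. apply psum_ext. intros i _. rewrite Rmult_comm, <- psum_scal.
      apply psum_ext. intros j Hj.
      replace ((/ l) ^ i) with ((/ l) ^ (i - j) * (/ l) ^ j) by (rewrite <- pow_add; f_equal; lia). ring. }
    rewrite Etri.
    rewrite (psum_ext (fun m => b m * ((/ l) ^ m * (_ - _)))
      (fun m => psum (fun k => a k * (/ l) ^ k) N * (b m * (/ l) ^ m)
         + (-1) * psum (fun j => b m * (/ l) ^ m * (a j * (/ l) ^ j)) (M - m))).
    + rewrite psum_plus, !psum_scal. ring.
    + intros m _. rewrite psum_scal. ring.
  - apply bigO_plus.
    + apply (bigO_mult 0 M); [apply bigO_psum_bounded|apply bigO_psum_tail, HMN].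
    + apply bigO_psum. intros m Hm. apply bigO_scal.
      replace M with (m + (M - m))%nat at 1 by lia.
      apply bigO_mult; [apply bigO_pow|]. apply bigO_psum_tail. lia.
Qed.

(** Reversing the sum changes its sign. *)
Lemma alternating_convolution_odd (a : nat -> R) i :
  psum (fun j => (-1) ^ j * a j * a (2 * i + 1 - j)%nat) (S (2 * i + 1)) = 0.
Proof.
  set (s := psum _ _).
  assert (H : s = - s); [|lra].
  unfold s at 1. rewrite psum_rev.
  rewrite (psum_ext _ (fun j => -1 * ((-1) ^ j * a j * a (2 * i + 1 - j)%nat))).
  - rewrite psum_scal. unfold s. ring.
  - intros j Hj. replace (2 * i + 1 - (2 * i + 1 - j))%nat with j by lia.
    assert (E : (-1) ^ (2 * i + 1 - j) = -1 * (-1) ^ j).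
    { assert (E1 : (-1) ^ (2 * i + 1 - j) * (-1) ^ j = -1).
      { rewrite <- pow_add. replace (2 * i + 1 - j + j)%nat with (2 * i + 1)%nat by lia. rewrite pow_add, pow_mult. replace ((-1) ^ 2) with 1 by ring. rewrite pow1. ring. }
      assert (E2 : (-1) ^ j * (-1) ^ j = 1).
      { rewrite <- Rpow_mult_distr. replace (-1 * -1) with 1 by ring. apply pow1. }
      transitivity ((-1) ^ (2 * i + 1 - j) * ((-1) ^ j * (-1) ^ j)); [rewrite E2; ring|].
      rewrite <- Rmult_assoc, E1. ring. }
    rewrite E. ring.
Qed.

Lemma psum_even_odd (f : nat -> R) n :
  psum f (2 * n) = psum (fun k => f (2 * k)%nat + f (2 * k + 1)%nat) n.
Proof.
  induction n as [|n IH]; [reflexivity|].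
  replace (2 * S n)%nat with (S (S (2 * n))) by lia.
  change (psum f (2 * n) + f (2 * n)%nat + f (S (2 * n)) =
    psum (fun k => f (2 * k)%nat + f (2 * k + 1)%nat) n + (f (2 * n)%nat + f (2 * n + 1)%nat)).
  rewrite IH, Nat.add_1_r. ring.
Qed.

Lemma cpoly_product q N :
  (2 * q <= N)%nat ->
  bigO (2 * q) (fun l => cpoly N (/ l) * cpoly N (- / l) - psum (fun k => d k * ((/ l) ^ 2) ^ k) q).
Proof.
  intros Hq.
  apply (bigO_ext _ (fun l => psum (fun k => (-1) ^ k * c k * (/ l) ^ k) N * psum (fun k => c k * (/ l) ^ k) N
     - psum (fun i => psum (fun j => (-1) ^ j * c j * c (i - j)%nat) (S i) * (/ l) ^ i) (2 * q)) _ 0).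
  - intros l _ _. rewrite psum_even_odd.
    rewrite (psum_ext (fun k => psum (fun j => (-1) ^ j * c j * c (2 * k - j)%nat) (S (2 * k)) * (/ l) ^ (2 * k) + _)
       (fun k => d k * ((/ l) ^ 2) ^ k)).
    + rewrite Rmult_comm. unfold cpoly at 1 2. f_equal. f_equal. apply psum_ext. intros k _.
      replace (- / l) with (-1 * / l) by ring. rewrite Rpow_mult_distr. ring.
    + intros k _. rewrite alternating_convolution_odd. unfold d. rewrite psum_sum_n, pow_mult. ring.
  - apply (bigO_cauchy_product (fun k => (-1) ^ k * c k) c). exact Hq.
Qed.

Theorem corollary9 :
  let a : nat -> C := maclaurin (K := C_AbsRing) f0 in
  let b : nat -> C := maclaurin (K := C_AbsRing) f1 in
  let rho : nat -> C := fun n => (a n * b n)%C in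
  asymptotic_series rho
    (fun n : nat => - (1 / (2 * Rpower (INR n) (3 / 2)))) d.
Proof.
  intros a b rho q Hq.
  (* With 2q + 5 terms the defect is O(x^{2q+4}), and the division by x^3/2 still
     leaves more than the required O(x^{2q}). *)
  set (N := (2 * q + 5)%nat).
  destruct moment_asymptotic as (K & HK & Hasym).
  destruct (Hasym N) as (C & k0 & Heps). cbv zeta in Heps.
  change (forall k, (k0 <= k)%nat -> Rabs (rel_error K N k) <= C * node k ^ N) in Heps.
  destruct (defect_small K C q k0 HK Heps) as (T & k1 & HT & Hgap). fold N in Hgap.
  destruct (cpoly_product q N ltac:(unfold N; lia)) as (C2 & L & HL & HC2 & Hprod).
  destruct (cpoly_bounded N) as [D [HD Hpoly]].
  destruct (INR_unbounded (L * L)) as [k2 Hk2].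
  exists (C2 + D * Rabs C + 2 * T).
  exists (S (k0 + k1 + k2)). intros [|k] Hk; [lia|].
  unfold rho, a, b. rewrite rho_coefficients.
  specialize (Heps k ltac:(lia)). specialize (Hgap k ltac:(lia)).
  pose proof (INR_S_pos k) as Hn. pose proof (node_pos k) as Hx0. pose proof (node_le1 k) as Hx1.
  pose proof (node_sqr k) as Hx2.
  assert (Hl : L <= sqrt (INR (S k))).
  { rewrite <- (sqrt_square L) by lra. apply sqrt_le_1_alt. apply Rlt_le, Rlt_le_trans with (INR k2); [exact Hk2|apply le_INR; lia]. }
  specialize (Hprod _ Hl). change (/ sqrt (INR (S k))) with (node k) in Hprod.
  assert (Hg : 1 / (2 * Rpower (INR (S k)) (3 / 2)) = node k ^ 3 / 2).
  { replace (3 / 2) with (1 + / 2) by field. rewrite Rpower_plus, Rpower_1, Rpower_sqrt by exact Hn.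
    unfold node. pose proof (sqrt_lt_R0 _ Hn) as Hs. 
    rewrite pow_inv. rewrite <- (sqrt_sqrt (INR (S k))) at 1 by lra. field. lra. }
  rewrite Hg.
  assert (Hx3 : 0 < node k ^ 3) by (apply pow_lt, Hx0).
  assert (Hsum : sum_n (fun j : nat => (d j / INR (S k) ^ j)%R) (q - 1) = psum (fun j => d j * (node k ^ 2) ^ j) q).
  { rewrite psum_sum_n. replace (S (q - 1)) with q by lia. apply psum_ext. intros j _.
    rewrite Hx2, pow_inv. reflexivity. }
  rewrite Hsum, <- RtoC_div, <- RtoC_minus, Cmod_R.
  2:{ intros E. lra. }
  assert (Hmain : acoef (S k) * moment k =
     node k ^ 3 / 2 * (cpoly N (node k) * (cpoly N (- node k) + rel_error K N k)) + defect K N k).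
  { unfold defect, approx_solution. rewrite (moment_eq K N k HK), Rmult_1_l, <- envelope_product. field. lra. }
  replace (- (acoef (S k) * moment k) / - (node k ^ 3 / 2) - psum (fun j => d j * (node k ^ 2) ^ j) q)
    with ((cpoly N (node k) * cpoly N (- node k) - psum (fun j => d j * (node k ^ 2) ^ j) q)
      + cpoly N (node k) * rel_error K N k + 2 * (defect K N k * / node k ^ 3)).
  2:{ rewrite Hmain. field. lra. }
  assert (HM : (C2 + D * Rabs C + 2 * T) / INR (S k) ^ q
     = C2 * node k ^ (2 * q) + D * (Rabs C * node k ^ (2 * q)) + 2 * (T * node k ^ (2 * q))).
  { rewrite (pow_mult (node k)), Hx2, pow_inv. unfold Rdiv. ring. }
  rewrite HM.
  assert (Hpw : forall j, 0 <= node k ^ (2 * q + j) <= node k ^ (2 * q)).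
  { intros j. rewrite pow_add.
    assert (0 <= node k ^ (2 * q)) by (apply pow_le; lra).
    assert (0 <= node k ^ j <= 1).
    { split; [apply pow_le; lra|]. rewrite <- (pow1 j). apply pow_incr; lra. }
    nra. }
  eapply Rle_trans; [apply Rabs_triang|]. apply Rplus_le_compat.
  - eapply Rle_trans; [apply Rabs_triang|]. apply Rplus_le_compat; [exact Hprod|].
    rewrite Rabs_mult. apply Rmult_le_compat; try apply Rabs_pos; [apply Hpoly, node_Rabs|].
    eapply Rle_trans; [exact Heps|]. pose proof (Rle_abs C). destruct (Hpw 5%nat) as [H1 H2].
    fold N in H1, H2. pose proof (Rabs_pos C). nra.
  - rewrite Rabs_mult, (Rabs_right 2) by lra. apply Rmult_le_compat_l; [lra|].
    rewrite Rabs_mult, (Rabs_right (/ node k ^ 3)) by (apply Rle_ge, Rlt_le, Rinv_0_lt_compat, Hx3).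
    apply Rle_trans with (T * (/ INR (S k)) ^ (q + 2) * / node k ^ 3).
    + apply Rmult_le_compat_r; [apply Rlt_le, Rinv_0_lt_compat, Hx3|exact Hgap].
    + rewrite <- Hx2, <- pow_mult, Rmult_assoc. apply Rmult_le_compat_l; [exact HT|].
      replace (2 * (q + 2))%nat with (2 * q + 1 + 3)%nat by lia. rewrite (pow_add _ _ 3).
      rewrite Rmult_assoc, Rinv_r, Rmult_1_r by lra. apply Hpw.
Qed.
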